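(* Let $p$ be a prime number with $p\equiv 5\pmod 8$, let $\varepsilon_p>1$ be the fundamental unit of $k_0=\mathbb{Q}(\sqrt{p})$, let $h$ be the class number of $k_0$, let $a$ be a positive square-free integer coprime to $p$, and let $K=\mathbb{Q}(\sqrt{-a\varepsilon_p\sqrt{p}})$. Write $a=\prod_{i=1}^n q_i$ or $a=2\prod_{i=1}^n q_i$ with $q_1,\dots,q_n$ distinct odd primes, indexed so that the Legendre symbol $\left(\frac{p}{q_j}\right)=1$ for $1\le j\le m$ and $\left(\frac{p}{q_j}\right)=-1$ for $m+1\le j\le n$ (where $0\le m\le n$). Put $q_i^*=(-1)^{\frac{q_i-1}{2}}q_i$ for $1\le i\le n$. For $1\le j\le m$ let $x_j,y_j$ be natural integers with $x_j^2-py_j^2=q_j^{3h}$ and with $x_j$ odd, $y_j$ even if $q_j\equiv1\pmod 4$, and $x_j$ even, $y_j$ odd if $q_j\equiv 3\pmod 4$; put $\alpha_j=x_j+y_j\sqrt{p}$ and $$\alpha_j^*=\begin{cases}(-1)^{\frac{x_j+y_j-1}{2}}\alpha_j, & \text{if } q_j\equiv 1\pmod 4,\\ (-1)^{\frac{x_j+y_j-1}{2}}\alpha_j\sqrt{p}, & \text{if } q_j\equiv 3\pmod 4.\end{cases}$$ Then the Hilbert genus field $E$ of $K$ is: \begin{enumerate} \item if $a\equiv 1\pmod 4$: $E=K(\sqrt{q_1^*},\dots,\sqrt{q_n^*},\sqrt{\alpha_1^*},\dots,\sqrt{\alpha_m^*})$; \item if $a\equiv 3\pmod 4$: $E=K(\sqrt{-1},\sqrt{q_1^*},\dots,\sqrt{q_n^*},\sqrt{\alpha_1^*},\dots,\sqrt{\alpha_m^*})$;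 \item if $a=2\prod_{i=1}^n q_i$ and $\prod_{i=1}^n q_i\equiv1\pmod 4$: $E=K(\sqrt{2},\sqrt{q_1^*},\dots,\sqrt{q_n^*},\sqrt{\alpha_1^*},\dots,\sqrt{\alpha_m^*})$; \item if $a=2\prod_{i=1}^n q_i$ and $\prod_{i=1}^n q_i\equiv3\pmod 4$: $E=K(\sqrt{-2},\sqrt{q_1^*},\dots,\sqrt{q_n^*},\sqrt{\alpha_1^*},\dots,\sqrt{\alpha_m^*})$. \end{enumerate}
   Context: For a number field $k$, the Hilbert genus field of $k$ is the subfield of the Hilbert class field $H(k)$ fixed by $G^2$, where $G=\mathrm{Gal}(H(k)/k)$; equivalently, the maximal unramified abelian extension of $k$ of exponent $2$. (Such integers $x_j,y_j$ exist for each $j\le m$.) *)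

(* Defs.v *)
From mathcomp Require Export all_boot all_order all_algebra all_field.
From mathcomp Require Export boolp classical_sets functions cardinality.

Set Implicit Arguments.
Unset Strict Implicit.
Unset Printing Implicit Defensive.

Import Order.TTheory GRing.Theory Num.Theory.

Local Open Scope classical_set_scope.
Local Open Scope ring_scope.

(* Number fields are taken inside algC, the field of algebraic complex        *)
(* numbers, and represented by their sets of elements.                        *)

Definition subfield (F : set algC) : Prop :=
  [/\ F 1,
      forall x y, F x -> F y -> F (x - y)
    & forall x y, F x -> F y -> F (x / y)].

(* The subfield F(S); a subfield automatically contains Q, so that            *)
(* adjoin set0 S is Q(S).                                                     *)
Definition adjoin (F S : set algC) : set algC := smallest subfield (F `|` S).

Definition Qadjoin (S : set algC) : set algC := adjoin set0 S.

Definition ring_of_integers (F : set algC) : set algC :=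
  F `&` [set x | x \in Aint].

Definition unit_of_integers (F : set algC) (u : algC) : Prop :=
  [/\ u != 0, ring_of_integers F u & ring_of_integers F u^-1].

(* For F real quadratic, whose only roots of unity are 1 and -1. The order of *)
(* algC is partial: 1 < eps entails that eps is real.                         *)
Definition fundamental_unit (F : set algC) (eps : algC) : Prop :=
  [/\ unit_of_integers F eps,
      1 < eps
    & forall u, unit_of_integers F u ->
        exists k : int, u = eps ^ k \/ u = - eps ^ k].

(* Below, O is a subring of algC, given by its set of elements. *)

Definition ideal (O I : set algC) : Prop :=
  [/\ I `<=` O, I 0,
      forall x y, I x -> I y -> I (x + y)
    & forall r x, O r -> I x -> I (r * x)].

Definition nonzero_ideal (O I : set algC) : Prop :=
  ideal O I /\ exists2 x, I x & x != 0.

Definition prime_ideal (O P : set algC) : Prop :=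
  [/\ ideal O P, ~ P 1
    & forall x y, O x -> O y -> P (x * y) -> P x \/ P y].

Definition ideal_mul (O I J : set algC) : set algC :=
  smallest (ideal O) [set x * y | x in I & y in J].

Definition ideal_exp (O I : set algC) (n : nat) : set algC :=
  iter n (ideal_mul O I) O.

Definition ideal_equiv (O I J : set algC) : Prop :=
  exists a b, [/\ O a, O b, a != 0, b != 0
    & [set a * x | x in I] = [set b * x | x in J]].

Definition ideal_class (O I : set algC) : set (set algC) :=
  [set J | nonzero_ideal O J /\ ideal_equiv O I J].

Definition ideal_classes (O : set algC) : set (set (set algC)) :=
  [set ideal_class O I | I in nonzero_ideal O].

Definition class_number (F : set algC) (h : nat) : Prop :=
  (ideal_classes (ring_of_integers F) #= `I_h)%card.

(* Field homomorphisms and automorphisms of a subfield L are represented by   *)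
(* functions on algC, of which only the values on L matter.                   *)

Definition embedding (L : set algC) (s : algC -> algC) : Prop :=
  [/\ s 1 = 1,
      forall x y, L x -> L y -> s (x + y) = s x + s y
    & forall x y, L x -> L y -> s (x * y) = s x * s y].

Definition galois_group (K L : set algC) : set (algC -> algC) :=
  [set s | [/\ embedding L s, s @` L = L & forall x, K x -> s x = x]].

Definition finite_extension (K L : set algC) : Prop :=
  [/\ subfield K, subfield L, K `<=` L
    & exists (d : nat) (b : 'I_d -> algC), forall x,
        L x -> exists2 c : 'I_d -> algC,
          (forall i, K (c i)) & x = \sum_(i < d) c i * b i].

Definition fixed_field (L : set algC) (G : set (algC -> algC)) : set algC :=
  [set x | L x /\ forall s, G s -> s x = x].

Definition abelian_extension (K L : set algC) : Prop :=
  [/\ finite_extension K L,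
      fixed_field L (galois_group K L) = K
    & forall s t, galois_group K L s -> galois_group K L t ->
        forall x, L x -> s (t x) = t (s x)].

(* The exponent of the prime Q of L in the factorisation of P O_L, where      *)
(* P = Q `&` O_K and P O_L is the ideal generated by P in O_L.                *)
Definition ramification_index (K L Q : set algC) (e : nat) : Prop :=
  let OL := ring_of_integers L in
  let POL := smallest (ideal OL) (Q `&` ring_of_integers K) in
  POL `<=` ideal_exp OL Q e /\ ~ (POL `<=` ideal_exp OL Q e.+1).

(* Residue fields are finite, so separability is automatic.                   *)
Definition unramified_finite_places (K L : set algC) : Prop :=
  forall Q, nonzero_ideal (ring_of_integers L) Q ->
    prime_ideal (ring_of_integers L) Q -> ramification_index K L Q 1.

(* No complex place of L lies above a real place of K.                        *)
Definition unramified_infinite_places (K L : set algC) : Prop :=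
  forall s, embedding L s -> (forall x, K x -> s x \is Num.real) ->
    forall x, L x -> s x \is Num.real.

Definition unramified_abelian_extension (K L : set algC) : Prop :=
  [/\ abelian_extension K L, unramified_finite_places K L
    & unramified_infinite_places K L].

(* The maximal unramified abelian extension of K, as the compositum of all    *)
(* the finite ones; finiteness of this compositum is not built in.            *)
Definition hilbert_class_field (K : set algC) : set algC :=
  adjoin K (\bigcup_(L in unramified_abelian_extension K) L).

(* The field fixed by the squares of G = Gal(H(K)/K), which generate (and, as *)
(* G is abelian, constitute) G^2.                                             *)
Definition hilbert_genus_field (K : set algC) : set algC :=
  let H := hilbert_class_field K in
  fixed_field H [set s \o s | s in galois_group K H].

(* Legendre symbol (a / q), meaningful for q an odd prime.                    *)
Definition legendre (a q : nat) : int :=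
  if (q %| a)%N then 0
  else if [exists x : 'I_q, x ^ 2 == a %[mod q]]%N then 1 else -1.

Definition square_free (a : nat) : Prop :=
  forall d : nat, (d ^ 2 %| a)%N -> d = 1%N.

Definition q_star (q : nat) : algC := (-1) ^+ (q.-1)./2 * q%:R.

Definition alpha (p x y : nat) : algC := x%:R + y%:R * sqrtC p%:R.

Definition alpha_star (p q x y : nat) : algC :=
  let sgn_alpha := (-1) ^+ ((x + y).-1)./2 * alpha p x y in
  if (q %% 4 == 1)%N then sgn_alpha else sgn_alpha * sqrtC p%:R.

(* Main.v *)
(* For K = k0(sqrt(- a eps sqrt p)), unramifiedness is tested with discrete
   valuations: a normal extension L/K is unramified exactly when every valuation
   of L takes the value 1 on K. Composita of unramified abelian extensions are
   again unramified (an automorphism acting trivially modulo a prime is trivial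
   on each factor), so the Hilbert class field is exhausted by finite ones, and
   the genus field is generated by the y in it with y^2 in K.
   Upper bound: y^2 has even valuations, so its norm to k0 is a totally positive
   element with even valuations, hence a square since N(eps) = -1; Hilbert 90
   gives y^2 = delta z^2 with delta in k0. Comparing valuations over 2, p and the
   q_i (the alpha_j compensate for the split primes, as the class number is odd)
   shows that, modulo squares, delta lies in the group generated by -1, eps, 2,
   sqrt p, the q_i and the alpha_j. That group is generated modulo squares of K
   by the elements whose square roots are adjoined together with -1, sqrt p and
   2, and of these latter classes only the asserted ones survive: if s lies in an
   unramified extension, s^2 - 1 cannot have odd valuation less than 2 w(2).
   Lower bound: each adjoined root is that of an element which, up to squares, is
   a unit away from 2 and congruent to 1 modulo 4 above 2. *)

From HB Require Import structures.
Require Import Defs.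
From mathcomp Require Import ring lra zify.

Set Implicit Arguments.
Unset Strict Implicit.
Unset Printing Implicit Defensive.

Import Order.TTheory GRing.Theory Num.Theory.

Local Open Scope classical_set_scope.
Local Open Scope ring_scope.

(** Finiteness enters through [numfield_dep]: among any [d + 1] elements of a number field, [d]
    depending only on the field, there is an integer relation with a coefficient prime to [l]. The
    valuation of a prime ideal is built from this alone. Galois theory is done with automorphisms of
    algC. The class number is odd because conjugation on ideal classes fixes only the principal
    class: Hilbert 90 and N(eps) = -1 turn an ambiguous class into a stable ideal, and the only
    ramified prime is principal, generated by sqrt p. As [3 * h] is then odd, the values of alpha_j
    at the two conjugate valuations above q_j have different parity. At 2 everything rests on the
    congruence eps^3 sqrt p = -1 modulo 4, which makes eps times the generator of K a square root of
    [a] modulo 4. It decides whether 2 ramifies in K over k0, leads to a uniformizer when it does,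
    and shows when -1, 2 or -2 is a square modulo 4 up to squares of K. The generator of K has a
    square that is negative under both embeddings of k0, so complex conjugation generates Gal(K/k0),
    norms are totally positive, and the infinite places impose no condition. *)

Local Notation aut := {rmorphism algC -> algC}.
Local Notation QQ := (range (ratr : rat -> algC)).

(** * Subfields and number fields *)

Section Subfield.
Variables (F : set algC) (SF : subfield F).

Lemma sf1 : F 1. Proof. by case: SF. Qed.
Lemma sfB x y : F x -> F y -> F (x - y). Proof. by case: SF => _ + _; apply. Qed.
Lemma sf_div x y : F x -> F y -> F (x / y). Proof. by case: SF => _ _; apply. Qed.
Lemma sf0 : F 0. Proof. by rewrite -(subrr 1); apply: sfB sf1 sf1. Qed.
Lemma sfN x : F x -> F (- x). Proof. by rewrite -sub0r; apply: sfB sf0. Qed.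
Lemma sfD x y : F x -> F y -> F (x + y).
Proof. by move=> Fx Fy; rewrite -[y]opprK; apply: sfB Fx (sfN Fy). Qed.
Lemma sfV x : F x -> F x^-1.
Proof. by rewrite -div1r; apply: sf_div sf1. Qed.
Lemma sfM x y : F x -> F y -> F (x * y).
Proof. by move=> Fx Fy; rewrite -[y]invrK; apply: sf_div Fx (sfV Fy). Qed.
Lemma sfX x n : F x -> F (x ^+ n).
Proof. by move=> Fx; elim: n => [|n IHn]; [exact: sf1 | rewrite exprS; apply: sfM]. Qed.
Lemma sf_nat n : F n%:R.
Proof. by elim: n => [|n IHn]; [exact: sf0 | rewrite -natr1; apply: sfD sf1]. Qed.
Lemma sf_int (n : int) : F n%:~R.
Proof. by case: n => n; rewrite ?NegzE ?mulrNz; [|apply: sfN]; apply: sf_nat. Qed.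
Lemma sf_rat (q : rat) : F (ratr q).
Proof. by apply: sf_div; apply: sf_int. Qed.
Lemma sfXz x (n : int) : F x -> F (x ^ n).
Proof. by move=> Fx; case: n => n; [|apply: sfV]; apply: sfX. Qed.
Lemma sf_sum I (r : seq I) (P : pred I) (f : I -> algC) :
  (forall i, P i -> F (f i)) -> F (\sum_(i <- r | P i) f i).
Proof. by move=> Ff; elim/big_ind: _ => //; [exact: sf0 | exact: sfD]. Qed.
Lemma sf_sum_seq (I : eqType) (r : seq I) (f : I -> algC) :
  (forall i, i \in r -> F (f i)) -> F (\sum_(i <- r) f i).
Proof. by move=> Ff; rewrite big_seq; apply: sf_sum. Qed.
Lemma sf_horner (p : {poly algC}) x : (forall i, F p`_i) -> F x -> F p.[x].
Proof.
by move=> Fp Fx; rewrite horner_coef; apply: sf_sum => i _; apply: sfM (sfX _ Fx).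
Qed.
Lemma sf_hornerQ (p : {poly rat}) x : F x -> F (map_poly ratr p).[x].
Proof. by apply: sf_horner => i; rewrite coef_map; apply: sf_rat. Qed.

End Subfield.

Ltac insf := repeat first [ assumption | match goal with SF : subfield ?F |- ?F ?t =>
  match t with
  | 1 => exact: (sf1 SF)
  | 0 => exact: (sf0 SF)
  | _ + - _ => apply: (sfB SF)
  | _ + _ => apply: (sfD SF)
  | - _ => apply: (sfN SF)
  | _ * _ => apply: (sfM SF)
  | _ ^+ _ => apply: (sfX SF)
  | _ ^-1 => apply: (sfV SF)
  | _%:R => exact: (sf_nat SF)
  | _%:~R => exact: (sf_int SF)
  | ratr _ => exact: (sf_rat SF)
  | exprz _ _ => apply: (sfXz SF)
  | _ *+ _ => rewrite -mulr_natr
  | _ *~ _ => rewrite -mulrzr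
  end end].

Lemma subfield_bigcap (C : set (set algC)) :
  (forall A, C A -> subfield A) -> subfield (\bigcap_(A in C) A).
Proof.
move=> CP; split=> [A CA | x y Ax Ay A CA | x y Ax Ay A CA].
- exact: sf1 (CP A CA).
- by apply: (sfB (CP A CA)); [apply: Ax | apply: Ay].
- by apply: (sf_div (CP A CA)); [apply: Ax | apply: Ay].
Qed.

Lemma subfield_adjoin F S : subfield (adjoin F S).
Proof. by apply: subfield_bigcap => A []. Qed.

Lemma adjoin_subl F S : F `<=` adjoin F S.
Proof. by move=> x Fx; apply: sub_gen_smallest; left. Qed.

Lemma adjoin_subr F S : S `<=` adjoin F S.
Proof. by move=> x Sx; apply: sub_gen_smallest; right. Qed.

Lemma adjoin_min F S A : subfield A -> F `<=` A -> S `<=` A -> adjoin F S `<=` A.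
Proof. by move=> SA FA SSA; apply: smallest_sub => // x []; [apply: FA | apply: SSA]. Qed.

Lemma subfield_rat : subfield (range (ratr : rat -> algC)).
Proof.
split=> [|_ _ [x _ <-] [y _ <-]|_ _ [x _ <-] [y _ <-]].
- by exists 1; rewrite ?rmorph1.
- by exists (x - y); rewrite ?rmorphB.
- by exists (x / y); rewrite ?fmorph_div.
Qed.

Local Notation evQ p z := (map_poly ratr p).[z].

(** A primitive element with polynomials instead of a basis: an automorphism of algC is known on [F]
    from the image of [th] alone. *)
Definition numfield (F : set algC) :=
  subfield F /\ exists2 th, F th & forall x, F x -> exists p : {poly rat}, x = evQ p th.

(** Closure under division is read off from a finite extension of rat generated by a preimage of
    [z], where every element is a polynomial in the generator. *)
Lemma subfield_evQ (z : algC) : subfield [set evQ p z | p in [set: {poly rat}]].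
Proof.
have [Qs [QsC [s1 Ds gens]]] := num_field_exists [:: z].
case: s1 Ds gens => [//|z0 [|//]] [Dz] gens; rewrite adjoin_seq1 in gens.
have im x : exists p : {poly rat}, QsC x = evQ p z.
  have /Fadjoin1_polyP[p ->] : x \in <<1; z0>>%VS by rewrite gens memvf.
  exists p; rewrite -horner_map /= -map_poly_comp Dz; congr _.[z].
  by apply: eq_map_poly => b /=; rewrite alg_num_field fmorph_rat.
have imK (p : {poly rat}) : QsC (map_poly (in_alg Qs) p).[z0] = evQ p z.
  rewrite -horner_map /= -map_poly_comp Dz; congr _.[z].
  by apply: eq_map_poly => b /=; rewrite alg_num_field fmorph_rat.
split=> [|_ _ [p _ <-] [q _ <-]|_ _ [p _ <-] [q _ <-]].
- by exists 1; rewrite ?rmorph1 ?hornerC.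
- by exists (p - q) => //; rewrite rmorphB hornerD hornerN.
- by rewrite -!imK -fmorph_div; set t := (X in QsC X); have [r ->] := im t; exists r.
Qed.

Lemma numfield_adjoin_seq F (s : seq algC) :
  numfield F -> numfield (adjoin F [set` s]).
Proof.
case=> SF [th Fth genF]; split; first exact: subfield_adjoin.
have [z /sig_eqW [a Dz] /sig_eqW [ps Ds]] := algC_PET (th :: s).
have SA := subfield_adjoin F [set` s].
exists z.
  rewrite Dz; apply: (sf_sum SA) => -[i ltis] _ /=; insf.
  case: i ltis => [|i] /= lti; first exact: adjoin_subl.
  by apply: adjoin_subr; rewrite /= mem_nth.
have Sz := subfield_evQ z.
have s_z x : x \in th :: s -> range (fun p : {poly rat} => evQ p z) x.
  by rewrite Ds => /mapP[p _ ->]; exists p.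
have : adjoin F [set` s] `<=` range (fun p : {poly rat} => evQ p z).
  apply: adjoin_min => // x; last by move=> sx; apply: s_z; rewrite inE sx orbT.
  move=> /genF[p ->]; apply: (sf_hornerQ Sz).
  by apply: s_z; rewrite mem_head.
by move=> + x xA => /(_ x xA) [p _ <-]; exists p.
Qed.

Lemma numfield_rat : numfield (range (ratr : rat -> algC)).
Proof.
split; first exact: subfield_rat.
exists 0; first by exists 0; rewrite ?rmorph0.
by move=> _ [q _ <-]; exists q%:P; rewrite map_polyC hornerC.
Qed.

Lemma Qadjoin_rat S : Qadjoin S = adjoin (range ratr) S.
Proof.
apply/seteqP; split; apply: adjoin_min.
- exact: subfield_adjoin.
- by [].
- exact: adjoin_subr.
- exact: subfield_adjoin.
- by move=> _ [q _ <-]; apply: (sf_rat (subfield_adjoin _ _)).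
- exact: adjoin_subr.
Qed.

Lemma numfield_Qadjoin_seq (s : seq algC) : numfield (Qadjoin [set` s]).
Proof. by rewrite Qadjoin_rat; apply: numfield_adjoin_seq numfield_rat. Qed.

Lemma adjoin_eq F S T : S `<=` adjoin F T -> T `<=` adjoin F S -> adjoin F S = adjoin F T.
Proof.
move=> ST TS; apply/seteqP; split; apply: adjoin_min => //;
  by [apply: subfield_adjoin | apply: adjoin_subl].
Qed.

(** Among the finite families in [F], one whose rational span has maximal dimension spans [F], so
    [F] is generated by finitely many algebraic numbers. *)
Lemma numfield_sub F N : numfield N -> subfield F -> F `<=` N -> numfield F.
Proof.
move=> [SN [th Nth genN]] SF sFN.
have [Qs [QsC [s1 Ds gens]]] := num_field_exists [:: th].
case: s1 Ds gens => [//|z0 [|//]] [Dz] gens; rewrite adjoin_seq1 in gens.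
have imN x : N x -> exists y, QsC y = x.
  move=> /genN[p ->]; exists (map_poly (in_alg Qs) p).[z0].
  rewrite -horner_map /= -map_poly_comp Dz; congr _.[th].
  by apply: eq_map_poly => b /=; rewrite alg_num_field fmorph_rat.
pose P (d : nat) := `[< exists2 s : seq Qs, (forall x, x \in s -> F (QsC x))
   & \dim <<s>>%VS = d >].
have P0 : exists d, P d.
  by exists 0%N; apply/asboolP; exists [::] => //; rewrite span_nil dimv0.
have Pb d : P d -> (d <= \dim {: Qs})%N.
  by move/asboolP => [s _ <-]; apply: dimvS; apply: subvf.
case: (ex_maxnP P0 Pb) => d /asboolP[s Fs ds] maxd.
have genF x : F x -> exists2 y, y \in <<s>>%VS & QsC y = x.
  move=> Fx; have [y Dy] := imN _ (sFN _ Fx); exists y => //.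
  have sub : (<<s>> <= <<y :: s>>)%VS by rewrite span_cons addvSr.
  have := maxd (\dim <<y :: s>>%VS); rewrite -ds => le.
  have {}le : (\dim <<y :: s>>%VS <= \dim <<s>>%VS)%N.
    apply: le; apply/asboolP; exists (y :: s) => // t; rewrite inE => /predU1P[->|/Fs//].
    by rewrite Dy.
  have /eqP -> : (<<s>> == <<y :: s>>)%VS by rewrite eqEdim sub.
  by apply: memv_span; rewrite mem_head.
have -> : F = Qadjoin [set` map QsC s]; last exact: numfield_Qadjoin_seq.
apply/seteqP; split; last first.
  by apply: adjoin_min => // _ /mapP[x sx ->]; apply: Fs.
have SA := subfield_adjoin set0 [set` map QsC s].
move=> _ /genF[y ys <-]; have /coord_span -> : y \in <<in_tuple s>>%VS := ys.
rewrite rmorph_sum; apply: (sf_sum SA) => i _ /=.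
rewrite rmorphZ_num; insf.
by apply: adjoin_subr => /=; apply: map_f; apply: mem_nth.
Qed.

Definition fixes (K : set algC) (nu : algC -> algC) := forall x, K x -> nu x = x.

Lemma aut_evQ (nu : {rmorphism algC -> algC}) (p : {poly rat}) z :
  nu (evQ p z) = evQ p (nu z).
Proof.
rewrite -horner_map -map_poly_comp; congr _.[_]; apply: eq_map_poly => q /=.
by rewrite fmorph_rat.
Qed.

(** The conjugates of [th] and [y] generate a splitting field, Galois over Q(th). Each of its
    automorphisms extends to algC, so the finite Galois correspondence applies to [y]. *)
Lemma galois_fixed K y : numfield K ->
  (forall nu : {rmorphism algC -> algC}, fixes K nu -> nu y = y) -> K y.
Proof.
move=> [SK [th Kth genK]] fixy.
have [pt [Dpt mon_pt] _] := minCpolyP th.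
have [py [Dpy mon_py] _] := minCpolyP y.
pose p := pt * py.
have [r Dr] := closed_field_poly_normal (map_poly ratr p : {poly algC}).
have p1 : p \is monic by rewrite monicMl.
rewrite lead_coef_map (monicP p1) rmorph1 scale1r in Dr.
have rth : th \in r.
  by rewrite -root_prod_XsubC -Dr rmorphM rootM /= -Dpt root_minCpoly.
have ry : y \in r.
  by rewrite -root_prod_XsubC -Dr rmorphM rootM /= -Dpy root_minCpoly orbT.
have [Qs [QsC [s1 Ds gens]]] := num_field_exists r.
have ax : splitting_field_axiom Qs.
  exists (map_poly (in_alg Qs) p); first by apply: alg_polyOver.
  exists s1 => //; apply/eqpP; exists (1, 1); rewrite ?oner_neq0 // !scale1r.
  apply: (map_poly_inj QsC); rewrite -map_poly_comp.
  rewrite (@eq_map_poly _ _ _ ratr); last first.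
    by move=> b /=; rewrite alg_num_field fmorph_rat.
  rewrite Dr -Ds big_map rmorph_prod; apply: eq_bigr => i _ /=.
  by rewrite map_polyXsubC.
pose LM := FieldExt_isSplittingField.Build _ Qs ax.
pose L : splittingFieldType rat := HB.pack Qs LM.
pose LC : {rmorphism L -> algC} := QsC.
have [th0 Dth] : exists th0 : L, LC th0 = th.
  by move: rth; rewrite -Ds => /mapP[t _ ->]; exists t.
have [y0 Dy] : exists y0 : L, LC y0 = y.
  by move: ry; rewrite -Ds => /mapP[t _ ->]; exists t.
have galL : galois <<1; th0>>%AS {:L}%AS.
  apply/and3P; split; first exact: subvf.
    apply/separableP => z _; apply: pcharf0_separable.
    by move=> q; rewrite pchar_lalg pchar_num.
  apply/splitting_normalField; first exact: subvf.
  have [q q1 [rs Dq genq]] := ax; exists q.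
    by apply: polyOverS q1 => z; apply: subvP; apply: sub1v.
  exists rs => //; apply/eqP; rewrite eqEsubv subvf /= -genq.
  by apply: adjoin_seqSl; apply: sub1v.
have : y0 \in fixedField ('Gal({:L}%AS / <<1; th0>>%AS))%g.
  apply/fixedFieldP => [|g gG]; first exact: memvf.
  have [nu Dnu] := extend_algC_subfield_aut LC (gal_repr g).
  apply: (fmorph_inj LC); rewrite Dnu Dy fixy // => x /genK[q ->].
  rewrite aut_evQ; congr _.[_]; rewrite -Dth -Dnu; congr (LC _).
  by apply: (fixed_gal _ gG); [exact: subvf | exact: memv_adjoin].
rewrite (galois_fixedField galL) => /Fadjoin1_polyP[q Dq].
rewrite -Dy Dq -horner_map -map_poly_comp Dth; set P := map_poly _ _.
have -> : P = map_poly ratr q.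
  by apply: eq_map_poly => b /=; rewrite alg_num_field fmorph_rat.
exact: (sf_hornerQ SK).
Qed.

Lemma numfield_im F : numfield F ->
  exists (Qs : fieldExtType rat) (QsC : {rmorphism Qs -> algC}),
    forall x, F x -> exists y, QsC y = x.
Proof.
move=> [_ [th _ genF]].
have [Qs [QsC [s1 Ds gens]]] := num_field_exists [:: th].
case: s1 Ds gens => [//|z0 [|//]] [Dz] _; exists Qs, QsC => x /genF[p ->].
exists (map_poly (in_alg Qs) p).[z0].
rewrite -horner_map /= -map_poly_comp Dz; congr _.[th].
by apply: eq_map_poly => b /=; rewrite alg_num_field fmorph_rat.
Qed.

(** After clearing denominators, divide by [l] as long as all coefficients are divisible; the
    absolute value of [n i0] decreases. *)
Lemma int_dep d (v : 'I_d -> rat) (l : nat) i0 : v i0 != 0 -> (1 < l)%N ->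
  exists2 c : rat, c != 0 & exists n : 'I_d -> int,
    (forall i, (n i)%:~R = c * v i) /\ (exists i, ~~ (l %| n i)%Z).
Proof.
move=> v0 l1.
pose N := \prod_(i < d) denq (v i).
have N0 : N != 0 by apply/prodf_neq0 => i _; rewrite denq_neq0.
have [n Dn] : exists n : 'I_d -> int, forall i, (n i)%:~R = N%:~R * v i.
  exists (fun i => (\prod_(j < d | j != i) denq (v j)) * numq (v i)) => i.
  rewrite [in RHS]/N (bigD1 i isT) /= !intrM -[X in _ = _ * X]divq_num_den.
  have : (denq (v i))%:~R != 0 :> rat by rewrite intr_eq0 denq_neq0.
  set P := (\prod_(j < d | _) _); move=> d0; field; exact: d0.
have n0 : n i0 != 0.
  by rewrite -(intr_eq0 rat) Dn mulf_neq0 // intr_eq0.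
have c0 : N%:~R != 0 :> rat by rewrite intr_eq0.
move: (N%:~R) n0 c0 Dn (ltnSn `|n i0|%N) => {N N0} c.
move: {2}(`|n i0|%N).+1 => m; elim: m c n => // k IHk c n n0 c0 Dn le_n.
case: (pselect (exists i, ~~ (l %| n i)%Z)) => [ex|nex].
  by exists c => //; exists n.
have dv i : (l %| n i)%Z by apply: contrapT => /negP ndv; apply: nex; exists i.
pose n' i := (n i %/ l)%Z.
have Dn' i : n i = n' i * l%:Z by rewrite /n' divzK.
have l0 : l%:R != 0 :> rat by rewrite pnatr_eq0; case: (l) l1.
apply: (IHk (c / l%:R) n').
- by apply: contraNneq n0 => e; rewrite Dn' e mul0r.
- by rewrite mulf_neq0 ?invr_eq0.
- move=> i; apply: (mulIf l0).
  by rewrite [RHS]mulrAC divfK // -Dn [in RHS]Dn' intrM.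
- have := Dn' i0; have : n' i0 != 0.
    by apply: contraNneq n0 => e; rewrite Dn' e mul0r.
  by move: le_n l1; clear; nia.
Qed.

(** A rational linear dependence, made primitive at [l]. It serves wherever an integral basis or the
    finiteness of O/l would be invoked. *)
Lemma numfield_dep F : numfield F -> exists d : nat, forall (l : nat) (x : nat -> algC),
  (1 < l)%N -> (forall i, (i <= d)%N -> F (x i)) ->
  exists n : nat -> int, (exists2 i, (i <= d)%N & ~~ (l %| n i)%Z) /\
     \sum_(i < d.+1) (n i)%:~R * x i = 0.
Proof.
move=> NF; have [Qs [QsC im]] := numfield_im NF.
exists (\dim {:Qs}) => l x l1 Fx; set d := \dim _ in Fx *.
have im' i : exists y, (i <= d)%N -> QsC y = x i.
  case: (leqP i d) => [le|]; last by exists 0.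
  by have [y Dy] := im _ (Fx i le); exists y.
have [y Dy] := choice im'.
pose X := [tuple of mkseq y d.+1].
have nfree : ~~ free X.
  apply/negP; rewrite /free size_tuple => /eqP e.
  by have := dimvS (subvf <<X>>%VS); rewrite e ltnn.
have [v [v0 [i0 vi0]]] : exists v : 'I_d.+1 -> rat,
    \sum_i v i *: X`_i = 0 /\ exists i, v i != 0.
  apply: contrapT => nex; move/negP: nfree; apply; apply/freeP => v v0 i.
  apply: contrapT => /eqP vi; apply: nex; exists v; split => //; by exists i.
have [c c0 [n [Dn [i ndv]]]] := int_dep vi0 l1.
exists (fun i => if insub i is Some i' then n i' else 0); split.
  exists i; first by rewrite -ltnS.
  by rewrite valK.
have {v0} := congr1 (fun t => ratr c * QsC t) v0.
rewrite rmorph0 mulr0 rmorph_sum mulr_sumr => {2}<-; apply: eq_bigr => j _.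
rewrite valK rmorphZ_num mulrA -rmorphM /= -Dn ratr_int; congr (_ * _).
by rewrite /= nth_mkseq // Dy // -ltnS.
Qed.

Lemma Aint_integral u : u \in Aint <-> integralOver (intr : int -> algC) u.
Proof.
split=> [Au | [p monp pu]].
  have /floorpP[p Dp] := Au; exists p; last by rewrite -Dp root_minCpoly.
  have := minCpoly_monic u; rewrite Dp !monicE lead_coef_map_inj //; last exact: intr_inj.
  by rewrite /= (eqr_int _ _ 1).
apply: root_monic_Aint pu _ _.
  by rewrite monicE lead_coef_map_inj ?(monicP monp) //; apply: intr_inj.
by apply/polyOverP => i; rewrite coef_map /= intr_int.
Qed.

Lemma Aint_root_monic (p : {poly algC}) u :
  p \is monic -> root p u -> (forall i, p`_i \in Aint) -> u \in Aint.
Proof.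
move=> monp pu Ap; apply/Aint_integral/(integral_root_monic monp pu).
by apply/integral_poly => i; apply/Aint_integral/Ap.
Qed.

(** Multiplied by the power [m - 1] of [c m], the relation becomes a monic equation for
    [c m * z]. *)
Lemma Aint_lead m (c : nat -> algC) z :
  (forall i, (i <= m)%N -> c i \in Aint) -> \sum_(i < m.+1) c i * z ^+ i = 0 ->
  c m * z \in Aint.
Proof.
case: m => [|m] Ac; first by rewrite big_ord1 expr0 mulr1 => ->; rewrite mul0r.
move=> e0; pose a := c m.+1; pose e i := if (i <= m)%N then c i * a ^+ (m - i) else (i == m.+1)%:R.
have De i : (i <= m)%N -> e i = c i * a ^+ (m - i) by rewrite /e => ->.
have De1 : e m.+1 = 1 by rewrite /e ltnn eqxx.
have mon : \poly_(i < m.+2) e i \is monic.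
  by rewrite monicE lead_coef_poly // ?De1 // oner_neq0.
apply: (Aint_root_monic mon).
  rewrite /root horner_poly big_ord_recr /= De1 mul1r; apply/eqP.
  transitivity (a ^+ m * \sum_(i < m.+2) c i * z ^+ i); last by rewrite e0 mulr0.
  rewrite [in RHS]big_ord_recr /= mulrDr mulr_sumr; congr (_ + _); last first.
    by rewrite exprMn exprS -/a; ring.
  apply: eq_bigr => i _; have le : (i <= m)%N by rewrite -ltnS.
  have -> : a ^+ m = a ^+ (m - i) * a ^+ i by rewrite -exprD subnK.
  by rewrite De // exprMn -/a; ring.
move=> i; rewrite coef_poly; case: ifP => // _; rewrite /e; case: ifP => [le|_].
  by rewrite rpredM ?rpredX ?Ac // leqW.
by rewrite rpred_nat.
Qed.

(** * Rings of integers *)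

Section RingOfIntegers.
Variables (F : set algC) (SF : subfield F).
Local Notation O := (ring_of_integers F).
Lemma ri1 : O 1. Proof. by split; [exact: sf1 | exact: Aint1]. Qed.
Lemma ri0 : O 0. Proof. by split; [exact: sf0 | exact: Aint0]. Qed.
Lemma riD x y : O x -> O y -> O (x + y).
Proof. by move=> [? Ax] [? Ay]; split; [insf | apply: rpredD]. Qed.
Lemma riN x : O x -> O (- x).
Proof. by move=> [? Ax]; split; [insf | rewrite /= rpredN]. Qed.
Lemma riB x y : O x -> O y -> O (x - y).
Proof. by move=> Ox Oy; apply: riD (riN Oy). Qed.
Lemma riM x y : O x -> O y -> O (x * y).
Proof. by move=> [? Ax] [? Ay]; split; [insf | apply: rpredM]. Qed.
Lemma riX x n : O x -> O (x ^+ n).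
Proof. by move=> [? Ax]; split; [insf | apply: rpredX]. Qed.
Lemma ri_int (n : int) : O n%:~R.
Proof. by split; [insf | exact: Aint_int]. Qed.
Lemma ri_nat (n : nat) : O n%:R.
Proof. exact: (ri_int n). Qed.
Lemma ri_sum I (r : seq I) (P : pred I) (f : I -> algC) :
  (forall i, P i -> O (f i)) -> O (\sum_(i <- r | P i) f i).
Proof. by move=> Of; elim/big_ind: _ => //; [exact: ri0 | exact: riD]. Qed.
End RingOfIntegers.

Ltac inri := repeat first [ assumption | match goal with SF : subfield ?F |- ring_of_integers ?F ?t =>
  match t with
  | 1 => exact: (ri1 SF)
  | 0 => exact: (ri0 SF)
  | _ + - _ => apply: (riB SF)
  | _ + _ => apply: (riD SF)
  | - _ => apply: (riN SF)
  | _ * _ => apply: (riM SF)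
  | _ ^+ _ => apply: (riX SF)
  | _%:R => exact: (ri_nat SF)
  | _%:~R => exact: (ri_int SF)
  | _ *+ _ => rewrite -mulr_natr
  | _ *~ _ => rewrite -mulrzr
  end end].

Lemma big_split_at (R : nzRingType) (c : nat -> R) m j : (j < m)%N ->
  \sum_(i < m) c i = \sum_(i < j) c i + (c j + \sum_(i < m - j.+1) c (j.+1 + i)%N).
Proof.
move=> ltjm; rewrite -!(big_mkord xpredT c) (big_cat_nat (leq0n j) (ltnW ltjm)) /=.
congr (_ + _); rewrite big_ltn //; congr (_ + _).
rewrite -{1}[j.+1]add0n big_addn big_mkord; apply: eq_bigr => i _.
by rewrite addnC.
Qed.

(** The integral equation of [x], divided by the largest possible power of [x], has a nonzero
    constant term, which is then a multiple of [x]. *)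
Lemma Aint_dvd_int F x : subfield F -> ring_of_integers F x -> x != 0 ->
  exists2 n : int, n != 0 & exists2 y, ring_of_integers F y & n%:~R = x * y.
Proof.
move=> SF Ox x0; have [_ /= Ax] := Ox; have /floorpP[p Dp] := Ax.
have p0 : p != 0.
  by apply: contraFneq (minCpoly_eq0 x) => e; rewrite Dp e rmorph0.
have ex : exists i, p`_i != 0.
  by exists (size p).-1; rewrite -lead_coefE lead_coef_eq0.
case: (ex_minnP ex) => j pj minj; exists p`_j => //.
have ltj : (j < size p)%N.
  by rewrite ltnNge; apply: contraNN pj => le; rewrite nth_default.
have := root_minCpoly x; rewrite Dp /root horner_coef size_map_inj_poly //; last exact: intr_inj.
rewrite (@big_split_at _ (fun i => (map_poly intr p)`_i * x ^+ i) _ _ ltj).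
rewrite big1 ?add0r => [|i _]; last first.
  have : ~~ (p`_i != 0) by apply: contraL (ltn_ord i) => /minj; rewrite -leqNgt.
  by rewrite negbK coef_map => /eqP ->; rewrite mul0r.
set S := \sum_(i < _) _.
have -> : S = x ^+ j * (x * \sum_(i < size p - j.+1) (p`_(j.+1 + i))%:~R * x ^+ i).
  rewrite !mulr_sumr; apply: eq_bigr => i _; rewrite coef_map exprD exprS /=; ring.
rewrite coef_map /= [_%:~R * _]mulrC -mulrDr mulf_eq0 expf_eq0 (negPf x0) andbF /=.
rewrite addr_eq0 => /eqP ->; rewrite -mulrN; eexists; last reflexivity.
by rewrite -sumrN; apply: (ri_sum SF) => i _; inri.
Qed.

(** The leading coefficient of an integer relation between powers of [x] is a denominator, by
    [Aint_lead]; the modulus 2 merely ensures that the relation is nonzero. *)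
Lemma numfield_frac F x : numfield F -> F x ->
  exists2 n : int, n != 0 & ring_of_integers F (n%:~R * x).
Proof.
move=> NF Fx; have SF := NF.1; have [d /(_ 2%N (fun i => x ^+ i)) dep] := numfield_dep NF.
have [//|i _|n [[i le_id ndv] e0]] := dep; first by insf.
pose P j := (j <= d)%N && (n j != 0).
have exP : exists j, P j.
  by exists i; rewrite /P le_id; apply: contraNneq ndv => ->; rewrite dvdz0.
have ubP j : P j -> (j <= d)%N by case/andP.
case: (ex_maxnP exP ubP) => j /andP[le_jd nj] maxj; exists (n j) => //; split; first by insf.
apply: (@Aint_lead j (fun i => (n i)%:~R)); first by move=> *; apply: Aint_int.
rewrite (@big_split_at _ (fun i => (n i)%:~R * x ^+ i) _ j) // [X in _ + (_ + X)]big1 in e0.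
  by rewrite big_ord_recr /= -[RHS]e0 addr0.
move=> k _; suff -> : n (j.+1 + k)%N = 0 by rewrite mul0r.
apply: contraTeq (isT) => nk; have /maxj : P (j.+1 + k)%N.
  rewrite /P nk andbT; have := ltn_ord k; move: le_jd; clear; lia.
by clear; lia.
Qed.

(** * Valuations and prime ideals *)

(* A valuation v is only meaningful at nonzero elements, so v x >= k is read
   as vge v k x, which holds at 0. *)
Definition vge (v : algC -> int) (k : int) (x : algC) : Prop := x = 0 \/ k <= v x.

Record val (F : set algC) (v : algC -> int) : Prop := Val {
  valM : forall x y, F x -> F y -> x != 0 -> y != 0 -> v (x * y) = v x + v y;
  valD : forall k x y, F x -> F y -> vge v k x -> vge v k y -> vge v k (x + y);
  val1 : exists x, [/\ F x, x != 0 & v x = 1]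
}.

(** * Construction of the valuation attached to a prime ideal *)

Section Core.
Variables (F Q : set algC).
Hypothesis NF : numfield F.
Local Notation O := (ring_of_integers F).
Hypothesis NQ : nonzero_ideal O Q.
Hypothesis PQ : prime_ideal O Q.
Let SF : subfield F := NF.1.

Let QO x : Q x -> O x. Proof. by case: NQ => -[+ _ _ _] _; apply. Qed.
Let QF x : Q x -> F x. Proof. by case/QO. Qed.
Let Q0 : Q 0. Proof. by case: NQ => -[]. Qed.
Let QD x y : Q x -> Q y -> Q (x + y). Proof. by case: NQ => -[_ _ + _] _; apply. Qed.
Let QM r x : O r -> Q x -> Q (r * x). Proof. by case: NQ => -[_ _ _ +] _; apply. Qed.
Let QN x : Q x -> Q (- x). Proof. by move=> Qx; rewrite -mulN1r; apply: QM => //; inri. Qed.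
Let QB x y : Q x -> Q y -> Q (x - y). Proof. by move=> Qx Qy; apply: QD Qx (QN Qy). Qed.
Let Q1 : ~ Q 1. Proof. by case: PQ. Qed.
Let Qprime x y : O x -> O y -> Q (x * y) -> Q x \/ Q y. Proof. by case: PQ => _ _; apply. Qed.
Let QnM x y : O x -> O y -> ~ Q x -> ~ Q y -> ~ Q (x * y).
Proof. by move=> Ox Oy nx ny /(Qprime Ox Oy)[]. Qed.
Let Qn0 x : ~ Q x -> x != 0. Proof. by move=> nQ; apply/eqP => x0; apply: nQ; rewrite x0. Qed.
Let Qsum I (r : seq I) (P : pred I) (f : I -> algC) :
  (forall i, P i -> Q (f i)) -> Q (\sum_(i <- r | P i) f i).
Proof. by move=> Qf; elim/big_ind: _. Qed.

Lemma prime_in_ideal : exists2 l : nat, prime l & Q l%:R.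
Proof.
have [_ [x Qx x0]] := NQ.
have [n n0 [y Oy Dn]] := Aint_dvd_int SF (QO Qx) x0.
have Qn : Q (`|n|%N)%:R.
  have Qn : Q n%:~R by rewrite Dn mulrC; apply: QM.
  by case: (n) Qn => k //; rewrite NegzE mulrNz => /QN; rewrite opprK.
have : (0 < `|n|)%N by rewrite absz_gt0.
elim: {n n0 Dn}`|n|%N {-2}`|n|%N (leqnn `|n|%N) Qn => [|k IHk] n; first by case: n.
move=> le_nk Qn n0; have n1 : (1 < n)%N.
  by case: n n0 Qn {le_nk} => [//|[_ /Q1|]].
have Dn : n = (pdiv n * (n %/ pdiv n))%N by rewrite mulnC divnK ?pdiv_dvd.
have /Qprime[] : Q ((pdiv n)%:R * (n %/ pdiv n)%:R) by rewrite -natrM -Dn.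
- by inri.
- by inri.
- by exists (pdiv n) => //; apply: pdiv_prime.
have pr := pdiv_prime n1; have gt1 := prime_gt1 pr.
move=> Qn'; apply: (IHk _ _ Qn'); first by move: Dn n1 gt1 le_nk; clear; nia.
by move: Dn n1 gt1 le_nk; clear; nia.
Qed.

Section Prime.
Variable (l : nat).
Hypothesis pr_l : prime l.
Hypothesis Ql : Q l%:R.

Lemma ndvd_notin (n : int) : ~~ (l %| n)%Z -> ~ Q n%:~R.
Proof.
move=> ndv Qn; have : coprimez l n by rewrite coprimezE prime_coprime.
move=> /coprimezP[[a b] /= e]; apply: Q1.
have -> : 1 = a%:~R * l%:R + b%:~R * n%:~R :> algC.
  by rewrite -[l%:R]/((l%:Z)%:~R) -!intrM -intrD e.
by apply: QD; apply: QM => //; inri.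
Qed.

(** Take a relation between powers of [t] and the least [j] with [n j] prime to [l]. The lower terms
    lie in [Q], hence so do [t ^+ j * (n j + r * t)] and [n j + r * t]; and [n j] is invertible
    modulo [l]. *)
Lemma prime_maximal t : O t -> ~ Q t -> exists2 r, O r & Q (1 - r * t).
Proof.
move=> Ot nQt; have [d /(_ l (fun i => t ^+ i)) dep] := numfield_dep NF.
have [|i _|n [[i le_id ndv] e0]] := dep; first exact: prime_gt1.
  by case: (riX SF i Ot).
have exP : exists j, ~~ (l %| n j)%Z by exists i.
case: (ex_minnP exP) => j nj minj.
have le_ji : (j <= d)%N by apply: leq_trans (minj _ ndv) le_id.
rewrite (@big_split_at _ (fun i => (n i)%:~R * t ^+ i) _ j) // in e0.
set S1 := \sum_(i < j) _ in e0; set S2 := \sum_(i < _) _ in e0.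
have QS1 : Q S1.
  apply: Qsum => k _; have : (l %| n k)%Z.
    by have := ltn_ord k; rewrite ltnNge; apply: contraNT => /minj.
  by move=> /dvdzP[c ->]; rewrite intrM mulrAC; apply: QM => //; inri.
have [r Or DS2] : exists2 r, O r & S2 = t ^+ j * (r * t).
  exists (\sum_(i < d - j) (n (j.+1 + i)%N)%:~R * t ^+ i).
    by apply: (ri_sum SF) => k _; inri.
  rewrite mulr_suml mulr_sumr; apply: eq_bigr => k _.
  by rewrite exprD exprS; ring.
have [] : Q (t ^+ j) \/ Q ((n j)%:~R + r * t).
  apply: Qprime; [by inri | by inri |].
  have -> : t ^+ j * ((n j)%:~R + r * t) = - S1.
    by apply/eqP; rewrite -addr_eq0 -e0 DS2; apply/eqP; ring.
  exact: QN.
- elim: (j) => [/Q1//|k IHk]; rewrite exprS => /(Qprime Ot)[] //; by inri.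
move=> Qnt; have : coprimez l (n j) by rewrite coprimezE prime_coprime.
move=> /coprimezP[[a b] /= e]; exists (- (b%:~R * r)); first by inri.
have -> : 1 - - (b%:~R * r) * t = a%:~R * l%:R + b%:~R * ((n j)%:~R + r * t).
  rewrite mulNr opprK mulrDr addrA; congr (_ + _); last by ring.
  by rewrite -[l%:R]/((l%:Z)%:~R) -!intrM -intrD e.
by apply: QD; apply: QM => //; inri.
Qed.

(** The local ring of [O] at [Q]. *)
Definition loc x := exists s t, [/\ O s, O t, ~ Q t & x = s / t].

Let locO x : O x -> loc x.
Proof. by move=> Ox; exists x, 1; split; rewrite ?divr1 //; inri. Qed.
Let locM x y : loc x -> loc y -> loc (x * y).
Proof.
move=> [s [t [Os Ot nt ->]]] [s' [t' [Os' Ot' nt' ->]]].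
exists (s * s'), (t * t'); split; [by inri | by inri | exact: QnM |].
by field; rewrite !Qn0.
Qed.
Let locD x y : loc x -> loc y -> loc (x + y).
Proof.
move=> [s [t [Os Ot nt ->]]] [s' [t' [Os' Ot' nt' ->]]].
exists (s * t' + s' * t), (t * t'); split; [by inri | by inri | exact: QnM |].
by field; rewrite !Qn0.
Qed.
Let loc_sum I (r : seq I) (P : pred I) (f : I -> algC) :
  (forall i, P i -> loc (f i)) -> loc (\sum_(i <- r | P i) f i).
Proof.
by move=> lf; elim/big_ind: _ => //; apply: locO; inri.
Qed.
Let locV t : O t -> ~ Q t -> loc t^-1.
Proof. by move=> Ot nt; exists 1, t; split; rewrite ?div1r //; inri. Qed.

(** The local ring is completely integrally closed. In a relation between powers of [z], let [j] be
    the last index with [n j] prime to [l]: the terms above [j] have a factor [l], so [z] times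
    their sum lies in [loc]. *)
Lemma loc_integral z : F z -> (forall k, loc (l%:R * z ^+ k)) -> loc z.
Proof.
move=> Fz lz; have [d /(_ l (fun i => z ^+ i)) dep] := numfield_dep NF.
have [|i _|n [[i le_id ndv] e0]] := dep; [exact: prime_gt1 | by insf |].
pose P j := (j <= d)%N && ~~ (l %| n j)%Z.
have exP : exists j, P j by exists i; rewrite /P le_id.
have ubP j : P j -> (j <= d)%N by case/andP.
case: (ex_maxnP exP ubP) => j /andP[le_jd nj] maxj.
rewrite (@big_split_at _ (fun i => (n i)%:~R * z ^+ i) _ j) // in e0.
set S2 := \sum_(i < _ - _) _ in e0.
have : loc (z * S2).
  rewrite mulr_sumr; apply: loc_sum => k _; have : (l %| n (j.+1 + k)%N)%Z.
    apply: contraT => ndk; have /maxj : P (j.+1 + k)%N.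
      rewrite /P ndk andbT; have := ltn_ord k; move: le_jd; clear; lia.
    by clear; lia.
  move=> /dvdzP[c ->]; rewrite intrM.
  have -> : z * (c%:~R * (l%:Z)%:~R * z ^+ (j.+1 + k)) = c%:~R * (l%:R * z ^+ (j.+1 + k).+1).
    by rewrite exprS /intmul; ring.
  by apply: locM => //; apply: locO; inri.
move=> [s [t [Os Ot nt Ds]]].
(* These are the coefficients of the relation multiplied by [t * z]: the constant [s] stands for all
   terms of degree above [j.+1], and the leading coefficient [t * n j] is outside [Q]. *)
pose c k := if k is k'.+1 then t * (n k')%:~R else s.
have Ac : c j.+1 * z \in Aint.
  apply: Aint_lead => [[|k] _ /=|].
  - by case: Os.
  - by suff [] : O (t * (n k)%:~R) by []; inri.
  rewrite big_ord_recl /= expr0 mulr1.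
  have t0 := Qn0 nt.
  have -> : s = t * (z * S2) by rewrite Ds; field.
  transitivity (t * (z * 0)); last by rewrite !mulr0.
  rewrite -[in RHS]e0 addrA (mulrDr z) (mulrDr t) [RHS]addrC; congr (_ + _).
  rewrite -(@big_ord_recr _ _ _ _ (fun i => (n i)%:~R * z ^+ i)) !mulr_sumr.
  by apply: eq_bigr => k _; rewrite /bump /= add1n exprS; ring.
have Oj : O (t * (n j)%:~R) by inri.
have nQ : ~ Q (t * (n j)%:~R) by apply: QnM => //; [inri | exact: ndvd_notin].
exists (c j.+1 * z), (t * (n j)%:~R); split => //.
  by split => //=; case: Oj => Fj _; insf.
by rewrite mulrC mulKf //; exact: Qn0.
Qed.

Let nloc1l : ~ loc (l%:R^-1).
Proof.
move=> [s [t [Os Ot nt e]]]; apply: nt.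
have l0 : l%:R != 0 :> algC by rewrite pnatr_eq0 -lt0n prime_gt0.
have t0 : t != 0.
  by apply: contraNneq (invr_neq0 l0) => t0; rewrite e t0 invr0 mulr0.
suff -> : t = s * l%:R by apply: QM.
by rewrite -[l%:R]invrK e; field; rewrite t0 /=; apply: contraNneq (invr_neq0 l0) => s0; rewrite e s0 mul0r.
Qed.

(** A socle element of the local ring modulo [l]. If there were none, one could multiply by elements
    of [Q] forever without entering [l * loc]; a relation primitive at [l] between the terms of such
    a sequence makes one of them a multiple of [l]. *)
Lemma socle_exists : exists b, [/\ O b, ~ loc (b / l%:R) & forall x, Q x -> loc (b * x / l%:R)].
Proof.
apply: contrapT => nex.
have step b : exists x, O b -> ~ loc (b / l%:R) -> Q x /\ ~ loc (b * x / l%:R).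
  apply: contrapT => nx; apply: nex; exists b.
  have Ob : O b by apply: contrapT => nO; apply: nx; exists 0 => /nO.
  split=> // [lb|x Qx]; first by apply: nx; exists 0 => _ /(_ lb).
  by apply: contrapT => nl; apply: nx; exists x.
have [f Hf] := choice step.
pose b := fix b n := if n is n'.+1 then b n' * f (b n') else 1.
have bP n : O (b n) /\ ~ loc (b n / l%:R).
  elim: n => [|n [Ob nb]] /=; first by rewrite div1r; split=> //; inri.
  by have [/QO Qf nl] := Hf _ Ob nb; split => //; inri.
have bQ j k : exists2 q, Q q & b (j.+1 + k)%N = b j * q.
  elim: k => [|k [q Qq Dq]].
    rewrite addn0; exists (f (b j)) => //; by have [] := Hf _ (bP j).1 (bP j).2.
  rewrite addnS /= -/b; exists (q * f (b (j.+1 + k)%N)); last by rewrite mulrA -Dq.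
  by apply: QM (QO Qq) _; have [] := Hf _ (bP (j.+1 + k)%N).1 (bP (j.+1 + k)%N).2.
have [d /(_ l b) dep] := numfield_dep NF.
have [|i _|n [[i le_id ndv] e0]] := dep; [exact: prime_gt1 | by case: (bP i) => -[] |].
have exP : exists j, ~~ (l %| n j)%Z by exists i.
case: (ex_minnP exP) => j nj minj.
have le_ji : (j <= d)%N by apply: leq_trans (minj _ ndv) le_id.
rewrite (@big_split_at _ (fun i => (n i)%:~R * b i) _ j) // in e0.
set S1 := \sum_(i < j) _ in e0; set S2 := \sum_(i < _) _ in e0.
have [q Qq DS2] : exists2 q, Q q & S2 = b j * q.
  rewrite /S2; elim/big_ind: _ => [|_ _ [q Qq ->] [q' Qq' ->]|k _].
  - by exists 0; rewrite ?mulr0.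
  - by exists (q + q'); rewrite ?mulrDr //; apply: QD.
  have [q Qq ->] := bQ j k; exists ((n (j.+1 + k)%N)%:~R * q); last by ring.
  by apply: QM => //; inri.
have [y Oy DS1] : exists2 y, O y & S1 = y * l%:R.
  rewrite /S1; elim/big_ind: _ => [|_ _ [q' Qq' ->] [q'' Qq'' ->]|k _].
  - by exists 0; rewrite ?mul0r //; inri.
  - by exists (q' + q''); rewrite ?mulrDl //; inri.
  have : (l %| n k)%Z.
    by have := ltn_ord k; rewrite ltnNge; apply: contraNT => /minj.
  have [Ob _] := bP k.
  by move=> /dvdzP[c ->]; rewrite intrM mulrAC; exists (c%:~R * b k) => //; inri.
case: (bP j) => Ob; apply.
have On : O ((n j)%:~R + q) by have := QO Qq; move=> ?; inri.
have nQ : ~ Q ((n j)%:~R + q).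
  by move=> QQ; apply: (ndvd_notin nj); rewrite -[X in Q X](addrK q); apply: QB.
exists (- y), ((n j)%:~R + q); split => //; first by inri.
have l0 : l%:R != 0 :> algC by rewrite pnatr_eq0 -lt0n prime_gt0.
apply/eqP; rewrite eqr_div ?(Qn0 nQ) //; apply/eqP.
rewrite mulNr -DS1; apply/eqP; rewrite -addr_eq0 -e0 DS2; apply/eqP; ring.
Qed.

(** For [z = b / l], [z * Q] lies in [loc] but [z] does not. If [z * Q] stayed inside the maximal
    ideal, all [l * z ^+ k] would be in [loc], against [loc_integral]. So [z * x] is a unit for some
    [x] in [Q], and this [x] generates [Q] locally. *)
Lemma uniformizer_exists : exists2 pi, Q pi & pi != 0 /\ forall x, Q x -> loc (x / pi).
Proof.
have l0 : l%:R != 0 :> algC by rewrite pnatr_eq0 -lt0n prime_gt0.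
have [b [Ob nb bQ]] := socle_exists; pose z := b / l%:R.
have zQ x : Q x -> loc (z * x) by move=> /bQ; rewrite /z mulrAC.
have Fz : F z by case: Ob => ? _; rewrite /z; insf.
have [x Qx [s [t [Os Ot [ns nt] e]]]] : exists2 x, Q x & exists s t,
    [/\ O s, O t, ~ Q s /\ ~ Q t & z * x = s / t].
  apply: contrapT => nex; apply: nb; apply: loc_integral => // k.
  suff [s [t [Qs Ot nt ->]]] : exists s t, [/\ Q s, O t, ~ Q t & l%:R * z ^+ k = s / t].
    by exists s, t; split => //; apply: QO.
  elim: k => [|k [s [t [Qs Ot nt e]]]].
    by exists l%:R, 1; split; rewrite ?mulr1 ?divr1 //; inri.
  have [s' [t' [Os' Ot' nt' e']]] := zQ _ Qs.
  have Qs' : Q s' by apply: contrapT => ns; apply: nex; exists s => //; exists s', t'.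
  exists s', (t * t'); split => //; [by inri | exact: QnM |].
  rewrite exprS mulrCA e mulrA e'; field; by rewrite !Qn0.
have zx0 : z * x != 0 by rewrite e mulf_neq0 ?invr_eq0 ?Qn0.
have x0 : x != 0 by apply: contraNneq zx0 => ->; rewrite mulr0.
have z0 : z != 0 by apply: contraNneq zx0 => ->; rewrite mul0r.
exists x => //; split => // y Qy.
have -> : y / x = (z * y) * (t / s).
  by rewrite -[t / s]invrK invf_div -e; field; rewrite x0 z0.
by apply: locM (zQ _ Qy) (locM (locO Ot) (locV Os ns)).
Qed.

Section Uniformizer.
Variable (pi : algC).
Hypotheses (Qpi : Q pi) (pi0 : pi != 0) (piP : forall x, Q x -> loc (x / pi)).

Let nloc_pi : ~ loc pi^-1.
Proof.
move=> [s [t [Os Ot nt e]]]; apply: nt; suff -> : t = s * pi by apply: QM.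
have t0 : t != 0.
  by apply: contraNneq (invr_neq0 pi0) => t0; rewrite e t0 invr0 mulr0.
have s0 : s != 0.
  by apply: contraNneq (invr_neq0 pi0) => t1; rewrite e t1 mul0r.
by rewrite -[pi]invrK e; field; rewrite t0.
Qed.

Let Fpi : F pi. Proof. exact: QF. Qed.

Definition lunit u := [/\ u != 0, loc u & loc u^-1].

Let lunitM u w : lunit u -> lunit w -> lunit (u * w).
Proof. by move=> [? ? ?] [? ? ?]; split; rewrite ?invfM ?mulf_neq0 //; apply: locM. Qed.
Let lunitV u : lunit u -> lunit u^-1.
Proof. by move=> [? ? ?]; split; rewrite ?invrK ?invr_eq0. Qed.
Let lunitO t : O t -> ~ Q t -> lunit t.
Proof. by move=> Ot nt; split; [exact: Qn0 | apply: locO | apply: locV]. Qed.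

Let lunit_pi n : ~ lunit (pi ^+ n.+1).
Proof.
move=> [_ _ lu]; apply: nloc_pi.
have -> : pi^-1 = pi ^+ n * (pi ^+ n.+1)^-1 by rewrite exprS; field; rewrite pi0 expf_neq0.
by apply: locM lu; apply: locO; have := QO Qpi; move=> ?; inri.
Qed.

Let lunit_piz (n : int) : lunit (pi ^ n) -> n = 0.
Proof.
case: n => [[|n]|n] //= lu; first by have := @lunit_pi n lu.
by have := lunitV lu; rewrite invrK => /lunit_pi.
Qed.

Let dec_of_bound y : y != 0 -> loc y -> (exists N, ~ loc (y / pi ^+ N)) ->
  exists k, lunit (y / pi ^+ k).
Proof.
move=> y0 ly [N]; elim: N => [|N IHN] nl; first by case: nl; rewrite expr0 divr1.
case: (pselect (loc (y / pi ^+ N))) => [lN|]; last exact: IHN.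
exists N; split => //; first by rewrite mulf_neq0 // invr_eq0 expf_neq0.
case: lN => s [t [Os Ot nt e]]; rewrite e invf_div; apply: locM; first exact: locO.
apply: locV => // Qs; apply: nl.
have -> : y / pi ^+ N.+1 = (s / pi) * t^-1.
  rewrite mulrAC -e exprSr; field; by rewrite pi0 expf_neq0.
by apply: locM (piP Qs) (locV Ot nt).
Qed.

Let dec_mul x y : (exists k, lunit (x / pi ^+ k)) -> (exists k, lunit (y / pi ^+ k)) ->
  exists k, lunit ((x * y) / pi ^+ k).
Proof.
move=> [k lx] [k' ly]; exists (k + k')%N; rewrite exprD -mulf_div; exact: lunitM.
Qed.

Let dec_l : exists k, lunit (l%:R / pi ^+ k).
Proof.
have l0 : l%:R != 0 :> algC by rewrite pnatr_eq0 -lt0n prime_gt0.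
apply: dec_of_bound => //; first by apply: locO; inri.
(* If every power of [pi] divided [l], the powers of [pi^-1] would have the common denominator [l],
   and [pi] would be a unit. *)
apply: contrapT => nex; apply: nloc_pi; apply: loc_integral; first by insf.
by move=> k; apply: contrapT => nl; apply: nex; exists k; rewrite -exprVn.
Qed.

Let dec_nat n : (0 < n)%N -> exists k, lunit (n%:R / pi ^+ k).
Proof.
elim: n {-2}n (leqnn n) => [[]//|N IHN] n le_n n0.
case: (boolP (l %| n)%N) => [/dvdnP[m Dn]|ndv].
  rewrite Dn natrM; apply: dec_mul dec_l; have := prime_gt1 pr_l.
  by move=> l1; apply: IHN; move: n0 le_n l1; rewrite Dn; clear; nia.
exists 0%N; rewrite expr0 divr1; apply: lunitO; first by inri.
by rewrite -[n%:R]/((n%:Z)%:~R); apply: ndvd_notin.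
Qed.

Let dec_O x : O x -> x != 0 -> exists k, lunit (x / pi ^+ k).
Proof.
move=> Ox x0; have [n n0 [y Oy Dn]] := Aint_dvd_int SF Ox x0.
apply: dec_of_bound => //; first exact: locO.
have [|k [_ _ lk]] := @dec_nat `|n|%N; first by rewrite absz_gt0.
exists k.+1 => lx; apply: nloc_pi.
have [y' Oy' Dn'] : exists2 y', O y' & (`|n|%N)%:R = x * y'.
  case: (n) Dn => m Dn; first by exists y.
  by exists (- y); [inri | rewrite mulrN -Dn NegzE mulrNz opprK].
have z0 : (`|n|%N)%:R != 0 :> algC by rewrite pnatr_eq0 absz_eq0.
have y0 : y' != 0 by apply: contraNneq z0 => y0; rewrite Dn' y0 mulr0.
have -> : pi^-1 = x / pi ^+ k.+1 * y' * ((`|n|%N)%:R / pi ^+ k)^-1.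
  by rewrite Dn' exprSr; field; rewrite x0 y0 pi0 expf_neq0.
by apply: locM lk; apply: locM lx (locO Oy').
Qed.

Let dec_F x : F x -> x != 0 -> exists k : int, lunit (x / pi ^ k).
Proof.
move=> Fx x0; have [n n0 On] := numfield_frac NF Fx.
have nC0 : n%:~R != 0 :> algC by rewrite intr_eq0.
have [k1 l1] := dec_O On (mulf_neq0 nC0 x0).
have [|k2 l2] := @dec_O n%:~R _ nC0; first by inri.
exists (k1%:Z - k2%:Z); have := lunitM l1 (lunitV l2).
suff -> : x / pi ^ (k1%:Z - k2%:Z) = n%:~R * x / pi ^+ k1 * (n%:~R / pi ^+ k2)^-1 by [].
rewrite expfzDr // -!exprnP -exprnN; field.
by rewrite nC0 !expf_neq0.
Qed.

Let v_ex x : exists k : int, F x -> x != 0 -> lunit (x / pi ^ k).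
Proof.
case: (pselect (F x)) => [Fx|nFx]; last by exists 0 => /nFx.
by case: (eqVneq x 0) => [_|/(dec_F Fx)[k]]; [exists 0 | exists k].
Qed.

Lemma val_exists_pi : exists v, [/\ val F v, forall x, O x -> (Q x <-> vge v 1 x)
  & forall x, F x -> vge v 0 x -> exists s t, [/\ O s, O t, ~ Q t & x = s / t]].
Proof.
have [v Hv] := choice v_ex.
have uniq x k : F x -> x != 0 -> lunit (x / pi ^ k) -> v x = k.
  move=> Fx x0 l1; have l2 := Hv _ Fx x0.
  have := lunitM (lunitV l1) l2.
  have -> : (x / pi ^ k)^-1 * (x / pi ^ v x) = pi ^ (k - v x).
    by rewrite expfzDr // -invr_expz; field; rewrite x0 !expfz_neq0.
  by move=> /lunit_piz; clear; lia.
have loc_pos x : F x -> x != 0 -> (loc x <-> 0 <= v x).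
  move=> Fx x0; have [_ l1 l2] := Hv _ Fx x0; have Opi := QO Qpi.
  split=> [lx|]; last first.
    case: (v x) l1 => // k l1 _; rewrite -[x](divfK (expfz_neq0 k pi0)).
    by apply: locM l1 _; apply: locO; rewrite -exprnP; inri.
  rewrite leNgt; apply/negP; case: (v x) l2 => // k; rewrite invf_div => l2 _.
  apply: nloc_pi; have -> : pi^-1 = x * (pi ^ Negz k / x) * pi ^+ k.
    rewrite NegzE -exprnN exprS; field; by rewrite x0 pi0 expf_neq0.
  by apply: locM; [exact: locM | apply: locO; inri].
have vM x y : F x -> F y -> x != 0 -> y != 0 -> v (x * y) = v x + v y.
  move=> Fx Fy x0 y0; apply: uniq; [by insf | by rewrite mulf_neq0 |].
  by rewrite expfzDr // -mulf_div; apply: lunitM; apply: Hv.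
have vpi (k : int) : v (pi ^ k) = k.
  apply: uniq; [by insf | exact: expfz_neq0 |].
  rewrite divff ?expfz_neq0 //; apply: lunitO => //; inri.
have vge_loc k x : F x -> (vge v k x <-> loc (x / pi ^ k)).
  move=> Fx; have [->|x0] := eqVneq x 0.
    by split=> [_|]; [rewrite mul0r; apply: locO; inri | left].
  have Fk : F (pi ^ (- k)) by insf.
  rewrite invr_expz; rewrite loc_pos ?mulf_neq0 ?expfz_neq0 //; last by insf.
  rewrite vM ?expfz_neq0 // vpi subr_ge0; split=> [[/eqP|//]|]; last by right.
  by rewrite (negPf x0).
exists v; split; last first.
- move=> x Fx [->|vx]; first by exists 0, 1; split; rewrite ?mul0r //; inri.
  have [->|x0] := eqVneq x 0; first by exists 0, 1; split; rewrite ?mul0r //; inri.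
  by have /loc_pos := vx; apply.
- move=> x Ox; have Fx : F x by case: Ox.
  rewrite vge_loc // expr1z; split=> [/piP//|[s [t [Os Ot nt e]]]].
  have : Q (x * t).
    by rewrite -[x](divfK pi0) e mulrAC divfK ?Qn0 //; apply: QM.
  by move=> /(Qprime Ox Ot)[].
- split => //; last by exists pi; split=> //; rewrite -[pi]expr1z vpi.
  move=> k x y Fx Fy /vge_loc lx /vge_loc ly; apply/vge_loc; first by insf.
  by rewrite mulrDl; apply: locD; [apply: lx | apply: ly].
Qed.

End Uniformizer.
End Prime.

Lemma val_of_prime : exists v, [/\ val F v, forall x, O x -> (Q x <-> vge v 1 x)
  & forall x, F x -> vge v 0 x -> exists s t, [/\ O s, O t, ~ Q t & x = s / t]].
Proof.
have [l pr_l Ql] := prime_in_ideal.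
have [pi Qpi [pi0 piP]] := uniformizer_exists pr_l Ql.
exact: val_exists_pi pr_l Ql _ Qpi pi0 piP.
Qed.

End Core.

Lemma int_gt0 (k : int) : 0 < k -> 1 <= k. Proof. lia. Qed.

(** Typical use: a ramification index is 1 as soon as the value 1 is a multiple of it. *)
Lemma int_mul_eq1 (e k : int) : 0 < e -> e * k = 1 -> e = 1.
Proof. by case: e => // -[|[|e]] // _; case: k => k; rewrite ?mul1r; lia. Qed.

(** * Elementary properties of valuations *)

Section Val.
Variables (F : set algC) (v : algC -> int).
Hypotheses (SF : subfield F) (V : val F v).
Local Notation O := (ring_of_integers F).

Lemma val_1 : v 1 = 0.
Proof.
have F1 := sf1 SF; have := valM V F1 F1 (oner_neq0 _) (oner_neq0 _).
by rewrite mulr1; lia.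
Qed.

Lemma val_N x : F x -> x != 0 -> v (- x) = v x.
Proof.
move=> Fx x0; have Fm : F (-1) by insf.
have m0 : -1 != 0 :> algC by rewrite oppr_eq0 oner_neq0.
have := valM V Fm Fm m0 m0; rewrite mulrNN mulr1 val_1 => e.
by rewrite -mulN1r (valM V) //; lia.
Qed.

Lemma val_V x : F x -> x != 0 -> v x^-1 = - v x.
Proof.
move=> Fx x0; have Fi : F x^-1 by insf.
have := valM V Fx Fi x0; rewrite divff // val_1 invr_eq0 => /(_ x0); lia.
Qed.

Lemma val_div x y : F x -> F y -> x != 0 -> y != 0 -> v (x / y) = v x - v y.
Proof. by move=> Fx Fy x0 y0; rewrite (valM V) ?invr_eq0 ?val_V //; insf. Qed.

Lemma val_X x n : F x -> x != 0 -> v (x ^+ n) = n%:Z * v x.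
Proof.
move=> Fx x0; elim: n => [|n IHn]; first by rewrite mul0r val_1.
by rewrite exprS (valM V) ?expf_neq0 ?IHn //; [lia | insf].
Qed.

Lemma val_Xz x (n : int) : F x -> x != 0 -> v (x ^ n) = n * v x.
Proof.
move=> Fx x0; case: n => n; first exact: val_X.
rewrite NegzE -invr_expz val_V ?expfz_neq0 //; last by insf.
by rewrite -exprnP val_X // mulNr.
Qed.

Lemma vge0 k : vge v k 0. Proof. by left. Qed.

Lemma vge_le k j x : k <= j -> vge v j x -> vge v k x.
Proof. by move=> le [|?]; [left | right; apply: le_trans le _]. Qed.

Lemma vgeN k x : F x -> vge v k x -> vge v k (- x).
Proof.
move=> Fx [->|le]; first by rewrite oppr0; left.
by have [->|x0] := eqVneq x 0; [rewrite oppr0; left | right; rewrite val_N].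
Qed.

Lemma vgeB k x y : F x -> F y -> vge v k x -> vge v k y -> vge v k (x - y).
Proof. by move=> Fx Fy vx vy; apply: (valD V) => //; [insf | exact: vgeN]. Qed.

Lemma vgeM k j x y : F x -> F y -> vge v k x -> vge v j y -> vge v (k + j) (x * y).
Proof.
move=> Fx Fy [->|vx]; first by rewrite mul0r; left.
move=> [->|vy]; first by rewrite mulr0; left.
have [->|x0] := eqVneq x 0; first by rewrite mul0r; left.
have [->|y0] := eqVneq y 0; first by rewrite mulr0; left.
by right; rewrite (valM V) // lerD.
Qed.

Lemma vgeMl k x y : F x -> F y -> vge v 0 x -> vge v k y -> vge v k (x * y).
Proof. by move=> Fx Fy vx vy; have := vgeM Fx Fy vx vy; rewrite add0r. Qed.

Lemma vgeMr k x y : F x -> F y -> vge v k x -> vge v 0 y -> vge v k (x * y).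
Proof. by move=> Fx Fy vx vy; have := vgeM Fx Fy vx vy; rewrite addr0. Qed.

Lemma vge_1 : vge v 0 1. Proof. by right; rewrite val_1. Qed.

Lemma vgeX x n : F x -> vge v 0 x -> vge v 0 (x ^+ n).
Proof.
move=> Fx vx; elim: n => [|n IHn]; first exact: vge_1.
by rewrite exprS; apply: vgeMl => //; insf.
Qed.

Lemma vge_sum k I (r : seq I) (P : pred I) (f : I -> algC) :
  (forall i, P i -> F (f i)) -> (forall i, P i -> vge v k (f i)) ->
  vge v k (\sum_(i <- r | P i) f i).
Proof.
move=> Ff vf; suff [] : F (\sum_(i <- r | P i) f i) /\ vge v k (\sum_(i <- r | P i) f i) by [].
elim/big_ind: _ => [|x y [Fx vx] [Fy vy]|i Pi].
- by split; [insf | exact: vge0].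
- by split; [insf | apply: (valD V)].
- by split; [exact: Ff | exact: vf].
Qed.

Lemma vge_sum_seq k (I : eqType) (r : seq I) (f : I -> algC) :
  (forall i, i \in r -> F (f i)) -> (forall i, i \in r -> vge v k (f i)) ->
  vge v k (\sum_(i <- r) f i).
Proof. by move=> Ff vf; rewrite big_seq; apply: vge_sum. Qed.

Lemma vgeE k x : x != 0 -> vge v k x -> k <= v x.
Proof. by move=> x0 [/eqP|//]; rewrite (negPf x0). Qed.

(** The bound [k] stands in for the value of [y], so that [y = 0] is covered. *)
Lemma val_dom x y k : F x -> F y -> x != 0 -> v x < k -> vge v k y ->
  x + y != 0 /\ v (x + y) = v x.
Proof.
move=> Fx Fy x0 lt vy; have Fxy : F (x + y) by insf.
have xy0 : x + y != 0.
  apply: contraTneq lt => e; rewrite -leNgt; apply: vgeE => //.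
  have -> : x = - y by apply/eqP; rewrite -addr_eq0 e.
  exact: vgeN.
split=> //; apply: le_anti; apply/andP; split; last first.
  by apply: vgeE => //; apply: (valD V) => //; [right | apply: vge_le vy; exact: ltW].
rewrite leNgt; apply/negP => lt2.
have : vge v (Num.min k (v (x + y))) x.
  rewrite -[x in vge _ _ x](addrK y); apply: vgeB => //.
    by right; rewrite ge_min lexx orbT.
  by apply: vge_le vy; rewrite ge_min lexx.
by move/(vgeE x0); rewrite ge_min !leNgt lt lt2.
Qed.

Lemma vge_nat n : vge v 0 n%:R.
Proof.
elim: n => [|n IHn]; first exact: vge0.
by rewrite -natr1; apply: (valD V) => //; [insf | insf | exact: vge_1].
Qed.

Lemma vge_int (n : int) : vge v 0 n%:~R.
Proof.
case: n => n; first exact: vge_nat.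
by rewrite NegzE mulrNz; apply: vgeN; [insf | exact: vge_nat].
Qed.

Lemma vge_ri x : O x -> vge v 0 x.
Proof.
move=> [Fx /= Ax]; have [->|x0] := eqVneq x 0; first exact: vge0.
right; rewrite leNgt; apply/negP => lt.
have /floorpP[p Dp] := Ax; have mon := minCpoly_monic x.
have := root_minCpoly x; rewrite /root horner_coef.
have := size_minCpoly x; rewrite -(prednK (ltnW (size_minCpoly x))) ltnS.
set n := (size _).-1 => n0; rewrite big_ord_recr /=.
have -> : (minCpoly x)`_n = 1 by have := monicP mon; rewrite lead_coefE.
rewrite mul1r addrC => /eqP e0.
have Fp i : F (minCpoly x)`_i by rewrite Dp coef_map /=; insf.
suff [] : x ^+ n + \sum_(i < n) (minCpoly x)`_i * x ^+ i != 0 /\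
  v (x ^+ n + \sum_(i < n) (minCpoly x)`_i * x ^+ i) = v (x ^+ n) by rewrite e0 eqxx.
(* When [v x < 0], the leading term [x ^+ n] has a value strictly below those of the other terms,
   which are at least [n.-1 * v x]. *)
apply: (@val_dom _ _ (n.-1%:Z * v x)); [by insf | | by rewrite expf_neq0 | |].
- by apply: (sf_sum SF) => i _; have := Fp i; move=> ?; insf.
- rewrite val_X //; move: n0 lt; clear; nia.
apply: vge_sum => i _; first by have := Fp i; move=> ?; insf.
rewrite -[_ * _]add0r -[X in vge v X]add0r add0r; apply: vgeM => //; [by insf | |].
  by rewrite Dp coef_map /=; exact: vge_int.
right; rewrite val_X //; have := ltn_ord i; move: lt n0; clear; nia.
Qed.

Lemma val_int0 (l : nat) (n : int) : prime l -> 0 < v l%:R -> ~~ (l %| n)%Z -> v n%:~R = 0.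
Proof.
move=> pr vl ndv; have l0 : l%:R != 0 :> algC by rewrite pnatr_eq0 -lt0n prime_gt0.
have n0 : n%:~R != 0 :> algC by rewrite intr_eq0; apply: contraNneq ndv => ->; rewrite dvdz0.
have := vgeE n0 (vge_int n); rewrite le_eqVlt => /orP[/eqP//|vn].
have : coprimez l n by rewrite coprimezE prime_coprime.
move=> /coprimezP[[a b] /= e].
have : vge v 1 1.
  have -> : 1 = a%:~R * l%:R + b%:~R * n%:~R :> algC.
    by rewrite -[l%:R]/((l%:Z)%:~R) -!intrM -intrD e.
  by apply: (valD V); [insf | insf | |]; apply: vgeMl; try (by insf);
    try exact: vge_int; right; apply: int_gt0.
by move=> /(vgeE (oner_neq0 _)); rewrite val_1.
Qed.

Lemma val_nat0 (l n : nat) : prime l -> 0 < v l%:R -> ~~ (l %| n)%N -> v n%:R = 0.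
Proof. by move=> pr vl ndv; apply: (@val_int0 l n). Qed.

Definition val_ideal : set algC := [set x | O x /\ vge v 1 x].

End Val.

Section ValIdeal.
Variables (F : set algC) (v : algC -> int).
Hypotheses (NF : numfield F) (V : val F v).
Let SF := NF.1.
Local Notation O := (ring_of_integers F).

Lemma val_ideal_prime : prime_ideal O (val_ideal F v).
Proof.
split.
- split=> [x []//||x y [[Fx Ax] vx] [[Fy Ay] vy]|r x Or [Ox vx]].
  + by split; [inri | exact: vge0].
  + by split; [inri; split | apply: (valD V)].
  + split; first by inri.
    by have [Fr _] := Or; have [Fx _] := Ox; apply: (vgeMl V) => //; exact: (vge_ri SF V).
- by case=> _ /(vgeE (oner_neq0 _)); rewrite (val_1 SF V).
move=> x y Ox Oy [_ vxy]; have [Fx _] := Ox; have [Fy _] := Oy.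
have [x0|x0] := eqVneq x 0; first by left; split => //; left.
have [y0|y0] := eqVneq y 0; first by right; split => //; left.
have := vgeE (mulf_neq0 x0 y0) vxy; rewrite (valM V) //.
have := vgeE x0 (vge_ri SF V Ox); have := vgeE y0 (vge_ri SF V Oy).
case: (ltP 0 (v x)) => vx; first by move=> *; left; split => //; right; lia.
by move=> *; right; split => //; right; lia.
Qed.

Lemma val_ideal_nonzero : nonzero_ideal O (val_ideal F v).
Proof.
split; first by case: val_ideal_prime.
have [x [Fx x0 vx]] := val1 V.
have [n n0 Ox] := numfield_frac NF Fx.
have nC : n%:~R != 0 :> algC by rewrite intr_eq0.
exists (n%:~R * x); last by rewrite mulf_neq0.
split => //; right; rewrite (valM V) ?vx //; last by insf.
have := vgeE nC (vge_int SF V n); lia.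
Qed.

Lemma val_prime : exists2 l : nat, prime l & 0 < v l%:R.
Proof.
have [l pr [_ vl]] := prime_in_ideal NF val_ideal_nonzero val_ideal_prime.
have l0 : l%:R != 0 :> algC by rewrite pnatr_eq0 -lt0n prime_gt0.
by exists l => //; have := vgeE l0 vl; lia.
Qed.

Lemma ri_notin_val x : O x -> ~ val_ideal F v x -> x != 0 /\ v x = 0.
Proof.
move=> Ox nx; have [x0|x0] := eqVneq x 0; first by case: nx; split => //; left.
split=> //; have := vgeE x0 (vge_ri SF V Ox); rewrite le_eqVlt => /orP[/eqP//|vx].
by case: nx; split => //; right.
Qed.

(** An abstract valuation has to be compared with the [v'] built from its ideal. If
    [v' x < 0 <= v x], take an integer [s] with [v' s = 1], so that [v s > 0]. A power of [s] makes
    [x] a [v']-unit, hence a quotient of integers outside the ideal, although the product has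
    positive [v]-value. *)
Lemma val_loc x : F x -> vge v 0 x ->
  exists s t, [/\ O s, O t, t != 0, v t = 0 & x = s / t].
Proof.
move=> Fx vx.
have [v' [V' Q' loc']] := val_of_prime NF val_ideal_nonzero val_ideal_prime.
have Q1 y : O y -> vge v' 1 y -> vge v 1 y by move=> Oy /(Q' _ Oy)[].
have Q2 y : O y -> vge v 1 y -> vge v' 1 y by move=> Oy vy; apply/(Q' _ Oy).
suff /loc' : vge v' 0 x.
  move=> /(_ Fx)[s [t [Os Ot nt ->]]]; exists s, t.
  by have [? ?] := ri_notin_val Ot nt.
have [->|x0] := eqVneq x 0; first by left.
right; rewrite leNgt; apply/negP => lt.
have [pi [Fpi pi0 vpi]] := val1 V'.
have /loc' [|s [t [Os Ot nt Dpi]]] := Fpi; first by right; rewrite vpi.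
have [t0 _] := ri_notin_val Ot nt.
have s0 : s != 0 by apply: contraNneq pi0 => s0; rewrite Dpi s0 mul0r.
have [Fs _] := Os; have [Ft _] := Ot.
have nt' : v' t = 0.
  have := vgeE t0 (vge_ri SF V' Ot); rewrite le_eqVlt => /orP[/eqP//|vt].
  by case: nt; split => //; apply: Q1 => //; right; lia.
have vs' : v' s = 1 by move: vpi; rewrite Dpi (val_div SF V') // nt'; lia.
have vs : 1 <= v s by apply: vgeE => //; apply: Q1 => //; right; rewrite vs'.
pose k := `|v' x|%N.
have y0 : x * s ^+ k != 0 by rewrite mulf_neq0 ?expf_neq0.
have Fy : F (x * s ^+ k) by insf.
have vy' : v' (x * s ^+ k) = 0.
  rewrite (valM V') ?expf_neq0 // ?(val_X SF V') // ?vs'; last by insf.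
  by rewrite /k; move: lt; clear; lia.
have /loc' [|s1 [t1 [Os1 Ot1 nt1 Dy]]] := Fy; first by right; rewrite vy'.
have [t10 vt1] := ri_notin_val Ot1 nt1.
have s10 : s1 != 0 by apply: contraNneq y0 => e; rewrite Dy e mul0r.
have [Fs1 _] := Os1; have [Ft1 _] := Ot1.
have vt1' : v' t1 = 0.
  have := vgeE t10 (vge_ri SF V' Ot1); rewrite le_eqVlt => /orP[/eqP//|vt].
  by case: nt1; split => //; apply: Q1 => //; right; lia.
have vs1' : v' s1 = 0 by move: vy'; rewrite Dy (val_div SF V') // vt1'; lia.
have vs1 : v s1 = 0.
  have := vgeE s10 (vge_ri SF V Os1); rewrite le_eqVlt => /orP[/eqP//|vs1].
  have : vge v' 1 s1 by apply: Q2 => //; right; lia.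
  by move=> /(vgeE s10); rewrite vs1'.
have : v (x * s ^+ k) = 0 by rewrite Dy (val_div SF V) // vs1 vt1.
rewrite (valM V) ?expf_neq0 // ?(val_X SF V) //; last by insf.
have := vgeE x0 vx; move: lt vs; rewrite /k; clear; nia.
Qed.

Lemma val_unif : exists x, [/\ O x, x != 0 & v x = 1].
Proof.
have [x [Fx x0 vx]] := val1 V.
have [|s [t [Os Ot t0 vt Dx]]] := val_loc Fx; first by right; rewrite vx.
have s0 : s != 0 by apply: contraNneq x0 => s0; rewrite Dx s0 mul0r.
exists s; split => //; move: vx; have [Fs _] := Os; have [Ft _] := Ot.
by rewrite Dx (val_div SF V) // vt subr0.
Qed.

Lemma val_max t : O t -> t != 0 -> v t = 0 -> exists2 r, O r & vge v 1 (1 - r * t).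
Proof.
move=> Ot t0 vt.
have [l pr [Ol vl]] := prime_in_ideal NF val_ideal_nonzero val_ideal_prime.
have [|r Or [_ vr]] := prime_maximal NF val_ideal_nonzero val_ideal_prime pr (conj Ol vl) Ot.
  by case=> _ /(vgeE t0); rewrite vt.
by exists r.
Qed.

End ValIdeal.

(** * Restriction and extension of valuations *)

Section Restrict.
Variables (F L : set algC) (v w : algC -> int).
Hypotheses (NF : numfield F) (NL : numfield L) (sFL : F `<=` L).
Hypotheses (V : val F v) (W : val L w).
Let SF := NF.1.
Let SL := NL.1.

(** An integer that is a [v]-unit is invertible modulo the ideal of [v], which is contained in that
    of [w], so it is a [w]-unit. Hence [w x] depends only on [v x], and [e] is the [w]-value of a
    uniformizer. *)
Lemma val_restrict :
  (forall x, ring_of_integers F x -> vge v 1 x -> vge w 1 x) ->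
  exists2 e : int, 0 < e & forall x, F x -> x != 0 -> w x = e * v x.
Proof.
move=> Hw.
have ri_sub x : ring_of_integers F x -> ring_of_integers L x by case=> /sFL.
have w0 t : ring_of_integers F t -> t != 0 -> v t = 0 -> w t = 0.
  move=> Ot t0 vt; have [r Or vr] := val_max NF V Ot t0 vt.
  have Ort : ring_of_integers F (1 - r * t) by inri.
  have wrt := Hw _ Ort vr.
  have := vgeE t0 (vge_ri SL W (ri_sub _ Ot)); rewrite le_eqVlt => /orP[/eqP//|wt].
  have [Lt _] := ri_sub _ Ot; have [Lr _] := ri_sub _ Or.
  have : vge w 1 (1 - r * t + r * t).
    apply: (valD W) => //; [by insf | by insf |].
    by apply: (vgeMl W) => //; [apply: (vge_ri SL W); apply: ri_sub | right; apply: int_gt0].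
  by rewrite subrK => /(vgeE (oner_neq0 _)); rewrite (val_1 SL W).
have w0F x : F x -> x != 0 -> v x = 0 -> w x = 0.
  move=> Fx x0 vx; have [|s [t [Os Ot t0 vt Dx]]] := val_loc NF V Fx.
    by right; rewrite vx.
  have s0 : s != 0 by apply: contraNneq x0 => s0; rewrite Dx s0 mul0r.
  have [Fs _] := Os; have [Ft _] := Ot.
  have vs : v s = 0 by move: vx; rewrite Dx (val_div SF V) // vt; lia.
  by rewrite Dx (val_div SL W) ?w0 //; apply: sFL.
have [pi [Opi pi0 vpi]] := val_unif NF V; have [Fpi _] := Opi.
exists (w pi); first by have := vgeE pi0 (Hw _ Opi _); rewrite /vge vpi; move=> /(_ (or_intror (lexx _))); lia.
move=> x Fx x0; have := w0F (x / pi ^ v x).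
rewrite (val_div SF V) ?expfz_neq0 //; last by insf.
rewrite (val_Xz SF V) // vpi mulr1 subrr mulf_neq0 ?invr_eq0 ?expfz_neq0 // => /(_ _ isT erefl).
have Lx := sFL Fx; have Lpi := sFL Fpi.
rewrite (val_div SL W) ?expfz_neq0 // ?(val_Xz SL W) //; last by insf.
have Fd : F (x / pi ^ v x) by insf.
move=> /(_ Fd); lia.
Qed.

End Restrict.

Lemma val_restrict_exists F L w : numfield F -> numfield L -> F `<=` L -> val L w ->
  exists v e, [/\ val F v, 0 < e & forall x, F x -> x != 0 -> w x = e * v x].
Proof.
move=> NF NL sFL W; have SF := NF.1; have SL := NL.1.
pose Q : set algC := [set x | ring_of_integers F x /\ vge w 1 x].
have ri_sub x : ring_of_integers F x -> ring_of_integers L x by case=> /sFL.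
have [[_ Q0 QD QM] Q1 Qp] := val_ideal_prime NL W.
have IQ : ideal (ring_of_integers F) Q.
  split=> [x []//||x y [Ox vx] [Oy vy]|r x Or [Ox vx]].
  - by split; [inri | exact: vge0].
  - split; first by inri.
    by case: (QD x y (conj (ri_sub _ Ox) vx) (conj (ri_sub _ Oy) vy)).
  - split; first by inri.
    by case: (QM r x (ri_sub _ Or) (conj (ri_sub _ Ox) vx)).
have PQ : prime_ideal (ring_of_integers F) Q.
  split=> // [[O1 v1]|x y Ox Oy [Oxy vxy]]; first by apply: Q1; split=> //; exact: ri_sub.
  by have [[_ ?]|[_ ?]] := Qp x y (ri_sub _ Ox) (ri_sub _ Oy) (conj (ri_sub _ Oxy) vxy);
    [left | right].
have [l pr wl] := val_prime NL W.
have NQ : nonzero_ideal (ring_of_integers F) Q.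
  split=> //; exists l%:R; last by rewrite pnatr_eq0 -lt0n prime_gt0.
  by split; [inri | right].
have [v [V QV _]] := val_of_prime NF NQ PQ; exists v.
have [|e e0 He] := val_restrict NF NL sFL V W; last by exists e.
by move=> x Ox /(QV _ Ox) [].
Qed.

Lemma val_eq F v w : numfield F -> val F v -> val F w ->
  (forall x, ring_of_integers F x -> vge v 1 x -> vge w 1 x) ->
  forall x, F x -> x != 0 -> w x = v x.
Proof.
move=> NF V W Hw; have [e e0 He] := val_restrict NF NF (fun x => id) V W Hw.
have [y [Fy y0 wy]] := val1 W; move: wy; rewrite He // => e1.
suff ee : e = 1 by move=> x Fx x0; rewrite He // ee mul1r.
exact: int_mul_eq1 e0 e1.
Qed.

Lemma val_over_ideal L (I : set algC) : numfield L ->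
  ideal (ring_of_integers L) I -> ~ I 1 -> (exists2 x, I x & x != 0) ->
  exists2 w, val L w & forall x, I x -> vge w 1 x.
Proof.
move=> NL II nI1 [x0 Ix0 nx0]; have SL := NL.1.
pose P (A : set algC) := A = set0 \/ [/\ ideal (ring_of_integers L) A, ~ A 1 & I `<=` A].
have [C CP totC|A [PA maxA]] := @Zorn_bigcup _ P.
  have [ne|em] := pselect (exists A, C A /\ A <> set0); last first.
    left; apply/seteqP; split=> // x [A CA Ax]; apply: em; exists A; split=> // A0.
    by rewrite A0 in Ax.
  right; have CP' A x : C A -> A x -> [/\ ideal (ring_of_integers L) A, ~ A 1 & I `<=` A].
    by move=> CA Ax; have [A0|//] := CP _ CA; rewrite A0 in Ax.
  have [A0 [CA0 nA0]] := ne; have [//|[[A0O A00 A0D A0M] A01 IA0]] := CP _ CA0.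
  split; last by move=> x Ix; exists A0 => //; exact: IA0.
    split=> [x [A CA Ax]||x y [A CA Ax] [B CB By]|r x Or [A CA Ax]].
    - by have [[+ _ _ _] _ _] := CP' _ _ CA Ax; apply.
    - by exists A0.
    - have [AB|BA] := totC A B CA CB.
        exists B => //; have [[_ _ + _] _ _] := CP' _ _ CB By; apply => //; exact: AB.
      exists A => //; have [[_ _ + _] _ _] := CP' _ _ CA Ax; apply => //; exact: BA.
    - by exists A => //; have [[_ _ _ +] _ _] := CP' _ _ CA Ax; apply.
  by case=> A CA A1; have [_ /(_ A1)] := CP' _ _ CA A1.
have [A0|[IA nA1 sIA]] := PA.
  case: (maxA I); last by right; split=> // x.
  by rewrite A0; split; [move=> x [] | move=> /(_ x0 Ix0)].
have [AO Az AD AM] := IA.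
have PrA : prime_ideal (ring_of_integers L) A.
  split=> // x y Ox Oy Axy; apply: contrapT => /not_orP[nx ny].
  pose B : set algC := [set z | exists a r, [/\ A a, ring_of_integers L r & z = a + r * x]].
  have AB : A `<=` B by move=> a Aa; exists a, 0; split; rewrite ?mul0r ?addr0 //; inri.
  have Bx : B x by exists 0, 1; split; rewrite ?mul1r ?add0r //; inri.
  case: (maxA B).
    by split=> // /(_ x Bx).
  right; split; last by move=> z /sIA /AB.
  - split=> [z [a [r [Aa Or ->]]]||z z' [a [r [Aa Or ->]]] [a' [r' [Aa' Or' ->]]]|s z Os [a [r [Aa Or ->]]]].
    + by have Oa := AO _ Aa; inri.
    + by apply: AB.
    + by exists (a + a'), (r + r'); split; [exact: AD | inri | ring].
    + by exists (s * a), (s * r); split; [exact: AM | inri | ring].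
  move=> [a [r [Aa Or e]]]; apply: ny.
  have -> : y = y * a + r * (x * y) by rewrite -[LHS]mulr1 e; ring.
  by apply: AD; apply: AM.
have NA : nonzero_ideal (ring_of_integers L) A by split=> //; exists x0 => //; exact: sIA.
have [w [W QW _]] := val_of_prime NL NA PrA; exists w => // x Ix.
by apply/QW; [apply: AO; exact: sIA | exact: sIA].
Qed.

(** The ideal generated by [l] is proper because the rational number 1/l is not an algebraic
    integer. *)
Lemma val_exists_over L (l : nat) : numfield L -> prime l ->
  exists2 w, val L w & 0 < w l%:R.
Proof.
move=> NL pr; have SL := NL.1.
have l0 : l%:R != 0 :> algC by rewrite pnatr_eq0 -lt0n prime_gt0.
pose I : set algC := [set x | exists2 y, ring_of_integers L y & x = l%:R * y].
have [|||w W Iw] := @val_over_ideal L I NL.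
- split=> [x [y Oy ->]||x y [z Oz ->] [t Ot ->]|r x Or [y Oy ->]].
  + by inri.
  + by exists 0; rewrite ?mulr0 //; inri.
  + by exists (z + t); [inri | ring].
  + by exists (r * y); [inri | ring].
- move=> [y [Ly Ay] e]; have : l%:R^-1 \in Aint.
    by suff -> : l%:R^-1 = y by []; apply: (mulfI l0); rewrite -e divff.
  move=> /Cint_rat_Aint; rewrite rpredV rpred_nat => /(_ isT) /intrP[n Dn].
  have : (l%:Z * n)%:~R = 1 :> algC by rewrite intrM -Dn; apply: divff.
  move/eqP; rewrite (eqr_int _ _ 1) => /eqP e1; have := dvdz_mulr n (dvdzz l).
  by rewrite e1 dvdzE /= dvdn1 => /eqP l1; move: pr; rewrite l1.
- by exists l%:R => //; exists 1; rewrite ?mulr1 //; inri.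
exists w => //; have : vge w 1 l%:R by apply: Iw; exists 1; rewrite ?mulr1 //; inri.
by move/(vgeE l0); lia.
Qed.

Lemma lying_over F L v : numfield F -> numfield L -> F `<=` L -> val F v ->
  exists w e, [/\ val L w, 0 < e & forall x, F x -> x != 0 -> w x = e * v x].
Proof.
move=> NF NL sFL V; have SF := NF.1; have SL := NL.1.
have ri_sub x : ring_of_integers F x -> ring_of_integers L x by case=> /sFL.
have [pi [Opi pi0 vpi]] := val_unif NF V.
(* The integers divisible by [pi] after localizing [F] at [v]. The ideal is proper: [t * 1 = pi * y]
   would make [y] an integer of [F] with value -1. *)
pose I : set algC := [set x | ring_of_integers L x /\ exists t y,
  [/\ ring_of_integers F t, t != 0, v t = 0, ring_of_integers L y & t * x = pi * y]].
have OLpi := ri_sub _ Opi; have [Fpi _] := Opi.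
have [|||w W Iw] := @val_over_ideal L I NL.
- split=> [x []//||x x' [Ox [t [y [Ot t0 vt Oy e]]]] [Ox' [t' [y' [Ot' t0' vt' Oy' e']]]]
    |r x Or [Ox [t [y [Ot t0 vt Oy e]]]]].
  + split; first by inri.
    by exists 1, 0; split; rewrite ?oner_neq0 ?mulr0 ?(val_1 SF V) //; inri.
  + split; first by inri.
    have OLt := ri_sub _ Ot; have OLt' := ri_sub _ Ot'; have [Ft _] := Ot; have [Ft' _] := Ot'.
    exists (t * t'), (t' * y + t * y'); split; [by inri | by rewrite mulf_neq0 | | by inri |].
      by rewrite (valM V) // vt vt'.
    by rewrite !mulrDr [t * t']mulrC -mulrA e [t' * t]mulrC -[t * t' * x']mulrA e'; ring.
  + split; first by inri.
    by exists t, (r * y); split => //; [inri | rewrite mulrCA e mulrCA].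
- move=> [_ [t [y [Ot t0 vt [Ly Ay]]]]]; rewrite mulr1 => e.
  have [Ft _] := Ot; have Dy : y = t / pi by rewrite e mulrC mulKf.
  have Oy : ring_of_integers F y by split => //; rewrite Dy; insf.
  have y0 : y != 0 by apply: contraNneq t0 => y0; rewrite e y0 mulr0.
  have := vgeE y0 (vge_ri SF V Oy); rewrite Dy (val_div SF V) // vt vpi; lia.
- exists pi => //; split => //; exists 1, 1; split; rewrite ?oner_neq0 ?(val_1 SF V) //; try inri.
  by rewrite mul1r mulr1.
exists w; have [|e e0 He] := val_restrict NF NL sFL V W; last by exists e.
move=> x Ox vx; apply: Iw; split; first exact: ri_sub.
have [->|x0] := eqVneq x 0.
  by exists 1, 0; split; rewrite ?oner_neq0 ?mulr0 ?(val_1 SF V) //; inri.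
have [Fx _] := Ox; have Fxp : F (x / pi) by insf.
have [|s [t [Os Ot t0 vt Dx]]] := val_loc NF V Fxp.
  by right; rewrite (val_div SF V) // vpi; have := vgeE x0 vx; lia.
exists t, s; split => //; first exact: ri_sub.
by rewrite -[x](divfK pi0) Dx; field.
Qed.

(** * Unramified extensions *)

Definition unr (K L : set algC) : Prop :=
  forall w, val L w -> exists x, [/\ K x, x != 0 & w x = 1].

Section SmallestIdeal.
Variables (F : set algC) (SF : subfield F).
Local Notation O := (ring_of_integers F).

Lemma ideal_O : ideal O O.
Proof. by split=> // *; inri. Qed.

Lemma ideal_smallest G : G `<=` O -> ideal O (smallest (ideal O) G).
Proof.
move=> GO; split=> [x|A [[_ + _ _] _]|x y Sx Sy A AP|r x Or Sx A AP] //.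
- by move/(_ O (conj ideal_O GO)).
- by have [[_ _ + _] _] := AP; apply; [apply: Sx | apply: Sy].
- by have [[_ _ _ +] _] := AP; apply => //; apply: Sx.
Qed.

Lemma ideal_ideal_mul I J : I `<=` O -> J `<=` O -> ideal O (ideal_mul O I J).
Proof.
move=> IO JO; apply: ideal_smallest => _ [x Ix [y Jy <-]].
by have := IO _ Ix; have := JO _ Jy; move=> ? ?; inri.
Qed.

Lemma ideal_mul_mem (I J : set algC) x y : I x -> J y -> ideal_mul O I J (x * y).
Proof. by move=> Ix Jy; apply: sub_gen_smallest; exists x => //; exists y. Qed.

Lemma ideal_ideal_exp I n : I `<=` O -> ideal O (ideal_exp O I n).
Proof.
move=> IO; elim: n => [|n IHn]; first exact: ideal_O.
by apply: ideal_ideal_mul => //; case: IHn.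
Qed.

End SmallestIdeal.

Section Unramified.
Variables (K L : set algC).
Hypotheses (NK : numfield K) (NL : numfield L) (sKL : K `<=` L).
Local Notation O := (ring_of_integers L).
Let SL : subfield L := NL.1.
Let SK : subfield K := NK.1.

Lemma ideal_exp2_val w : val L w ->
  ideal_exp O (val_ideal L w) 2 = [set x | O x /\ vge w 2 x].
Proof.
move=> W; have PQ := val_ideal_prime NL W; have IQ : ideal O (val_ideal L w) by case: PQ.
have QO : val_ideal L w `<=` O by case: IQ.
apply/seteqP; split.
  apply: smallest_sub.
    split=> [x []//||x y [[Lx Ax] vx] [[Ly Ay] vy]|r x Or [Ox vx]].
    - by split; [inri | exact: vge0].
    - by split; [inri; split | apply: (valD W)].
    - split; first by inri.
      have [Lr _] := Or; have [Lx _] := Ox.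
      by apply: (vgeMl W) => //; exact: (vge_ri SL W).
  move=> _ [x [Ox vx] [y Qy <-]].
  have {Qy} : val_ideal L w y.
    apply: Qy; split=> // _ [x' [Ox' vx'] [y' Oy' <-]]; rewrite mulrC.
    by case: IQ => _ _ _; apply.
  move=> [Oy vy]; split; first by inri.
  by have [Lx _] := Ox; have [Ly _] := Oy; apply: (vgeM W Lx Ly vx vy).
move=> x [Ox vx].
have [pi [Opi pi0 vpi]] := val_unif NL W; have [Lpi _] := Opi; have [Lx _] := Ox.
have Qpi : val_ideal L w pi by split => //; right; rewrite vpi.
have Qx : val_ideal L w x by split=> //; apply: vge_le vx.
have [E1 E2 E3 E4] := ideal_ideal_exp SL 2 QO.
have Qmul y z : val_ideal L w y -> val_ideal L w z -> ideal_exp O (val_ideal L w) 2 (y * z).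
  by move=> Qy Qz; apply: ideal_mul_mem => //; rewrite -[z]mulr1; apply: ideal_mul_mem => //; inri.
have Lxp : L (x / pi ^+ 2) by insf.
have [|s [t [Os Ot t0 vt Dx]]] := val_loc NL W Lxp.
  have [->|x0] := eqVneq x 0; first by rewrite mul0r; left.
  right; rewrite (val_div SL W) ?expf_neq0 // ?(val_X SL W) // ?vpi; last by insf.
  by rewrite mulr1 subr_ge0; apply: vgeE.
have [r Or vr] := val_max NL W Ot t0 vt.
(* Here [t * x = s * pi ^+ 2] and [r] inverts [t] modulo the prime, so each summand is a multiple of
   a product of two elements of the ideal. *)
have -> : x = (1 - r * t) * x + r * (pi * (s * pi)).
  by rewrite -[x](divfK (expf_neq0 2 pi0)) Dx; field.
apply: E3; last apply: E4 => //.
  by apply: Qmul => //; split => //; inri.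
by apply: Qmul => //; case: IQ => _ _ _; apply.
Qed.

Lemma unr_of_unramified : unramified_finite_places K L -> unr K L.
Proof.
move=> unK w W; apply: contrapT => nex.
have PQ := val_ideal_prime NL W; have NQ := val_ideal_nonzero NL W.
have QO : val_ideal L w `<=` O by case: NQ => -[].
have [_] := unK _ NQ PQ; apply; rewrite (ideal_exp2_val W).
apply: smallest_sub.
  by rewrite -(ideal_exp2_val W); apply: ideal_ideal_exp.
move=> x [[Ox vx] [Kx _]]; split => //.
have [->|x0] := eqVneq x 0; first by left.
right; have := vgeE x0 vx; rewrite le_eqVlt => /orP[/eqP e|//].
by case: nex; exists x.
Qed.

Lemma unramified_of_unr : unr K L -> unramified_finite_places K L.
Proof.
move=> unK Q NQ PQ; have [w [W QW _]] := val_of_prime NL NQ PQ.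
have QO : Q `<=` O by case: NQ => -[].
have QE : Q = val_ideal L w.
  apply/seteqP; split=> [x Qx|x [Ox vx]]; last exact/QW.
  by split; [exact: QO | apply/QW => //; exact: QO].
have [x [Kx x0 wx]] := unK _ W.
have [v [e [V e0 He]]] := val_restrict_exists NK NL sKL W.
have [s [Os s0 vs]] := val_unif NK V.
have ws : w s = 1.
  have [Ks _] := Os; rewrite He // vs mulr1.
  have := He _ Kx x0; rewrite wx => /esym; exact: int_mul_eq1.
have Qs : Q s.
  by rewrite QE; split; [case: Os => Ks As; split => //; exact: sKL | right; rewrite ws].
split.
  apply: smallest_sub; first exact: ideal_ideal_exp.
  by move=> y [Qy _]; rewrite -[y]mulr1; apply: ideal_mul_mem => //; inri.
move=> /(_ s); rewrite QE (ideal_exp2_val W); case.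
  by apply: sub_gen_smallest; split => //; rewrite -QE.
by move=> _ /(vgeE s0); rewrite ws.
Qed.

End Unramified.

Lemma conj_sqrt F s : numfield F -> F (s ^+ 2) -> ~ F s ->
  exists2 nu : {rmorphism algC -> algC}, fixes F nu & nu s = - s.
Proof.
move=> NF Fs2 nFs; apply: contrapT => nex; apply: nFs; apply: galois_fixed => // nu fx.
have /eqP := fx _ Fs2; rewrite rmorphXn /= eqf_sqr => /orP[/eqP//|/eqP e].
by case: nex; exists nu.
Qed.

(** If 1 is not a value of [F], positive values on [F] are at least 2. For a uniformizer
    [x = u + t * s], the conjugate [x'] also has positive value, or else the norm would have value
    1; so [2 * t], and away from 2 both [u] and [t], have value at least 2. Above 2, the integral
    element [(1 + s) / 2] takes over the role of [s]. *)
Lemma quad_unr F L s w : numfield F -> numfield L -> F `<=` L -> L s -> F (s ^+ 2) ->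
  (forall x, L x -> exists u t, [/\ F u, F t & x = u + t * s]) ->
  val L w -> s != 0 ->
  (w 2%:R = 0 /\ w s = 0) \/ (0 < w 2%:R /\ vge w (2%:Z * w 2%:R) (s ^+ 2 - 1)) ->
  exists x, [/\ F x, x != 0 & w x = 1].
Proof.
move=> NF NL sFL Ls Fs2 span W s0 cond; have SF := NF.1; have SL := NL.1.
case: (pselect (F s)) => [Fs|nFs].
  have [x [Lx x0 wx]] := val1 W; exists x; split => //.
  by have [u [t [Fu Ft ->]]] := span _ Lx; insf.
have [nu fx nus] := conj_sqrt NF Fs2 nFs.
apply: contrapT => nex.
have up y : F y -> vge w 1 y -> vge w 2 y.
  move=> Fy; have [->|y0] := eqVneq y 0; first by left.
  move=> /(vgeE y0); rewrite le_eqVlt => /orP[/eqP e|]; last by right.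
  by case: nex; exists y.
have [x [Ox x0 wx]] := val_unif NL W; have [Lx Ax] := Ox.
have [u [t [Fu Ft Dx]]] := span _ Lx.
have Lu := sFL _ Fu; have Lt := sFL _ Ft.
pose x' := u - t * s; have Lx' : L x' by rewrite /x'; insf.
have Dx' : x' = nu x by rewrite Dx rmorphD rmorphM /= (fx _ Fu) (fx _ Ft) nus mulrN.
have Ox' : ring_of_integers L x' by split => //=; rewrite Dx' Aint_aut.
have x'0 : x' != 0 by rewrite Dx' fmorph_eq0.
have wx' : vge w 1 x'.
  right; have := vgeE x'0 (vge_ri SL W Ox'); rewrite le_eqVlt => /orP[/eqP e|]; last exact: int_gt0.
  case: nex; exists (x * x'); split; last by rewrite (valM W) // -e wx.
    have -> : x * x' = u ^+ 2 - t ^+ 2 * s ^+ 2 by rewrite Dx /x'; ring.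
    by insf.
  by rewrite mulf_neq0.
have two0 : 2%:R != 0 :> algC by rewrite pnatr_eq0.
have L2 : L 2%:R by insf.
have wx1 : vge w 1 x by right; rewrite wx.
have F2 : F 2%:R by insf.
suff : vge w 2 x by move=> /(vgeE x0); rewrite wx.
have ws : w s = 0.
  case: cond => [[]//|[w2 ws2]].
  have Ls21 : L (s ^+ 2 - 1) by insf.
  have : w (1 + (s ^+ 2 - 1)) = w 1.
    have [] // := @val_dom L w SL W 1 (s ^+ 2 - 1) (2%:Z * w 2%:R); rewrite ?oner_neq0 ?(val_1 SL W) //.
    - by insf.
    - by move: w2; clear; lia.
  by rewrite addrC subrK (val_1 SL W) (val_X SL W) //; lia.
have wV y : L y -> vge w 1 y -> vge w 1 (y / s).
  move=> Ly vy; apply: (vgeMr W) => //; first by insf.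
  by right; rewrite (val_V SL W) // ws.
have w2t : vge w 2 (2%:R * t).
  apply: up; first by insf.
  have -> : 2%:R * t = (x - x') / s by rewrite Dx /x'; field.
  by apply: wV; [insf | apply: (vgeB SL W)].
case: cond => [[w2 _]|[w2 ws2]].
  have half y k : L y -> vge w k (2%:R * y) -> vge w k y.
    move=> Ly vy; rewrite -[y](mulKf two0); apply: (vgeMl W) => //; [by insf | by insf |].
    by right; rewrite (val_V SL W) // w2.
  rewrite Dx; apply: (valD W) => //; first by insf.
    apply: up => //; apply: half => //.
    have -> : 2%:R * u = x + x' by rewrite Dx /x'; ring.
    exact: (valD W).
  apply: (vgeMr W) => //; last by right; rewrite ws.
  exact: half.
pose th := (1 + s) / 2%:R.
have Lth : L th by rewrite /th; insf.
have vth : vge w 0 th.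
  have [->|th0] := eqVneq th 0; first by left.
  (* If [w th < 0], then [1 - th] has the same value, and [th * (1 - th) = (1 - s ^+ 2) / 4] would
     have negative value. *)
  right; rewrite leNgt; apply/negP => lt.
  have Lth1 : L (1 - th) by insf.
  have [|||||th10 wth1] := @val_dom L w SL W (- th) 1 0.
  - by insf.
  - by insf.
  - by rewrite oppr_eq0.
  - by rewrite (val_N SL W).
  - exact: (vge_1 SL W).
  rewrite addrC in th10 wth1.
  have Lss : L ((s ^+ 2 - 1) / 2%:R ^+ 2) by insf.
  have : vge w 0 (th * (1 - th)).
    have -> : th * (1 - th) = - ((s ^+ 2 - 1) / 2%:R ^+ 2) by rewrite /th; field.
    apply: (vgeN SL W) => //.
    have -> : 0 = 2%:Z * w 2%:R + - (2%:Z * w 2%:R) by rewrite subrr.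
    apply: (vgeM W) => //; [by insf | by insf |].
    by right; rewrite (val_V SL W) ?expf_neq0 // ?(val_X SL W) //; insf.
  move=> /(vgeE (mulf_neq0 th0 th10)).
  by rewrite (valM W) // wth1 (val_N SL W) //; move: lt; clear; lia.
have -> : x = (u - t) + 2%:R * t * th by rewrite Dx /th; field.
have v2th : vge w 2 (2%:R * t * th) by apply: (vgeMr W) => //; insf.
apply: (valD W) => //; [by insf | by insf |].
apply: up; first by insf.
have -> : u - t = x - 2%:R * t * th by rewrite Dx /th; field.
by apply: (vgeB SL W) => //; [insf | apply: vge_le v2th].
Qed.

(** * Embeddings and Galois groups *)

Section Embedding.
Variables (L : set algC) (s : algC -> algC).
Hypotheses (SL : subfield L) (Es : embedding L s).

Lemma emb1 : s 1 = 1. Proof. by case: Es. Qed.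
Lemma embD x y : L x -> L y -> s (x + y) = s x + s y.
Proof. by case: Es => _ + _; apply. Qed.
Lemma embM x y : L x -> L y -> s (x * y) = s x * s y.
Proof. by case: Es => _ _; apply. Qed.
Lemma emb0 : s 0 = 0.
Proof.
have := embD (sf0 SL) (sf0 SL); rewrite addr0 => e.
by apply: (@addIr _ (s 0)); rewrite add0r.
Qed.
Lemma embN x : L x -> s (- x) = - s x.
Proof.
move=> Lx; have Ln : L (- x) by insf.
by apply/eqP; rewrite -addr_eq0 -embD // addNr emb0.
Qed.
Lemma embB x y : L x -> L y -> s (x - y) = s x - s y.
Proof. by move=> Lx Ly; rewrite embD ?embN //; insf. Qed.
Lemma embV x : L x -> s x^-1 = (s x)^-1.
Proof.
move=> Lx; have [->|x0] := eqVneq x 0; first by rewrite invr0 emb0 invr0.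
have Li : L x^-1 by insf.
have e : s x * s x^-1 = 1 by rewrite -embM // divff // emb1.
have sx0 : s x != 0 by apply: contra_eq_neq e => ->; rewrite mul0r eq_sym oner_neq0.
by apply: (mulfI sx0); rewrite e divff.
Qed.
Lemma emb_div x y : L x -> L y -> s (x / y) = s x / s y.
Proof. by move=> Lx Ly; rewrite embM ?embV //; insf. Qed.
Lemma emb_nat n : s n%:R = n%:R.
Proof.
elim: n => [|n IHn]; first exact: emb0.
by rewrite -natr1 embD ?IHn ?emb1 //; insf.
Qed.
Lemma emb_int (n : int) : s n%:~R = n%:~R.
Proof.
case: n => n; first exact: emb_nat.
by rewrite NegzE mulrNz embN ?emb_nat //; insf.
Qed.
Lemma emb_rat (q : rat) : s (ratr q) = ratr q.
Proof. by rewrite /ratr emb_div ?emb_int //; insf. Qed.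
Lemma embX x n : L x -> s (x ^+ n) = s x ^+ n.
Proof.
move=> Lx; elim: n => [|n IHn]; first by rewrite !expr0 emb1.
by rewrite !exprS embM ?IHn //; insf.
Qed.
Lemma emb_evQ (p : {poly rat}) x : L x -> s (evQ p x) = evQ p (s x).
Proof.
move=> Lx; elim/poly_ind: p => [|p c IHp]; first by rewrite rmorph0 !horner0 emb0.
have ? := @sf_hornerQ _ SL p x Lx.
have Lpx : L (evQ p x * x) by insf.
rewrite rmorphD rmorphM /= map_polyX map_polyC !hornerE (embD Lpx (sf_rat SL c)).
by rewrite embM // IHp emb_rat.
Qed.

End Embedding.

Lemma fixesV K (nu : aut) : fixes K nu -> fixes K (algC_invaut nu).
Proof. by move=> fx x Kx; rewrite -{1}(fx _ Kx) algC_autK. Qed.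

(** The conjugates over [K] are among the roots of the minimal polynomial over Q, so the orbit is
    finite. *)
Lemma orbit_exists (K : set algC) y : exists2 O : seq algC, uniq O &
  forall t, t \in O <-> exists2 nu : aut, fixes K nu & nu y = t.
Proof.
have [r Dr] := closed_field_poly_normal (minCpoly y).
exists (undup [seq t <- r | `[< exists2 nu : aut, fixes K nu & nu y = t >]]).
  exact: undup_uniq.
move=> t; rewrite mem_undup mem_filter; split=> [/andP[/asboolP //]|[nu fx nuy]].
apply/andP; split; first by apply/asboolP; exists nu.
rewrite -root_prod_XsubC; have := Dr; rewrite (monicP (minCpoly_monic y)) scale1r => <-.
by rewrite -nuy -(minCpoly_aut nu y) root_minCpoly.
Qed.

Lemma perm_map_stable (O : seq algC) (mu : aut) :
  uniq O -> (forall t, t \in O -> mu t \in O) -> perm_eq (map mu O) O.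
Proof.
move=> uO st; apply: uniq_perm => //; first by rewrite map_inj_uniq //; apply: fmorph_inj.
apply: (@uniq_min_size _ (map mu O) O _ _ _).2.
- by rewrite map_inj_uniq //; apply: fmorph_inj.
- by move=> _ /mapP[t Ot ->]; apply: st.
- by rewrite size_map.
Qed.

Lemma map_prod_XsubC (mu : aut) (O : seq algC) :
  map_poly mu (\prod_(t <- O) ('X - t%:P)) = \prod_(t <- map mu O) ('X - t%:P).
Proof.
by rewrite rmorph_prod big_map; apply: eq_bigr => t _; rewrite /= map_polyXsubC.
Qed.

Lemma prod_XsubC_fixed (mu : aut) (O : seq algC) :
  uniq O -> (forall t, t \in O -> mu t \in O) ->
  forall i, mu (\prod_(t <- O) ('X - t%:P))`_i = (\prod_(t <- O) ('X - t%:P))`_i.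
Proof.
by move=> uO st i;  rewrite -coef_map map_prod_XsubC (perm_big O (perm_map_stable uO st)).
Qed.

(** The product of the [X - t] over the orbit of [th] is rational, hence divisible by the minimal
    polynomial, all of whose roots are therefore in the orbit. *)
Lemma conj_exists th t : root (minCpoly th) t -> exists nu : aut, nu th = t.
Proof.
move=> rt; have [O uO OP] := orbit_exists (range ratr) th.
set P := \prod_(t <- O) ('X - t%:P).
have Prat i : range (ratr : rat -> algC) P`_i.
  apply: (galois_fixed numfield_rat) => nu fx; apply: prod_XsubC_fixed => // u.
  move=> /OP[mu fxm <-]; apply/OP; exists (nu \o mu) => // x Qx /=.
  by rewrite fxm // fx.
have [c Hc] := choice (fun i => let: ex_intro2 q _ e := Prat i in ex_intro (fun q => ratr q = P`_i) q e).
pose q := \poly_(i < size P) c i.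
have Dq : map_poly ratr q = P.
  apply/polyP => i; rewrite coef_map coef_poly; case: ltnP => [_|le] /=; first exact: Hc.
  by rewrite rmorph0 nth_default.
have [p [Dp _] dv] := minCpolyP th.
have : p %| q.
  by rewrite -dv Dq root_prod_XsubC; apply/OP; exists [the aut of idfun].
move=> /dvdpP[q' Dq']; have : root P t by rewrite -Dq Dq' rmorphM rootM /= -Dp rt orbT.
by rewrite root_prod_XsubC => /OP[nu _ <-]; exists nu.
Qed.

(** This lets automorphisms of algC replace the partial maps of [galois_group]. *)
Lemma embedding_extends L s : numfield L -> embedding L s ->
  exists nu : aut, forall x, L x -> nu x = s x.
Proof.
move=> [SL [th Lth genL]] Es.
have [p [Dp _] _] := minCpolyP th.
have : root (minCpoly th) (s th).
  rewrite Dp /root -(emb_evQ SL Es) // -[X in s X](_ : 0 = _) ?(emb0 SL Es) //.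
  by apply/esym/rootP; rewrite -Dp root_minCpoly.
move=> /conj_exists[nu Dnu]; exists nu => x /genL[q ->].
by rewrite aut_evQ (emb_evQ SL Es) // Dnu.
Qed.

Lemma finite_extension_numfield K L : numfield K -> finite_extension K L -> numfield L.
Proof.
move=> NK [SK SL sKL [d [b Hb]]].
have NN := numfield_adjoin_seq (codom b) NK; apply: (numfield_sub NN SL).
have SN := NN.1; move=> x /Hb[c Kc ->]; apply: (sf_sum SN) => i _.
apply: (sfM SN); first by apply: adjoin_subl; apply: Kc.
by apply: adjoin_subr; apply: codom_f.
Qed.

(** Normality, drawn from the fixed-field condition: the product of the [X - t] over the images of
    [x] under Gal(L/K) has coefficients in [K], so [nu x] is one of its roots. *)
Lemma abelian_stable K L (nu : aut) x : numfield K -> abelian_extension K L ->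
  fixes K nu -> L x -> L (nu x).
Proof.
move=> NK [fin fixL _] fx Lx; have NL := finite_extension_numfield NK fin.
have [_ SL sKL _] := fin.
have [O uO OP] := orbit_exists K x.
pose O' := [seq t <- O | `[< exists2 s, galois_group K L s & s x = t >]].
have uO' : uniq O' by rewrite filter_uniq.
pose P := \prod_(t <- O') ('X - t%:P).
have O'P t : t \in O' <-> exists2 s, galois_group K L s & s x = t.
  rewrite mem_filter; split=> [/andP[/asboolP //]|[s Gs sx]].
  apply/andP; split; first by apply/asboolP; exists s.
  have [Es _ sK] := Gs; have [mu Hmu] := embedding_extends NL Es.
  apply/OP; exists mu; last by rewrite Hmu.
  by move=> y Ky; rewrite Hmu ?sK //; exact: sKL.
have LO' t : t \in O' -> L t.
  by move=> /O'P[s [_ <- _] <-]; exists x.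
have LP i : L P`_i.
  rewrite /P; move: LO' {O'P P uO'}; elim: O' i => [|t l IHl] i Ll.
    by rewrite big_nil coefC; case: (i == 0%N); insf.
  rewrite big_cons mulrBl coefB coefXM coefCM.
  have Lt : L t by apply: Ll; rewrite mem_head.
  have Ll' j : L (\prod_(t <- l) ('X - t%:P))`_j.
    by apply: IHl => u lu; apply: Ll; rewrite inE lu orbT.
  have := Ll' i; have := Ll' i.-1; case: (i == 0%N) => ? ?; insf.
have KP i : K P`_i.
  rewrite -[K]fixL; split=> // s Gs; have [Es imL sK] := Gs.
  have [mu Hmu] := embedding_extends NL Es; rewrite -Hmu //.
  apply: prod_XsubC_fixed => // t /O'P[s' [Es' imL' sK'] <-].
  have Ls'x : L (s' x) by rewrite -imL'; exists x.
  apply/O'P; exists (s \o s'); last by rewrite /= Hmu.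
  split.
  - split=> [|y z Ly Lz|y z Ly Lz] /=; rewrite ?(emb1 Es') ?(emb1 Es) //.
      rewrite (embD Es') // (embD Es) // -imL'; [by exists y | by exists z].
    rewrite (embM Es') // (embM Es) // -imL'; [by exists y | by exists z].
  - by rewrite -image_comp imL' imL.
  - by move=> y Ky /=; rewrite sK' // sK.
have : root P (nu x).
  have <- : map_poly nu P = P by apply/polyP => i; rewrite coef_map /= fx.
  rewrite fmorph_root root_prod_XsubC; apply/O'P; exists idfun => //.
  by split=> //; rewrite image_id.
by rewrite root_prod_XsubC => /LO'.
Qed.

(** * Inertia and composita *)

Section Frobenius.
Variables (L : set algC) (v : algC -> int) (l : nat).
Hypotheses (SL : subfield L) (V : val L v) (pr_l : prime l) (vl : 0 < v l%:R).

Lemma vge_powB k n a b : L a -> L b -> vge v 0 a -> vge v 0 b ->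
  vge v k (a - b) -> vge v k (a ^+ n - b ^+ n).
Proof.
move=> La Lb va vb vab; rewrite subrXX; apply: (vgeMr V) => //; first by insf.
  by apply: (sf_sum SL) => i _; insf.
apply: (vge_sum SL V) => i _; first by insf.
by apply: (vgeMl V); try (by insf); apply: (vgeX SL V).
Qed.

Lemma vge_l : vge v 1 l%:R.
Proof. by right; apply: int_gt0. Qed.

(** The cofactor of [a - b] in [a ^+ l - b ^+ l] is congruent to [l * b ^+ l.-1], hence has positive
    value. *)
Lemma vge_powlB k a b : 1 <= k -> L a -> L b -> vge v 0 a -> vge v 0 b ->
  vge v k (a - b) -> vge v (k + 1) (a ^+ l - b ^+ l).
Proof.
move=> k1 La Lb va vb vab; rewrite subrXX; apply: (vgeM V) => //; first by insf.
  by apply: (sf_sum SL) => i _; insf.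
have -> : \sum_(i < l) a ^+ (l.-1 - i) * b ^+ i =
    \sum_(i < l) (a ^+ (l.-1 - i) - b ^+ (l.-1 - i)) * b ^+ i + l%:R * b ^+ l.-1.
  rewrite mulr_natl -[X in _ *+ X]card_ord -sumr_const -big_split /=; apply: eq_bigr => i _.
  have -> : b ^+ l.-1 = b ^+ (l.-1 - i) * b ^+ i.
    by rewrite -exprD subnK // -ltnS prednK ?prime_gt0.
  by ring.
have LS : L (\sum_(i < l) (a ^+ (l.-1 - i) - b ^+ (l.-1 - i)) * b ^+ i).
  by apply: (sf_sum SL) => i _; insf.
apply: (valD V) => //; first by insf.
  apply: (vge_sum SL V) => i _; first by insf.
  apply: (vgeMr V); try (by insf); last exact: (vgeX SL V).
  by apply: vge_powB => //; apply: vge_le vab.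
by apply: (vgeMr V); try (by insf); [exact: vge_l | exact: (vgeX SL V)].
Qed.

Lemma vge_frobD a b : L a -> L b -> vge v 0 a -> vge v 0 b ->
  vge v 1 ((a + b) ^+ l - (a ^+ l + b ^+ l)).
Proof.
move=> La Lb va vb; have l0 := prime_gt0 pr_l.
have -> : (a + b) ^+ l - (a ^+ l + b ^+ l) =
    \sum_(i < l.-1) (a ^+ (l - i.+1) * b ^+ i.+1) *+ 'C(l, i.+1).
  case: (l) l0 => // n _; rewrite exprDn big_ord_recl big_ord_recr /=.
  rewrite bin0 subn0 expr0 mulr1 mulr1n /bump /= add1n subnn binn mul1r mulr1n.
  set S := \sum_(i < n) _; have -> : a ^+ n.+1 + (S + b ^+ n.+1) - (a ^+ n.+1 + b ^+ n.+1) = S by ring.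
  by apply: eq_bigr => i _; rewrite add1n.
apply: (vge_sum SL V) => i _; first by insf.
rewrite -mulr_natr; apply: (vgeMl V); try (by insf).
  by apply: (vgeMl V); try (by insf); apply: (vgeX SL V).
have : (l %| 'C(l, i.+1))%N.
  by apply: prime_dvd_bin => //=; rewrite -[X in (_ < X)%N](prednK l0) ltnS.
move=> /dvdnP[c ->]; rewrite natrM; apply: (vgeMl V); try (by insf); [exact: (vge_nat SL V) | exact: vge_l].
Qed.

Lemma vge_frobXD n a b : L a -> L b -> vge v 0 a -> vge v 0 b ->
  vge v 1 ((a + b) ^+ (l ^ n) - (a ^+ (l ^ n) + b ^+ (l ^ n))).
Proof.
move=> La Lb va vb; elim: n => [|n IHn].
  by rewrite expn0 !expr1 subrr; left.
set A := a ^+ (l ^ n) in IHn *; set B := b ^+ (l ^ n) in IHn *; set C := (a + b) ^+ (l ^ n) in IHn.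
have LA : L A by rewrite /A; insf. have LB : L B by rewrite /B; insf. have LC : L C by rewrite /C; insf.
have vA : vge v 0 A by apply: (vgeX SL V). have vB : vge v 0 B by apply: (vgeX SL V).
have vC : vge v 0 C by apply: (vgeX SL V); [insf | apply: (valD V)].
rewrite expnSr !exprM -/A -/B -/C.
have -> : C ^+ l - (A ^+ l + B ^+ l) = (C ^+ l - (A + B) ^+ l) + ((A + B) ^+ l - (A ^+ l + B ^+ l)) by ring.
apply: (valD V); [by insf | by insf | |exact: vge_frobD].
by apply: vge_powB => //; [insf | apply: (valD V)].
Qed.

(** Replaces the finiteness of the residue field: modulo the integral equation of [x] and modulo
    [l], its powers reduce to finitely many polynomials. *)
Lemma pigeonhole_powers x : ring_of_integers L x ->
  exists i j, (i < j)%N /\ vge v 1 (x ^+ (l ^ i) - x ^+ (l ^ j)).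
Proof.
move=> Ox; have [Lx /= Ax] := Ox; have /floorpP[p Dp] := Ax.
have mon : p \is monic.
  have := minCpoly_monic x; rewrite Dp !monicE lead_coef_map_inj //; last exact: intr_inj.
  by rewrite /= (eqr_int _ _ 1).
have px : (map_poly intr p).[x] = 0 by rewrite -Dp; apply/rootP/root_minCpoly.
pose a N := Pdiv.Ring.rmodp 'X^N p; pose m := (size p).-1.
have p0 : p != 0 by rewrite monic_neq0.
have sa N : (size (a N) <= m)%N.
  by rewrite /m -ltnS prednK ?size_poly_gt0 // Pdiv.Ring.ltn_rmodpN0.
have xN N : x ^+ N = \sum_(i < m) ((a N)`_i)%:~R * x ^+ i.
  have := Pdiv.RingMonic.rdivp_eq mon ('X^N : {poly int}).
  move=> /(congr1 (fun q => (map_poly (intr : int -> algC) q).[x])).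
  rewrite rmorphD rmorphM /= !hornerE px mulr0 add0r map_polyXn hornerXn => ->.
  rewrite (@horner_coef_wide _ m); last by apply: leq_trans (size_poly _ _) _; exact: sa.
  by apply: eq_bigr => i _; rewrite coef_map.
have l0 := prime_gt0 pr_l.
pose f (N : nat) : {ffun 'I_m -> 'I_(l.-1.+1)} := [ffun i : 'I_m => inord `|((a N)`_i %% l)%Z|].
pose B := #|{: {ffun 'I_m -> 'I_(l.-1.+1)}}|.
have : ~~ injectiveb (fun i : 'I_B.+1 => f (l ^ i)%N).
  apply/negP => /injectiveP/leq_card; rewrite card_ord -/B; by rewrite ltnn.
move=> /injectivePn[i [j nij e]].
have fin N M : f N = f M -> vge v 1 (x ^+ N - x ^+ M).
  move=> /ffunP e'; rewrite (xN N) (xN M) -sumrB; apply: (vge_sum SL V) => k _; first by insf.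
  rewrite -mulrBl -intrB; apply: (vgeMr V); try (by insf); last first.
    by apply: (vgeX SL V) => //; exact: (vge_ri SL V).
  have := e' k; rewrite !ffunE => /(congr1 (@nat_of_ord _)).
  have lz : (l : int) != 0 by case: (l) l0.
  have lt N' : (`|((a N')`_k %% l)%Z| < l.-1.+1)%N.
    rewrite prednK // -ltz_nat gez0_abs ?modz_ge0 //.
    exact: ltz_pmod.
  rewrite /= !inordK // => e2.
  have : (l %| (a N)`_k - (a M)`_k)%Z.
    rewrite -eqz_mod_dvd; apply/eqP; have := congr1 Posz e2.
    by rewrite !gez0_abs ?modz_ge0.
  move=> /dvdzP[c ->]; rewrite intrM; apply: (vgeMl V); try (by insf); [exact: (vge_int SL V) | exact: vge_l].
have /orP[lt|lt] : (i < j)%N || (j < i)%N by rewrite -neq_ltn.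
  by exists i, j; split => //; apply: fin.
by exists j, i; split => //; apply: fin.
Qed.

(** When [x ^+ (l ^ i)] and [x ^+ (l ^ j)] agree, additivity of Frobenius makes
    [x ^+ (l ^ (j - i)) - x] nilpotent modulo the prime, hence zero there. *)
Lemma frobenius_fixed_ri x : ring_of_integers L x ->
  exists2 k, (0 < k)%N & vge v 1 (x ^+ (l ^ k) - x).
Proof.
move=> Ox; have [i [j [lt vij]]] := pigeonhole_powers Ox; have [Lx _] := Ox.
exists (j - i)%N; first by rewrite subn_gt0.
set y := x ^+ _; have Ly : L y by rewrite /y; insf.
have vx : vge v 0 x := vge_ri SL V Ox.
have vy : vge v 0 y by apply: (vgeX SL V).
have Lyx : L (y - x) by insf.
have := vge_frobXD i Lx Lyx vx (vgeB SL V Ly Lx vy vx).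
rewrite [x + (y - x)]addrC subrK -exprM -expnD subnK ?(ltnW lt) // => v1.
have {v1} vp : vge v 1 ((y - x) ^+ (l ^ i)).
  have -> : (y - x) ^+ (l ^ i) = (x ^+ (l ^ j) - x ^+ (l ^ i)) - (x ^+ (l ^ j) - (x ^+ (l ^ i) + (y - x) ^+ (l ^ i))) by ring.
  apply: (vgeB SL V) => //; try (by insf).
  by rewrite -opprB; apply: (vgeN SL V) => //; insf.
have [->|nz] := eqVneq (y - x) 0; first by left.
right; have := vgeE (expf_neq0 (l ^ i) nz) vp; rewrite (val_X SL V) // => ge1.
by apply: int_gt0; move: ge1; case: (v (y - x)) => [[|k]|k]; rewrite ?mulr0 //; clear; nia.
Qed.

End Frobenius.

Lemma frobenius_fixed L v l x : numfield L -> val L v -> prime l -> 0 < v l%:R ->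
  L x -> vge v 0 x -> exists2 k, (0 < k)%N & vge v 1 (x ^+ (l ^ k) - x).
Proof.
move=> NL V pr vl Lx vx; have SL := NL.1.
have [s [t [Os Ot t0 vt Dx]]] := val_loc NL V Lx vx.
have [r Or vr] := val_max NL V Ot t0 vt.
have Ors : ring_of_integers L (r * s) by inri.
have [k k0 vk] := frobenius_fixed_ri SL V pr vl Ors; exists k => //.
have [Lrs _] := Ors; have vrs := vge_ri SL V Ors.
have vd : vge v 1 (x - r * s).
  have -> : x - r * s = x * (1 - r * t) by rewrite Dx; field.
  have [Lr _] := Or; have [Lt _] := Ot.
  by apply: (vgeMl V) => //; insf.
have -> : x ^+ (l ^ k) - x = (x ^+ (l ^ k) - (r * s) ^+ (l ^ k)) + ((r * s) ^+ (l ^ k) - r * s) - (x - r * s) by ring.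
apply: (vgeB SL V) => //; try (by insf).
by apply: (valD V) => //; try (by insf); apply: (vge_powB SL V).
Qed.

Definition stable (K L : set algC) :=
  forall nu : aut, fixes K nu -> forall x, L x -> L (nu x).

(** The congruence of [g x] with [x] lifts to all powers of [pi], a uniformizer of [L] lying in [K].
    In [x = (x ^+ (l ^ k)) ^+ l + pi * x1], raising to the power [l] improves a congruence by one,
    and so does the factor [pi], which [g] fixes. *)
Lemma inertia_trivial K L M w (g : aut) : numfield K -> numfield L -> numfield M ->
  K `<=` L -> L `<=` M -> stable K L -> unr K L -> val M w -> fixes K g ->
  (forall u, ring_of_integers M u -> vge w 1 (g u - u)) -> fixes L g.
Proof.
move=> NK NL NM sKL sLM stL unL W fg Hw; have SL := NL.1; have SM := NM.1.
have [v [e [V e0 He]]] := val_restrict_exists NL NM sLM W.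
have [pi [Kpi pi0 vpi]] := unL _ V; have Lpi := sKL _ Kpi.
have [l pr vl] := val_prime NL V.
have base0 u : ring_of_integers L u -> vge v 1 (g u - u).
  move=> [Lu Au]; have [|->|] := Hw u; first by split => //; exact: sLM.
    by left.
  have Lgu : L (g u - u) by have ? := stL g fg u Lu; insf.
  have [->|nz] := eqVneq (g u - u) 0; first by left.
  rewrite He // => ge1; right; apply: int_gt0; move: ge1 e0; clear.
  by case: e => // e; case: (v _) => [[|k]|k]; rewrite ?mulr0 //; nia.
have base x : L x -> vge v 0 x -> vge v 1 (g x - x).
  move=> Lx vx; have [s [t [Os Ot t0 vt Dx]]] := val_loc NL V Lx vx.
  have [Ls _] := Os; have [Lt _] := Ot; have Lgs := stL g fg s Ls; have Lgt := stL g fg t Lt.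
  have Lgtt : L (g t - t) by insf.
  have [||gt0 vgt] := @val_dom L v SL V t (g t - t) 1 Lt Lgtt t0.
  - by rewrite vt.
  - exact: base0.
  rewrite addrC subrK in gt0; rewrite addrC subrK vt in vgt.
  have -> : g x - x = ((g s - s) * t - s * (g t - t)) / (t * g t).
    by rewrite Dx fmorph_div; field; rewrite t0 gt0.
  apply: (vgeMr V); try (by insf).
    apply: (vgeB SL V); try (by insf).
      apply: (vgeMr V); try (by insf); [exact: base0 | exact: (vge_ri SL V)].
    apply: (vgeMl V); try (by insf); [exact: (vge_ri SL V) | exact: base0].
  right; rewrite (val_V SL V) ?mulf_neq0 //; last by insf.
  by rewrite (valM V) // vt vgt.
have step (n : nat) : forall x, L x -> vge v 0 x -> vge v (n.+1)%:Z (g x - x).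
  elim: n => [//|n IHn] x Lx vx.
  have [[//|k] _ vk] := frobenius_fixed NL V pr vl Lx vx.
  pose x1 := (x - x ^+ (l ^ k.+1)) / pi; have Lx1 : L x1 by rewrite /x1; insf.
  have vx1 : vge v 0 x1.
    change (vge v (1 - 1) x1).
    apply: (vgeM V); try (by insf); last by right; rewrite (val_V SL V) // vpi.
    by rewrite -opprB; apply: (vgeN SL V) => //; insf.
  have Dx : x = (x ^+ (l ^ k)) ^+ l + pi * x1.
    by rewrite -exprM -expnSr /x1; field.
  have Lgx := stL g fg x Lx; have Lgx1 := stL g fg x1 Lx1.
  have vgx : vge v 0 (g x).
    rewrite -[g x](subrK x); apply: (valD V) => //; first by insf.
    by apply: vge_le (base _ Lx vx).
  have -> : g x - x = ((g x ^+ (l ^ k)) ^+ l - (x ^+ (l ^ k)) ^+ l) + pi * (g x1 - x1).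
    have Dgx : g x = (g x ^+ (l ^ k)) ^+ l + pi * g x1.
      by rewrite {1}Dx rmorphD rmorphM !rmorphXn /= (fg _ Kpi).
    transitivity (((g x ^+ (l ^ k)) ^+ l + pi * g x1) - ((x ^+ (l ^ k)) ^+ l + pi * x1)).
      by rewrite -Dgx -Dx.
    by ring.
  apply: (valD V); try (by insf).
    have -> : n.+2%:Z = n.+1%:Z + 1 by rewrite -PoszD addn1.
    apply: (vge_powlB SL V pr vl) => //; try (by insf); try (by apply: (vgeX SL V)).
    by apply: (vge_powB SL V) => //; exact: IHn.
  have -> : n.+2%:Z = 1 + n.+1%:Z by rewrite -PoszD add1n.
  by apply: (vgeM V); try (by insf); [right; rewrite vpi | exact: IHn].
have fin x : L x -> vge v 0 x -> g x = x.
  move=> Lx vx; apply/eqP; rewrite -subr_eq0; apply: contraT => nz.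
  by have := vgeE nz (step (absz (v (g x - x))) x Lx vx); case: (v (g x - x)) => k /=; lia.
move=> x Lx; have [->|x0] := eqVneq x 0; first by rewrite rmorph0.
case: (lerP 0 (v x)) => vx; first by apply: fin => //; right.
apply: (can_inj invrK); rewrite -fmorphV; apply: fin; first by insf.
by right; rewrite (val_V SL V) //; move: vx; clear; lia.
Qed.

Lemma fixesC K (nu mu : aut) : fixes K nu -> fixes K mu -> fixes K (nu \o mu).
Proof. by move=> fn fm x Kx; rewrite /= fm // fn. Qed.

Lemma fixes_adjoin F S (nu : aut) : fixes F nu -> fixes S nu -> fixes (adjoin F S) nu.
Proof.
move=> fF fS; have : adjoin F S `<=` [set x | nu x = x]; last by move=> + x => /(_ x).
apply: adjoin_min => //; split=> [|x y /= ex ey|x y /= ex ey].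
- exact: rmorph1.
- by rewrite rmorphB ex ey.
- by rewrite fmorph_div ex ey.
Qed.

Lemma stable_adjoin K L1 L2 : stable K L1 -> stable K L2 -> stable K (adjoin L1 L2).
Proof.
move=> st1 st2 nu fn; have SA := subfield_adjoin L1 L2.
have : adjoin L1 L2 `<=` [set x | adjoin L1 L2 (nu x)]; last by move=> + x => /(_ x).
apply: adjoin_min.
- split=> [|x y /= ex ey|x y /= ex ey].
  + by rewrite /= rmorph1; insf.
  + by rewrite rmorphB; insf.
  + by rewrite fmorph_div; insf.
- by move=> x Lx /=; apply: adjoin_subl; apply: st1 nu fn x Lx.
- by move=> x Lx /=; apply: adjoin_subr; apply: st2 nu fn x Lx.
Qed.

Lemma numfield_adjoin L1 L2 : numfield L1 -> numfield L2 -> numfield (adjoin L1 L2).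
Proof.
move=> N1 [S2 [th Lth genL]].
suff -> : adjoin L1 L2 = adjoin L1 [set` [:: th]] by apply: numfield_adjoin_seq.
apply: adjoin_eq => x.
  move=> /genL[p ->]; apply: (sf_hornerQ (subfield_adjoin _ _)).
  by apply: adjoin_subr; rewrite /= inE.
by rewrite /= inE => /eqP ->; apply: adjoin_subr.
Qed.

Lemma val_aut M w (g : aut) : (forall x, M x -> M (g x)) ->
  (forall x, M x -> M (algC_invaut g x)) -> val M w -> val M (w \o g).
Proof.
move=> gM gM' W; have gv k x : vge (w \o g) k x <-> vge w k (g x).
  split=> [[->|le]|[/eqP|le]]; [by left; rewrite rmorph0 | by right | | by right].
  by rewrite fmorph_eq0 => /eqP ->; left.
split.
- by move=> x y Mx My x0 y0; rewrite /= rmorphM (valM W) ?fmorph_eq0 //; apply: gM.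
- move=> k x y Mx My /gv vx /gv vy; apply/gv; rewrite rmorphD.
  by apply: (valD W) => //; apply: gM.
- have [x [Mx x0 wx]] := val1 W; exists (algC_invaut g x); split.
  + exact: gM'.
  + by rewrite fmorph_eq0.
  + by rewrite /= algC_invautK.
Qed.

(* Dedekind's independence of the ring homomorphisms O_M -> O_M/Q induced by
   automorphisms that are pairwise distinct modulo Q. *)
Lemma dedekind_mod M w (nu : algC -> aut) (l : seq algC) : numfield M -> val M w ->
  (forall t x, t \in l -> M x -> M (nu t x)) ->
  (forall t, t \in l -> exists u, [/\ ring_of_integers M u, nu t u - u != 0 & w (nu t u - u) = 0]) ->
  forall (a : algC -> algC) a1, (forall t, t \in l -> M (a t) /\ vge w 0 (a t)) ->
  M a1 -> a1 != 0 -> w a1 = 0 ->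
  exists2 x, ring_of_integers M x & ~ vge w 1 (a1 * x + \sum_(t <- l) a t * nu t x).
Proof.
move=> NM W nuM; have SM := NM.1.
have riA (g : aut) x : (forall x, M x -> M (g x)) -> ring_of_integers M x -> ring_of_integers M (g x).
  by move=> gM [Mx Ax]; split; [exact: gM | rewrite /= Aint_aut].
elim: l nuM => [|t0 l IHl] nuM tr a a1 Ha Ma1 a10 wa1.
  exists 1; first by inri.
  by rewrite big_nil addr0 mulr1 => /(vgeE a10); rewrite wa1.
apply: contrapT => nex.
have H x : ring_of_integers M x -> vge w 1 (a1 * x + (a t0 * nu t0 x + \sum_(t <- l) a t * nu t x)).
  by move=> Ox; apply: contrapT => nv; apply: nex; exists x => //; rewrite big_cons.
have [u [Ou nz wu]] := tr _ (mem_head _ _).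
have [Mu _] := Ou; have Ogu : ring_of_integers M (nu t0 u).
  by apply: riA => // x; apply: nuM; rewrite mem_head.
have [Mgu _] := Ogu.
have nuMl t x : t \in l -> M x -> M (nu t x) by move=> lt; apply: nuM; rewrite inE lt orbT.
(* The relation at [u * x] minus [nu t0 u] times the relation at [x] eliminates [t0]. Only the
   coefficient of the identity has to remain a unit, so what matters is that each [nu t] differs
   from the identity modulo the prime. *)
have [||t lt||||x Ox] := IHl _ _ (fun t => a t * (nu t u - nu t0 u)) (a1 * (u - nu t0 u)).
- exact: nuMl.
- by move=> t lt; apply: tr; rewrite inE lt orbT.
- have [Mat vat] : M (a t) /\ vge w 0 (a t) by apply: Ha; rewrite inE lt orbT.
  have Otu : ring_of_integers M (nu t u) by apply: riA => // x; apply: nuMl.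
  have [Mtu _] := Otu; split; first by insf.
  apply: (vgeMl W) => //; first by insf.
  by apply: (vge_ri SM W); inri.
- by insf.
- by rewrite mulf_neq0 // -opprB oppr_eq0.
- rewrite (valM W) ?wa1 //; [|by insf|by rewrite -opprB oppr_eq0].
  by rewrite -opprB (val_N SM W) ?wu //; insf.
case; have [Mx _] := Ox.
have Oux : ring_of_integers M (u * x) by inri.
have Ms y : M y -> M (\sum_(t <- l) a t * nu t y).
  move=> My; apply: (sf_sum_seq SM) => t lt; have Mty := nuMl t y lt My.
  by have [Mat _] : M (a t) /\ vge w 0 (a t) by [apply: Ha; rewrite inE lt orbT]; insf.
have [Ma0 _] := Ha _ (mem_head _ _).
have Mgx : M (nu t0 x) by apply: nuM; rewrite ?mem_head.
have Mgux : M (nu t0 (u * x)) by rewrite rmorphM; insf.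
have S1 := Ms _ Mx; have Mux : M (u * x) by insf. have S2 := Ms _ Mux.
set R := (X in vge w 1 X); have -> : R = (a1 * (u * x) + (a t0 * nu t0 (u * x) + \sum_(t <- l) a t * nu t (u * x)))
   - nu t0 u * (a1 * x + (a t0 * nu t0 x + \sum_(t <- l) a t * nu t x)).
  rewrite /R; have -> : \sum_(t <- l) a t * (nu t u - nu t0 u) * nu t x =
      \sum_(t <- l) a t * nu t (u * x) - nu t0 u * \sum_(t <- l) a t * nu t x.
    by rewrite mulr_sumr -sumrB; apply: eq_bigr => t _; rewrite rmorphM; ring.
  by rewrite rmorphM; ring.
apply: (vgeB SM W); try (by insf); first exact: H.
by apply: (vgeMl W); try (by insf); [exact: (vge_ri SM W) | exact: H].
Qed.

Definition unr_normal (K L : set algC) :=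
  [/\ numfield L, K `<=` L, stable K L & unr K L].

(* If no value w(y), y in K, were 1, then the trace of x z would have
   valuation at least 2 for every integer x, where z has valuation 1 at w and
   positive valuation at all the conjugates of w; dividing by z contradicts
   the independence of the automorphisms modulo Q. *)
Lemma compositum_unr K L1 L2 : numfield K ->
  unr_normal K L1 -> unr_normal K L2 -> unr_normal K (adjoin L1 L2).
Proof.
move=> NK [N1 K1 st1 un1] [N2 K2 st2 un2]; set M := adjoin L1 L2.
have NM : numfield M := numfield_adjoin N1 N2; have SM := NM.1; have SK := NK.1.
have stM : stable K M := stable_adjoin st1 st2.
have L1M : L1 `<=` M by apply: adjoin_subl. have L2M : L2 `<=` M by apply: adjoin_subr.
have sKM : K `<=` M by move=> x /K1 /L1M.
split=> // w W; apply: contrapT => nex.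
have up y : K y -> vge w 1 y -> vge w 2 y.
  move=> Ky; have [->|y0] := eqVneq y 0; first by left.
  move=> /(vgeE y0); rewrite le_eqVlt => /orP[/eqP e|]; last by right.
  by case: nex; exists y.
have [_ [th Mth genM]] := NM.
have [O uO OP] := orbit_exists K th.
have ex_nu t : exists nu : aut, t \in O -> fixes K nu /\ nu th = t.
  case: (boolP (t \in O)) => [/OP[nu fn nt]|_]; first by exists nu.
  by exists [the aut of idfun].
have [nu Hnu] := choice ex_nu.
have fnu t : t \in O -> fixes K (nu t) by case/Hnu.
have nuth t : t \in O -> nu t th = t by case/Hnu.
have Oth : th \in O by apply/OP; exists [the aut of idfun].
have nuM t x : t \in O -> M x -> M (nu t x) by move=> Ot; apply: stM; exact: fnu.
have nu1 x : M x -> nu th x = x by move=> /genM[p ->]; rewrite aut_evQ nuth.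
have riA t x : t \in O -> ring_of_integers M x -> ring_of_integers M (nu t x).
  by move=> Ot [Mx Ax]; split; [exact: nuM | rewrite /= Aint_aut].
have trK x : M x -> K (\sum_(t <- O) nu t x).
  move=> /genM[p ->]; apply: galois_fixed => // mu fmu.
  rewrite rmorph_sum /=.
  have stO t : t \in O -> mu t \in O.
    by move=> /OP[rho frho <-]; apply/OP; exists (mu \o rho) => //; exact: fixesC.
  have -> : \sum_(t <- O) mu (nu t (evQ p th)) = \sum_(t <- O) evQ p (mu t).
    by rewrite !big_seq; apply: eq_bigr => t Ot; rewrite !aut_evQ nuth.
  have -> : \sum_(t <- O) nu t (evQ p th) = \sum_(t <- O) evQ p t.
    by rewrite !big_seq; apply: eq_bigr => t Ot; rewrite !aut_evQ nuth.
  by rewrite -[RHS](perm_big _ (perm_map_stable uO stO)) big_map.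
have inertia t : t \in O -> t != th ->
    exists u, [/\ ring_of_integers M u, nu t u - u != 0 & w (nu t u - u) = 0].
  move=> Ot nt; apply: contrapT => nex'.
  have Hw u : ring_of_integers M u -> vge w 1 (nu t u - u).
    move=> Ou; have [->|nz] := eqVneq (nu t u - u) 0; first by left.
    have Onu := riA _ _ Ot Ou; have Ot' : ring_of_integers M (nu t u - u) by inri.
    right; have := vgeE nz (vge_ri SM W Ot'); rewrite le_eqVlt => /orP[/eqP e|].
      by case: nex'; exists u.
    exact: int_gt0.
  have f1 := inertia_trivial NK N1 NM K1 L1M st1 un1 W (fnu _ Ot) Hw.
  have f2 := inertia_trivial NK N2 NM K2 L2M st2 un2 W (fnu _ Ot) Hw.
  by have := fixes_adjoin f1 f2 Mth; rewrite nuth // => e; rewrite e eqxx in nt.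
(* Prime avoidance: if [w \o nu t] differs from [w], some integer is a unit at [w] and has positive
   value at [w \o nu t]; otherwise 1 is taken. The product of these elements with a uniformizer will
   be [z]. *)
have ex_T t : exists x, t \in O -> [/\ ring_of_integers M x, x != 0, w x = 0 &
    vge w 1 (nu t x) \/ forall y, M y -> y != 0 -> w (nu t y) = w y].
  case: (boolP (t \in O)) => [Ot|_]; last by exists 0.
  have Wt : val M (w \o nu t).
    apply: val_aut => // x Mx; first exact: nuM.
    by apply: stM => //; apply: fixesV; exact: fnu.
  case: (pselect (forall x, ring_of_integers M x -> vge (w \o nu t) 1 x -> vge w 1 x)) => [Hx|].
    exists 1 => _; split; rewrite ?oner_neq0 ?(val_1 SM W) //; first by inri.
    by right=> y My y0; have := val_eq NM Wt W Hx My y0.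
  move=> /existsNP[x] /not_implyP[Ox] /not_implyP[vx nvx]; exists x => _.
  have x0 : x != 0 by apply/eqP => x0; apply: nvx; left.
  split=> //.
    have := vgeE x0 (vge_ri SM W Ox); rewrite le_eqVlt => /orP[/eqP//|wx].
    by case: nvx; right; exact: int_gt0.
  left; case: vx => [e|]; last by right.
  by rewrite e eqxx in x0.
have [T HT] := choice ex_T.
have [z0 [Oz0 z00 wz0]] := val_unif NM W.
have OT t : t \in O -> ring_of_integers M (T t) by case/HT.
pose Pz := \prod_(t <- O) T t; pose z := z0 * Pz.
have prodT l : {subset l <= O} -> [/\ ring_of_integers M (\prod_(t <- l) T t),
    \prod_(t <- l) T t != 0 & w (\prod_(t <- l) T t) = 0].
  elim: l => [|t l IHl] sub.
    by rewrite big_nil oner_neq0 (val_1 SM W); split=> //; inri.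
  have Ol u : u \in l -> u \in O by move=> lu; apply: sub; rewrite inE lu orbT.
  have [Ot t0 wt _] := HT t (sub _ (mem_head _ _)).
  have [Opl l0 wl] := IHl Ol; rewrite big_cons mulf_neq0 //; split=> //; first by inri.
  by have [Mt _] := Ot; have [Ml _] := Opl; rewrite (valM W) // wt wl.
have [OPz Pz0 wPz] := prodT O (fun t Ot => Ot).
have [Mz0 _] := Oz0; have [MPz _] := OPz.
have Oz : ring_of_integers M z by rewrite /z; inri.
have [Mz _] := Oz; have z_0 : z != 0 by rewrite mulf_neq0.
have wz : w z = 1 by rewrite (valM W) // wz0 wPz.
have wnuz t : t \in O -> vge w 1 (nu t z).
  move=> Ot; have [OTt Tt0 wTt [wnu|wnu]] := HT _ Ot; last by right; rewrite wnu ?wz.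
  have [Or _ _] := prodT (rem t O) (fun u => @mem_rem _ _ _ u).
  have [Mr _] := Or; have Mnr := nuM _ _ Ot Mr; have [MTt _] := OTt.
  have MnT := nuM _ _ Ot MTt; have Mnz0 := nuM _ _ Ot Mz0.
  rewrite /z /Pz (big_rem t Ot) /= mulrCA !rmorphM /=; apply: (vgeMr W) => //; first by insf.
  apply: (vgeMl W) => //; first exact: (vge_ri SM W (riA _ _ Ot Oz0)).
  exact: (vge_ri SM W (riA _ _ Ot Or)).
have remO t : t \in rem th O -> t \in O by apply: mem_rem.
have remth t : t \in rem th O -> t != th by rewrite mem_rem_uniq // inE => /andP[].
have [||||||x Ox] := @dedekind_mod M w nu (rem th O) NM W _ _ (fun t => nu t z / z) 1.
- by move=> t x /remO; exact: nuM.
- by move=> t rt; apply: inertia; [exact: remO | exact: remth].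
- move=> t /remO Ot; have Mnz := nuM _ _ Ot Mz; split; first by insf.
  change (vge w (1 - 1) (nu t z / z)).
  by apply: (vgeM W) => //; [insf | exact: wnuz | right; rewrite (val_V SM W) // wz].
- by insf.
- exact: oner_neq0.
- exact: (val_1 SM W).
case; have [Mx _] := Ox; have Mxz : M (x * z) by insf.
have -> : 1 * x + \sum_(t <- rem th O) nu t z / z * nu t x = (\sum_(t <- O) nu t (x * z)) / z.
  rewrite (big_rem th Oth) /= nu1 // mulrDl mulfK // mul1r; congr (_ + _).
  by rewrite mulr_suml; apply: eq_bigr => t _; rewrite (rmorphM (nu t) x) /= mulrAC [_ * nu t x]mulrC.
have KS := trK _ Mxz; change (vge w (2 - 1) ((\sum_(t <- O) nu t (x * z)) / z)).
apply: (vgeM W); [exact: sKM | by insf | | by right; rewrite (val_V SM W) // wz].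
apply: up => //; apply: (vge_sum_seq SM W) => t Ot; first exact: nuM.
have Mnx := nuM _ _ Ot Mx; have Mnz := nuM _ _ Ot Mz.
rewrite (rmorphM (nu t) x); apply: (vgeMl W) => //; last exact: wnuz.
exact: (vge_ri SM W (riA _ _ Ot Ox)).
Qed.

(** * The Hilbert class field *)

Section Hilbert.
Variable (K : set algC).
Hypothesis NK : numfield K.
Local Notation H := (hilbert_class_field K).
Let SK : subfield K := NK.1.
Let SH : subfield H := subfield_adjoin _ _.

Lemma unr_normal_of_unramified L : unramified_abelian_extension K L -> unr_normal K L.
Proof.
move=> [ab unf _]; have [fin _ _] := ab; have [_ SL sKL _] := fin.
have NL := finite_extension_numfield NK fin.
split=> //; last exact: unr_of_unramified.
by move=> nu fnu x Lx; exact: abelian_stable NK ab fnu Lx.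
Qed.

Lemma unr_normal_self : unr_normal K K.
Proof.
split=> // [nu fnu x Kx|w W]; first by rewrite fnu.
by have [x [Kx x0 wx]] := val1 W; exists x.
Qed.

(** [unr_normal] retains just those properties of unramified abelian extensions that pass to
    composita, so the union of such fields is a field containing all the generators. *)
Lemma hilbert_unr_normal x : H x -> exists2 L, unr_normal K L & L x.
Proof.
suff : H `<=` [set x | exists2 L, unr_normal K L & L x] by apply.
apply: adjoin_min; last 2 first.
- by move=> y Ky; exists K => //; exact: unr_normal_self.
- by move=> y [L unL Ly]; exists L => //; exact: unr_normal_of_unramified.
have join y z : (exists2 L, unr_normal K L & L y) -> (exists2 L, unr_normal K L & L z) ->
    exists2 L, unr_normal K L & L y /\ L z.
  move=> [L1 u1 L1y] [L2 u2 L2z]; exists (adjoin L1 L2); first exact: compositum_unr.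
  by split; [exact: adjoin_subl | exact: adjoin_subr].
split=> [|y z /join H1 /H1[L uL [Ly Lz]]|y z /join H1 /H1[L uL [Ly Lz]]].
- by exists K; [exact: unr_normal_self | insf].
- by have [[SL _] _ _ _] := uL; exists L => //; insf.
- by have [[SL _] _ _ _] := uL; exists L => //; insf.
Qed.

Lemma hilbert_stable : stable K H.
Proof.
move=> nu fnu x Hx; have : H `<=` [set x | H (nu x)]; last by apply.
apply: adjoin_min => [|y Ky|y [L unL Ly]].
- split=> [|y z /= ey ez|y z /= ey ez].
  + by rewrite /= rmorph1; insf.
  + by rewrite rmorphB; insf.
  + by rewrite fmorph_div; insf.
- by rewrite /= fnu //; exact: adjoin_subl.
- apply: adjoin_subr; exists L => //.
  by have [_ _ stL _] := unr_normal_of_unramified unL; exact: stL.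
Qed.

Lemma aut_galois L (nu : aut) : fixes K nu -> stable K L -> galois_group K L nu.
Proof.
move=> fnu stL; split=> //.
  by split=> [|x y _ _|x y _ _]; rewrite ?rmorph1 ?rmorphD ?rmorphM.
apply/seteqP; split=> [_ [x Lx <-]|x Lx]; first exact: stL.
exists (algC_invaut nu x); last by rewrite algC_invautK.
by apply: stL => //; exact: fixesV.
Qed.

Lemma hilbert_commute x (nu mu : aut) : H x -> fixes K nu -> fixes K mu -> nu (mu x) = mu (nu x).
Proof.
move=> Hx fnu fmu; have : H `<=` [set x | nu (mu x) = mu (nu x)]; last by apply.
apply: adjoin_min => [|y Ky|y [L unL Ly]].
- split=> [|y z /= ey ez|y z /= ey ez].
  + by rewrite /= !rmorph1.
  + by rewrite !rmorphB ey ez.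
  + by rewrite !fmorph_div ey ez.
- by rewrite /= !(fnu y Ky, fmu y Ky).
- have [_ _ stL _] := unr_normal_of_unramified unL; have [[_ _ com] _ _] := unL.
  by apply: com => //; exact: aut_galois.
Qed.

(* An element fixed by the squares is a sum of simultaneous eigenvectors of
   the automorphisms, with eigenvalues 1 and -1. *)
Lemma genus_eigen (E : set algC) x : subfield E -> hilbert_genus_field K x ->
  (forall y, H y -> (forall nu : aut, fixes K nu -> nu y = y \/ nu y = - y) -> E y) ->
  E x.
Proof.
move=> SE [Hx fixx] HE.
have sqx (nu : aut) : fixes K nu -> nu (nu x) = x.
  by move=> fnu; apply: (fixx (nu \o nu)); exists nu => //; apply: aut_galois => //; exact: hilbert_stable.
(* By the last condition the automorphisms act on [z] through the finitely many conjugates of [x],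
   so it is enough to split along one automorphism per conjugate. *)
pose Z : set algC := [set z | [/\ H z, forall nu : aut, fixes K nu -> nu (nu z) = z &
  forall nu mu : aut, fixes K nu -> fixes K mu -> nu x = mu x -> nu z = mu z]].
pose T (gs : seq aut) z := Z z /\ forall i, (i < size gs)%N ->
  let g := nth [the aut of idfun] gs i in g z = z \/ g z = - z.
have main gs : (forall i, (i < size gs)%N -> fixes K (nth [the aut of idfun] gs i)) ->
  (forall z, T gs z -> E z) -> forall z, Z z -> E z.
  elim: gs => [|g gs IH] fgs HT z Zz; first by apply: HT; split.
  have fg : fixes K g := fgs 0%N isT.
  apply: IH Zz => [i lti|]; first exact: (fgs i.+1).
  move=> {}z [Zz Hz]; have [Hz' sqz cz] := Zz.
  have Hg := hilbert_stable fg Hz'.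
  have comm (nu : aut) : fixes K nu -> nu (g z) = g (nu z).
    by move=> fn; exact: hilbert_commute.
  have H2 : H 2%:R by insf.
  have sqg (nu : aut) : fixes K nu -> nu (nu (g z)) = g z.
    by move=> fn; rewrite comm // hilbert_commute ?sqz //; exact: hilbert_stable.
  have cg (nu mu : aut) : fixes K nu -> fixes K mu -> nu x = mu x -> nu (g z) = mu (g z).
    by move=> fn fm e; rewrite !comm // (cz nu mu).
  have Zp : Z ((z + g z) / 2%:R).
    split=> [|nu fn|nu mu fn fm e].
    - by insf.
    - by rewrite !fmorph_div !rmorph_nat !rmorphD sqg // sqz //.
    - by rewrite !fmorph_div !rmorph_nat !rmorphD (cg nu mu) // (cz nu mu) //.
  have Zm : Z ((z - g z) / 2%:R).
    split=> [|nu fn|nu mu fn fm e].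
    - by insf.
    - by rewrite !fmorph_div !rmorph_nat !rmorphB sqg // sqz //.
    - by rewrite !fmorph_div !rmorph_nat !rmorphB (cg nu mu) // (cz nu mu) //.
  have -> : z = (z + g z) / 2%:R + (z - g z) / 2%:R by field.
  apply: (sfD SE); apply: HT; split=> // -[|i] lti /=.
  - by left; rewrite fmorph_div rmorph_nat rmorphD sqz // addrC.
  - have fi := fgs i.+1 lti; rewrite fmorph_div rmorph_nat rmorphD comm //.
    by case: (Hz i lti) => /= ->; [left | right]; rewrite ?rmorphN //; field.
  - by right; rewrite fmorph_div rmorph_nat rmorphB sqz // -opprB mulNr.
  - have fi := fgs i.+1 lti; rewrite fmorph_div rmorph_nat rmorphB comm //.
    by case: (Hz i lti) => /= ->; [left | right]; rewrite ?rmorphN //; field.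
have [O uO OP] := orbit_exists K x.
have ex_nu t : exists nu : aut, fixes K nu /\ (t \in O -> nu x = t).
  case: (boolP (t \in O)) => [/OP[nu fn nt]|_]; first by exists nu.
  by exists [the aut of idfun].
have [nu Hnu] := choice ex_nu.
apply: (main (map nu O)) => [i|z [[Hz sqz cz] ez]|].
- by rewrite size_map => lti; rewrite (nth_map 0) //; have [] := Hnu (nth 0 O i).
- apply: HE => // mu fmu; have Omu : mu x \in O by apply/OP; exists mu.
  have := ez (index (mu x) O); rewrite size_map index_mem => /(_ Omu) /=.
  rewrite (nth_map 0) ?index_mem // nth_index //.
  have [fn e] := Hnu (mu x).
  by rewrite (cz mu (nu (mu x))) // e.
- by split=> // a b fa fb.
Qed.

End Hilbert.

(** * Parity, squarefree parts and elementary congruences *)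

Definition evz (k : int) := exists j : int, k = j + j.

Lemma evz_or k : evz k \/ evz (k + 1).
Proof.
have [e|e] : (k %% 2 = 0)%Z \/ (k %% 2 = 1)%Z by lia.
  by left; exists (k %/ 2)%Z; lia.
by right; exists ((k %/ 2)%Z + 1); lia.
Qed.

Lemma evzD j k : evz j -> evz k -> evz (j + k).
Proof. by move=> [a ->] [b ->]; exists (a + b); ring. Qed.
Lemma evz2 k : evz (2%:Z * k). Proof. by exists k; ring. Qed.
Lemma evz_not k : evz k -> evz (k + 1) -> False.
Proof. by move=> [a ->] [b]; lia. Qed.
Lemma evz_addr j k : evz k -> evz (j + k) -> evz j.
Proof. by move=> [a ->] [b e]; exists (b - a); lia. Qed.

Section ValQ.
Variables (F : set algC) (v : algC -> int) (l : nat).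
Hypotheses (SF : subfield F) (V : val F v) (pr_l : prime l) (vl : 0 < v l%:R).

Lemma val_natE n : (0 < n)%N -> v n%:R = (logn l n)%:Z * v l%:R.
Proof.
move=> n0; have Dn := pfactor_coprime pr_l n0; case: Dn => m co Dm.
have m0 : (0 < m)%N by rewrite lt0n; apply: contraTneq n0 => m0; rewrite Dm m0.
have l0 : l%:R != 0 :> algC by rewrite pnatr_eq0 -lt0n prime_gt0.
have Fm : F m%:R by insf. have Fl : F l%:R by insf. have Flk : F (l%:R ^+ logn l n) by insf.
have mC : m%:R != 0 :> algC by rewrite pnatr_eq0 -lt0n.
rewrite {1}Dm natrM natrX (valM V) ?expf_neq0 // (val_X SF V) //.
by rewrite (val_nat0 SF V pr_l vl) ?add0r // -prime_coprime.
Qed.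

Lemma val_intE (n : int) : n != 0 -> exists k : int, v n%:~R = k * v l%:R.
Proof.
move=> n0; exists (logn l `|n|%N)%:Z; rewrite -val_natE ?absz_gt0 //.
case: n n0 => n n0 //; rewrite NegzE mulrNz (val_N SF V) ?pnatr_eq0 //; by insf.
Qed.

Lemma val_ratE x : QQ x -> x != 0 -> exists k : int, v x = k * v l%:R.
Proof.
move=> [q _ <-]; rewrite fmorph_eq0 => q0.
have nz : (numq q)%:~R != 0 :> algC by rewrite intr_eq0 numq_eq0.
have dz : (denq q)%:~R != 0 :> algC by rewrite intr_eq0 denq_neq0.
rewrite /ratr (val_div SF V) //; try (by insf).
have [|a ->] := val_intE (n := numq q); first by rewrite numq_eq0.
have [|b ->] := val_intE (n := denq q); first by rewrite denq_neq0.
by exists (a - b); rewrite mulrBl.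
Qed.
End ValQ.

Lemma quad_Aint (b c x : algC) : b \in Aint -> c \in Aint -> x ^+ 2 - b * x + c = 0 -> x \in Aint.
Proof.
move=> Ab Ac e; rewrite -[x]mul1r.
pose co i := nth 0 [:: c; - b; 1] i.
apply: (@Aint_lead 2 co).
  by case=> [|[|[|]]] //= _; rewrite ?rpredN.
by rewrite !big_ord_recl big_ord0 /bump /co /= -[RHS]e; ring.
Qed.

Lemma sqrt_Aint x : x ^+ 2 \in Aint -> x \in Aint.
Proof.
move=> Ax; apply: (@quad_Aint 0 (- x ^+ 2)) => //; first by rewrite rpredN.
by ring.
Qed.

Lemma nat_squarefree n : (0 < n)%N -> exists s c : nat,
  [/\ (0 < s)%N, n = (c * s ^ 2)%N & forall l, prime l -> ~~ (l ^ 2 %| c)%N].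
Proof.
elim: n {-2}n (leqnn n) => [[]//|N IHN] n le_n n0.
case: (pselect (exists2 l, prime l & (l ^ 2 %| n)%N)) => [[l pr /dvdnP[m Dm]]|nex].
  have l1 := prime_gt1 pr.
  have [||s [c [s0 Dc sf]]] := IHN m.
  - by rewrite Dm in le_n n0; move: le_n n0 l1; clear; nia.
  - by rewrite Dm in n0; move: n0; clear; nia.
  exists (s * l)%N, c; split => //; first by rewrite muln_gt0 s0 prime_gt0.
  by rewrite Dm Dc; ring.
exists 1%N, n; split=> //; first by rewrite muln1.
by move=> l pr; apply/negP => dv; apply: nex; exists l.
Qed.

Lemma rat_squarefree g : QQ g -> g != 0 -> exists s (c : nat),
  [/\ QQ s, s != 0, g = c%:R * s ^+ 2 \/ g = - (c%:R * s ^+ 2), (0 < c)%N &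
   forall l, prime l -> ~~ (l ^ 2 %| c)%N].
Proof.
move=> [q _ <-]; rewrite fmorph_eq0 => q0.
pose n := (`|numq q| * `|denq q|)%N.
have n0 : (0 < n)%N by rewrite muln_gt0 !absz_gt0 numq_eq0 q0 denq_neq0.
have [s [c [s0 Dn sf]]] := nat_squarefree n0.
have d0 : (denq q)%:~R != 0 :> algC by rewrite intr_eq0 denq_neq0.
exists (s%:R / (denq q)%:~R), c; split => //.
- have SQ := subfield_rat; by insf.
- by rewrite mulf_neq0 ?invr_eq0 // pnatr_eq0 -lt0n.
- have Dn' : (numq q)%:~R * (denq q)%:~R = c%:R * s%:R ^+ 2 :> algC \/
     (numq q)%:~R * (denq q)%:~R = - (c%:R * s%:R ^+ 2) :> algC.
    rewrite -natrX -natrM -Dn /n -intrM.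
    rewrite -abszM.
    by case: (numq q * denq q) => k; [left | right; rewrite NegzE mulrNz].
  have -> : ratr q = (numq q)%:~R * (denq q)%:~R / (denq q)%:~R ^+ 2 :> algC.
    by rewrite /ratr; field.
  by case: Dn' => ->; [left | right]; field.
- by rewrite lt0n; apply: contraTneq n0 => c0; rewrite Dn c0.
Qed.

Lemma Creal_rat x : QQ x -> x \is Num.real.
Proof. by move=> [q _ <-]; apply: Creal_Crat; apply/CratP; exists q. Qed.

Lemma exprz_eq1_gt1 (e : algC) (n : int) : 1 < e -> e ^ n = 1 -> n = 0.
Proof.
move=> e1; have key m : e ^+ m.+1 != 1 by rewrite gt_eqF // exprn_egt1.
case: n => [[//|n]|n] /eqP; first by rewrite (negPf (key n)).
by rewrite NegzE -exprnN invr_eq1 (negPf (key n)).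
Qed.

(** For [q] congruent to 3 modulo 4, Fermat's theorem would give [t = t ^ q = - t] modulo [q], since
    (q - 1)/2 is odd. *)
Lemma prime_dvd_sqr_add1 (q t : nat) : prime q -> odd q -> (q %| t ^ 2 + 1)%N -> (q %% 4 = 1)%N.
Proof.
move=> pr oq dv; apply/eqP; apply: contraT => n1; exfalso.
have q3 : (q %% 4 = 3)%N by move: oq n1; clear; lia.
pose k := (q %/ 4)%N; have Dq : q = (2 * (2 * k + 1) + 1)%N by rewrite /k; move: q3; clear; lia.
have e1 : (t ^ q = t %[mod q])%N := fermat_little t pr.
have q0 := pchar_Fp pr; have qR n : (n%:R == 0 :> 'F_q) = (q %| n)%N by rewrite (dvdn_pcharf q0).
have qq : q%:R = 0 :> 'F_q by apply/eqP; rewrite qR.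
have md n : n%:R = (n %% q)%:R :> 'F_q.
  by rewrite {1}(divn_eq n q) natrD natrM qq mulr0 add0r.
have t2 : t%:R ^+ 2 = -1 :> 'F_q.
  by apply/eqP; rewrite -addr_eq0 -natrX natr1 qR -addn1.
have tq : t%:R ^+ q = t%:R :> 'F_q by rewrite -natrX md e1 -md.
have tn : t%:R = - t%:R :> 'F_q.
  have E n : n = (2 * (2 * k + 1) + 1)%N -> t%:R ^+ n = - t%:R :> 'F_q.
    by move=> ->; rewrite exprD exprM t2 expr1 -signr_odd oddD oddM /= expr1 mulN1r.
  by rewrite -{1}tq; apply: E.
have : (2 * t)%:R == 0 :> 'F_q by rewrite natrM mulr_natl mulr2n {1}tn addNr.
rewrite qR Euclid_dvdM // => /orP[/dvdn_leq|].
  by move=> /(_ isT); move: q3; clear; lia.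
rewrite -qR => /eqP t0; move: t2; rewrite t0 expr0n /= => /eqP.
by rewrite eq_sym oppr_eq0 oner_eq0.
Qed.

Lemma dvd_sqr_add1 (n t : nat) : odd n -> (n %| t ^ 2 + 1)%N -> (n %% 4 = 1)%N.
Proof.
elim: n {-2}n (leqnn n) => [[]//|N IHN] n le_n on dv.
have [n1|n1] := eqVneq n 1%N; first by rewrite n1.
have gt1 : (1 < n)%N by case: n n1 on {le_n dv} => [|[]].
have pr := pdiv_prime gt1; have := divnK (pdiv_dvd n); set q := pdiv n in pr *; set m := (n %/ q)%N => Dn.
have [om oq] : odd m /\ odd q by move: on; rewrite -Dn oddM => /andP.
have q1 : (q %% 4 = 1)%N.
  by apply: (prime_dvd_sqr_add1 (t := t)) => //; apply: dvdn_trans dv; rewrite -Dn dvdn_mull.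
have m1 : (m %% 4 = 1)%N.
  apply: IHN => //; last by apply: dvdn_trans dv; rewrite -Dn dvdn_mulr.
  by move: (prime_gt1 pr) Dn le_n gt1; clear; nia.
by rewrite -Dn -modnMm m1 q1.
Qed.

(** The points other than [c] fall into pairs, and the condition [x < s x] selects one point of
    each. *)
Lemma odd_card_involution (n : nat) (s : 'I_n -> 'I_n) c : involutive s ->
  (forall x, s x = x <-> x = c) -> odd n.
Proof.
move=> sK fixs; pose A := finset [pred x : 'I_n | (x < s x)%N]; pose B := finset [pred x : 'I_n | (s x < x)%N].
have DB : B = [set s x | x in A]%SET.
  apply/setP => x; rewrite inE /=; apply/idP/imsetP => [lt|[y]].
    by exists (s x); rewrite ?sK // inE /= sK.
  by rewrite inE /= => lt ->; rewrite sK.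
have cB : #|B| = #|A| by rewrite DB card_imset //; exact: inv_inj.
have dAB : #|(A :|: B)%SET| = (#|A| + #|B|)%N.
  rewrite cardsU; suff -> : (A :&: B)%SET = finset.set0 by rewrite cards0 subn0.
  by apply/setP => x; rewrite !inE /=; lia.
have : #|[set: 'I_n]%SET| = (#|(A :|: B)%SET|).+1.
  have -> : [set: 'I_n]%SET = (c |: (A :|: B))%SET.
    apply/setP => x; rewrite !inE; have [e|ne] := eqVneq x c => //=.
    have : s x != x by apply: contraNneq ne => /fixs ->.
    by rewrite -val_eqE /=; lia.
  rewrite cardsU1 !inE /=; have : s c = c by apply/fixs.
  by move=> ->; rewrite ltnn.
rewrite cardsT card_ord dAB cB => ->; lia.
Qed.

(** * Equivalence of ideals *)

Local Notation scale a I := [set a * x | x in I].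

Lemma scaleM (a b : algC) (I : set algC) : scale (a * b) I = scale a (scale b I).
Proof.
apply/seteqP; split=> [_ [x Ix <-]|_ [_ [x Ix <-] <-]].
  by exists (b * x); [exists x | rewrite mulrA].
by exists x => //; rewrite mulrA.
Qed.

Section Equiv.
Variables (F : set algC) (SF : subfield F).
Local Notation O := (ring_of_integers F).

Lemma equiv_refl I : ideal_equiv O I I.
Proof. by exists 1, 1; split; rewrite ?oner_neq0 //; inri. Qed.

Lemma equiv_sym I J : ideal_equiv O I J -> ideal_equiv O J I.
Proof. by move=> [a [b [Oa Ob a0 b0 e]]]; exists b, a. Qed.

Lemma equiv_trans I J H : ideal_equiv O I J -> ideal_equiv O J H -> ideal_equiv O I H.
Proof.
move=> [a [b [Oa Ob a0 b0 e]]] [c [d [Oc Od c0 d0 e']]].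
exists (c * a), (b * d); split; try (by inri); rewrite ?mulf_neq0 //.
by rewrite (scaleM c a) e -(scaleM c b) [c * b]mulrC (scaleM b c) e' -(scaleM b d).
Qed.

Lemma ideal_class_eq I J : nonzero_ideal O I -> nonzero_ideal O J ->
  ideal_class O I = ideal_class O J <-> ideal_equiv O I J.
Proof.
move=> NI NJ; split=> [e|eIJ].
  have : ideal_class O J I by rewrite -e; split => //; exact: equiv_refl.
  by case=> _; apply: equiv_sym.
apply/seteqP; split=> H [NH eH]; split=> //.
  by apply: equiv_trans (equiv_sym eIJ) eH.
exact: equiv_trans eIJ eH.
Qed.

End Equiv.

(** * Quadratic extensions and local criteria *)

Section QuadraticExtension.
Variables (K : set algC) (s : algC).
Hypotheses (NK : numfield K) (Ks2 : K (s ^+ 2)).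
Let SK := NK.1.
Local Notation L := (adjoin K [set s]).
Let SL : subfield L := subfield_adjoin _ _.
Let sKL : K `<=` L := @adjoin_subl K [set s].
Let Ls : L s. Proof. exact: adjoin_subr. Qed.

Lemma quad_numfield : numfield L.
Proof.
have -> : L = adjoin K [set` [:: s]]; last exact: numfield_adjoin_seq.
by congr adjoin; apply/seteqP; split=> x /=; rewrite inE => /eqP.
Qed.

Lemma quad_span x : L x -> exists u t, [/\ K u, K t & x = u + t * s].
Proof.
suff : L `<=` [set x | exists u t, [/\ K u, K t & x = u + t * s]] by apply.
have K1 : K 1 by insf. have K0 : K 0 by insf.
case: (pselect (K s)) => [Ks|nKs].
  apply: adjoin_min => [|z Kz|_ /= ->].
  - split=> [|x1 x2 [u [t [Ku Kt ->]]] [u' [t' [Ku' Kt' ->]]]|x1 x2 [u [t [Ku Kt ->]]] [u' [t' [Ku' Kt' ->]]]].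
    + by exists 1, 0; split=> //; rewrite mul0r addr0.
    + by exists (u + t * s - (u' + t' * s)), 0; split; rewrite ?mul0r ?addr0 //; insf.
    + by exists ((u + t * s) / (u' + t' * s)), 0; split; rewrite ?mul0r ?addr0 //; insf.
  - by exists z, 0; split; rewrite ?mul0r ?addr0.
  - by exists s, 0; split; rewrite ?mul0r ?addr0.
have [nu fnu nus] := conj_sqrt NK Ks2 nKs.
apply: adjoin_min => [|z Kz|_ /= ->].
- split=> [|x1 x2 [u [t [Ku Kt ->]]] [u' [t' [Ku' Kt' ->]]]|x1 x2 [u [t [Ku Kt ->]]] [u' [t' [Ku' Kt' ->]]]].
  + by exists 1, 0; split=> //; rewrite mul0r addr0.
  + by exists (u - u'), (t - t'); split; [insf | insf | ring].
  have [e|nz] := eqVneq (u' + t' * s) 0.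
    by exists 0, 0; split => //; rewrite e invr0; ring.
  have nz' : u' - t' * s != 0.
    have -> : u' - t' * s = nu (u' + t' * s).
      by rewrite rmorphD rmorphM /= (fnu _ Ku') (fnu _ Kt') nus mulrN.
    by rewrite fmorph_eq0.
  pose N := u' ^+ 2 - s ^+ 2 * t' ^+ 2.
  have DN : N = (u' + t' * s) * (u' - t' * s) by rewrite /N; ring.
  have KN : K N by rewrite /N; insf.
  exists ((u * u' - s ^+ 2 * t * t') / N), ((t * u' - u * t') / N); split; try (by insf).
  by rewrite DN; field; rewrite nz nz'.
- by exists z, 0; split; rewrite ?mul0r ?addr0.
- by exists 0, 1; split; rewrite ?mul1r ?add0r.
Qed.

Lemma quad_stable : stable K L.
Proof.
move=> nu fnu x /quad_span[u [t [Ku Kt ->]]].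
have Ku' := sKL Ku; have Kt' := sKL Kt.
have /eqP := fnu _ Ks2; rewrite rmorphXn /= eqf_sqr rmorphD rmorphM /= (fnu _ Ku) (fnu _ Kt).
by case/orP => /eqP ->; insf.
Qed.

Lemma quad_abelian : abelian_extension K L.
Proof.
split.
- split=> //.
  exists 2%N, (fun i : 'I_2 => if i == ord0 then 1 else s) => x /quad_span[u [t [Ku Kt ->]]].
  exists (fun i : 'I_2 => if i == ord0 then u else t); first by move=> i; case: ifP.
  by rewrite big_ord_recl big_ord1 /= mulr1.
- apply/seteqP; split=> [x [Lx fx]|x Kx]; last by split; [exact: sKL | move=> g [_ _]; exact].
  apply: galois_fixed => // nu fnu; apply: fx.
  by apply: aut_galois => //; exact: quad_stable.
move=> g g' [Eg _ fg] [Eg' _ fg'] x /quad_span[u [t [Ku Kt ->]]].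
have Lu := sKL Ku; have Lt := sKL Kt.
have sgn f : embedding L f -> (forall x, K x -> f x = x) -> f s = s \/ f s = - s.
  move=> Ef ff; have /eqP := ff _ Ks2; rewrite (embX SL Ef) // eqf_sqr.
  by case/orP => /eqP ?; [left | right].
have form f e : embedding L f -> (forall x, K x -> f x = x) -> L e -> f (u + t * e) = u + t * f e.
  move=> Ef ff Le; have Lte : L (t * e) by insf.
  by rewrite (embD Ef) // (embM Ef) // (ff _ Ku) (ff _ Kt).
have Lns : L (- s) by insf.
rewrite (form g' s) // (form g s) //.
have ns h : embedding L h -> h (- s) = - h s by move=> Eh; rewrite (embN SL Eh).
by have [es|es] := sgn g Eg fg; have [es'|es'] := sgn g' Eg' fg'; rewrite es es';
  rewrite ?(form g) ?(form g') ?ns // ?es ?es' ?opprK.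
Qed.

End QuadraticExtension.

(* Sufficient conditions for K(sqrt d)/K to be unramified at w, above 2 and
   away from 2 respectively. *)
Definition sq4 (K : set algC) (w : algC -> int) (d : algC) :=
  exists z, [/\ K z, z != 0 & vge w (2%:Z * w 2%:R) (d * z ^+ 2 - 1)].

Definition sq_unit (K : set algC) (w : algC -> int) (d : algC) :=
  exists z, [/\ K z, z != 0 & w (d * z ^+ 2) = 0].

(** The sign (-1)^((n - 1)/2) makes an odd number [n] congruent to 1 modulo 4; this is the sign in
    [q_star] and [alpha_star]. *)
Lemma sign_mod4 (s : nat) : exists k : int, (-1) ^+ s * (2 * s + 1)%:Z = 4 * k + 1.
Proof.
have [e|e] : (exists t, s = (2 * t)%N) \/ (exists t, s = (2 * t + 1)%N).
- have [e|e] : odd s \/ ~~ odd s by case: (odd s); [left | right].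
    by right; exists s./2; lia.
  by left; exists s./2; lia.
- have [t ->] := e; exists t%:Z; rewrite -signr_odd oddM /= expr0 mul1r; lia.
- have [t ->] := e; exists (- t%:Z - 1); rewrite -signr_odd oddD oddM /= expr1; lia.
Qed.

Lemma unr_val_sqr_even K M v y : numfield K -> numfield M -> K `<=` M -> unr K M ->
  val K v -> M y -> y != 0 -> K (y ^+ 2) -> evz (v (y ^+ 2)).
Proof.
move=> NK NM sKM unrM V My y0 Ky2.
have [w [e [W e_gt0 He]]] := lying_over NK NM sKM V.
have [x [Kx x0 wx]] := unrM w W.
have e1 : e = 1 by apply: (@int_mul_eq1 e (v x)) => //; rewrite -He.
have := He _ Ky2 (expf_neq0 2 y0); rewrite e1 mul1r (val_X NM.1 W) // => <-.
by exists (w y); move: (w y) => c; clear; lia.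
Qed.

(** Arithmetic for [val_norm_even] when [w] is invariant under conjugation: there [e] divides 2, and
    four times [j] is [e] times the value [c] of the norm. *)
Lemma two_div (e k j c : int) : 0 < e -> 1 + 1 = e * k -> j + j + (j + j) = e * c -> evz c.
Proof.
move=> e_gt0 e2 ec; have k_gt0 : 0 < k by rewrite -(pmulr_rgt0 _ e_gt0) -e2.
have le_e2 : e <= 1 + 1 by rewrite e2 ler_peMr -?gtz0_ge1 // ltW.
have [e1|e1] : e = 1 \/ e = 2 by clear -e_gt0 le_e2; lia.
  by exists (j + j); rewrite ec e1 mul1r.
by exists j; rewrite e1 in ec; clear -ec; lia.
Qed.

(** * The quadratic field and the cyclic quartic field *)

Section QuadraticField.
Variable p : nat.
Hypotheses (pr_p : prime p) (p8 : (p %% 8 = 5)%N).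
Local Notation sp := (sqrtC (p%:R : algC)).
Definition quad_field : set algC := Qadjoin [set sqrtC (p%:R : algC)].
Local Notation k0 := quad_field.
Local Notation O := (ring_of_integers k0).
Let SQ := subfield_rat.

Lemma sp2 : sp ^+ 2 = p%:R. Proof. exact: sqrtCK. Qed.
Lemma sp_gt0 : 0 < sp. Proof. by rewrite sqrtC_gt0 ltr0n prime_gt0. Qed.
Lemma sp_neq0 : sp != 0. Proof. exact: lt0r_neq0 sp_gt0. Qed.
Lemma p_neq0 : p%:R != 0 :> algC. Proof. by rewrite pnatr_eq0 -lt0n prime_gt0. Qed.
Lemma sp_Aint : sp \in Aint.
Proof. by apply: sqrt_Aint; rewrite sp2 Aint_Cnat // rpred_nat. Qed.

Lemma sp_irrat : ~ QQ sp.
Proof.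
move=> Qsp; have /intrP[n Dn] : sp \in Num.int.
  apply: Cint_rat_Aint sp_Aint; case: Qsp => q _ <-; by apply/CratP; exists q.
have e : n ^+ 2 = p%:Z by apply: (@intr_inj algC); rewrite rmorphXn /= -Dn sp2.
have /(congr1 (logn p)) : p = (`|n| ^ 2)%N by rewrite -abszX e.
by rewrite lognX logn_prime // eqxx; move: (logn _ _) => k; clear; lia.
Qed.

Lemma rat_k0 x : QQ x -> k0 x.
Proof. by move=> [q _ <-]; apply: (sf_rat (subfield_adjoin _ _)). Qed.

Lemma sf_k0 : subfield k0. Proof. exact: subfield_adjoin. Qed.
Lemma k0_sp : k0 sp. Proof. exact: adjoin_subr. Qed.

Lemma nf_k0 : numfield k0.
Proof.
have -> : k0 = Qadjoin [set` [:: sp]]; last exact: numfield_Qadjoin_seq.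
by rewrite /quad_field; congr Qadjoin; apply/seteqP; split=> x /=; rewrite inE => /eqP.
Qed.

Lemma rat_indep u t : QQ u -> QQ t -> u + t * sp = 0 -> u = 0 /\ t = 0.
Proof.
move=> Qu Qt e; have [t0|t0] := eqVneq t 0.
  by move: e; rewrite t0 mul0r addr0.
case: sp_irrat; have -> : sp = - u / t.
  apply: (mulIf t0); rewrite divfK // mulrC; apply/eqP.
  by rewrite -subr_eq0 opprK addrC e.
by insf.
Qed.

Lemma k0P x : k0 x <-> exists u t, [/\ QQ u, QQ t & x = u + t * sp].
Proof.
split; last first.
  move=> [u [t [/rat_k0 ku /rat_k0 kt ->]]]; have := sf_k0; have := k0_sp; move=> ? ?; insf.
suff : k0 `<=` [set x | exists u t, [/\ QQ u, QQ t & x = u + t * sp]] by apply.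
have Q1 : QQ 1 := sf1 SQ. have Q0 : QQ 0 := sf0 SQ. have Qp : QQ p%:R by insf.
apply: adjoin_min => [||_ /= ->]; last by exists 0, 1; split => //; ring.
  split=> [|_ _ [u [t [Qu Qt ->]]] [u' [t' [Qu' Qt' ->]]]|_ _ [u [t [Qu Qt ->]]] [u' [t' [Qu' Qt' ->]]]].
  - by exists 1, 0; split => //; ring.
  - by exists (u - u'), (t - t'); split; [insf | insf | ring].
  - have [e0|nz] := eqVneq (u' + t' * sp) 0.
      by exists 0, 0; split => //; rewrite e0 invr0; ring.
    have nz' : u' - t' * sp != 0.
      apply: contraNneq nz => e; have Qmt' : QQ (- t') by insf.
      have e2 : u' + - t' * sp = 0 by rewrite mulNr.
      have [-> /eqP] := rat_indep Qu' Qmt' e2.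
      by rewrite oppr_eq0 => /eqP ->; rewrite mul0r addr0.
    pose N := u' ^+ 2 - p%:R * t' ^+ 2.
    have DN : N = (u' + t' * sp) * (u' - t' * sp) by rewrite /N; move: (sp) sp2 => S <-; ring.
    have QN : QQ N by rewrite /N; insf.
    have N0 : N != 0 by rewrite DN mulf_neq0.
    exists ((u * u' - p%:R * t * t') / N), ((t * u' - u * t') / N); split; try (by insf).
    by move: (sp) sp2 nz nz' DN => S <- nz nz' ->; field; rewrite nz nz'.
by move=> y [].
Qed.

Lemma tau_exists : exists tau : aut, tau sp = - sp.
Proof.
have [|tau _ e] := conj_sqrt (s := sp) numfield_rat _ sp_irrat; last by exists tau.
by rewrite sp2; insf.
Qed.

Variable tau : aut.
Hypothesis tau_sp : tau sp = - sp.
Let SK0 := sf_k0.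
Let NK0 := nf_k0.
Let Ksp := k0_sp.
Let sp0 := sp_neq0.

Lemma tauQ x : QQ x -> tau x = x.
Proof. by move=> [q _ <-]; rewrite fmorph_rat. Qed.

Lemma tau_form u t : QQ u -> QQ t -> tau (u + t * sp) = u - t * sp.
Proof. by move=> Qu Qt; rewrite rmorphD rmorphM /= (tauQ Qu) (tauQ Qt) tau_sp mulrN. Qed.

Lemma tau_k0 x : k0 x -> k0 (tau x).
Proof.
move=> /k0P[u [t [Qu Qt ->]]]; rewrite tau_form //.
by have ku := rat_k0 Qu; have kt := rat_k0 Qt; insf.
Qed.

Lemma tauK x : k0 x -> tau (tau x) = x.
Proof.
move=> /k0P[u [t [Qu Qt ->]]]; rewrite tau_form // -mulNr tau_form //; last by insf.
by rewrite mulNr opprK.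
Qed.

Lemma tau_invaut x : k0 x -> algC_invaut tau x = tau x.
Proof. by move=> kx; apply: (fmorph_inj tau); rewrite algC_invautK tauK. Qed.

Lemma tau_ri x : O x -> O (tau x).
Proof. by move=> [kx Ax]; split; [exact: tau_k0 | rewrite /= Aint_aut]. Qed.

Lemma trace_Q x : k0 x -> QQ (x + tau x).
Proof.
move=> /k0P[u [t [Qu Qt ->]]]; rewrite tau_form //.
have -> : u + t * sp + (u - t * sp) = u + u by ring.
by insf.
Qed.

Lemma norm_Q x : k0 x -> QQ (x * tau x).
Proof.
move=> /k0P[u [t [Qu Qt ->]]]; rewrite tau_form //.
have -> : (u + t * sp) * (u - t * sp) = u ^+ 2 - p%:R * t ^+ 2.
  by move: (sp) sp2 => S <-; ring.
by insf.
Qed.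

Lemma QAint x : QQ x -> x \in Aint -> exists n : int, x = n%:~R.
Proof.
move=> [q _ <-] Ax; apply/intrP; apply: Cint_rat_Aint Ax; by apply/CratP; exists q.
Qed.

Lemma trace_Z x : O x -> exists n : int, x + tau x = n%:~R.
Proof.
move=> Ox; have [kx _] := Ox; apply: QAint (trace_Q kx) _.
have [_ /= A1] := Ox; have [_ /= A2] := tau_ri Ox; exact: rpredD.
Qed.

Lemma norm_Z x : O x -> exists n : int, x * tau x = n%:~R.
Proof.
move=> Ox; have [kx _] := Ox; apply: QAint (norm_Q kx) _.
have [_ /= A1] := Ox; have [_ /= A2] := tau_ri Ox; exact: rpredM.
Qed.

(* Hilbert's theorem 90, in the form used for norms that are squares. *)
Lemma norm_square c s : k0 c -> QQ s -> s != 0 -> c * tau c = s ^+ 2 ->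
  exists r z, [/\ QQ r, r != 0, k0 z, z != 0 & c = r * z ^+ 2].
Proof.
move=> kc Qs s0 e; have ks := rat_k0 Qs.
have c0 : c != 0.
  by apply: contraTneq s0 => c0; move: e; rewrite c0 mul0r => /esym/eqP; rewrite sqrf_eq0 negbK.
pose w := c / s; have kw : k0 w by rewrite /w; insf.
have tw : w * tau w = 1 by rewrite /w fmorph_div (tauQ Qs) mulf_div -expr2 e divff // sqrf_eq0.
have w0 : w != 0 by rewrite mulf_neq0 ?invr_eq0.
have [e1|nz] := eqVneq (1 + w) 0.
  exists (- s), 1; split; rewrite ?oppr_eq0 ?oner_neq0 //; try (by insf).
  have -> : c = w * s by rewrite /w divfK.
  have -> : w = -1 by apply/eqP; rewrite -addr_eq0 addrC e1.
  by ring.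
pose z := 1 + w; have kz : k0 z by rewrite /z; insf.
have tz : tau z = z / w.
  rewrite rmorphD rmorph1 /z mulrDl divff // mul1r addrC; congr (_ + _).
  by apply: (mulfI w0); rewrite tw divff.
have tz0 : tau z != 0 by rewrite fmorph_eq0.
have QN := norm_Q kz.
exists (s / (z * tau z)), z; split => //.
- by insf.
- by rewrite mulf_neq0 ?invr_eq0 // mulf_neq0.
- by rewrite tz /w; field; rewrite nz s0 c0.
Qed.

Definition omega : algC := (1 + sp) / 2%:R.
(** The constant in [omega ^+ 2 = omega + c4], namely (p - 1)/4; it is odd because [p] is 5 modulo
    8. *)
Definition c4 : nat := (p %/ 4)%N.

Lemma c4E : p = (4 * c4 + 1)%N /\ odd c4.
Proof. rewrite /c4; split; lia. Qed.

Lemma omega2 : omega ^+ 2 = omega + c4%:R.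
Proof.
have e : p%:R = 4%:R * c4%:R + 1 :> algC by rewrite {1}c4E.1 natrD natrM.
rewrite /omega; move: (sp) sp2 => S; rewrite e => e2.
have -> : (c4%:R : algC) = (S ^+ 2 - 1) / 4%:R by rewrite e2; field.
by field.
Qed.

Lemma omega_k0 : k0 omega. Proof. by rewrite /omega; insf. Qed.

Lemma omega_ri : O omega.
Proof.
split; first exact: omega_k0.
apply: (@quad_Aint 1 (- c4%:R)) => //; first by rewrite rpredN Aint_Cnat // rpred_nat.
by rewrite omega2; ring.
Qed.

Lemma tau_omega : tau omega = 1 - omega.
Proof. by rewrite /omega fmorph_div rmorphD rmorph1 rmorph_nat tau_sp; field. Qed.

Lemma sp_omega : sp = 2%:R * omega - 1.
Proof. by rewrite /omega; move: (sp) => S; field. Qed.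

Lemma sp_ri : O sp. Proof. by split=> //; exact: sp_Aint. Qed.

Lemma val_tau v : val k0 v -> val k0 (v \o tau).
Proof.
move=> V; apply: val_aut => // x kx; first exact: tau_k0.
by rewrite tau_invaut //; exact: tau_k0.
Qed.

Lemma k0_span x : k0 x -> exists u t, [/\ QQ u, QQ t & x = u + t * sp].
Proof. by move/k0P. Qed.

(** Primes other than [p] do not ramify in k0: [quad_unr] applies over Q to [sp], whose square [p]
    is 1 modulo 4. *)
Lemma val_l1 v l : val k0 v -> prime l -> l != p -> 0 < v l%:R -> v l%:R = 1.
Proof.
move=> V pr_l lp vl.
have s0 := sp_neq0.
have Q2 : QQ (sp ^+ 2) by rewrite sp2; insf.
have vp : v p%:R = 0.
  by apply: (val_nat0 SK0 V pr_l vl); rewrite dvdn_prime2.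
have vsp : v sp = 0.
  by have := val_X SK0 V 2 Ksp s0; rewrite sp2 vp; lia.
have cond : (v 2%:R = 0 /\ v sp = 0) \/ (0 < v 2%:R /\ vge v (2%:Z * v 2%:R) (sp ^+ 2 - 1)).
  have [l2|l2] := eqVneq l 2%N; last first.
    left; split=> //; apply: (val_nat0 SK0 V pr_l vl).
    by rewrite dvdn_prime2 //.
  right; rewrite sp2; move: vl; rewrite l2 => vl; split=> //.
  have -> : p%:R - 1 = 2%:R ^+ 2 * c4%:R :> algC.
    by rewrite {1}c4E.1 natrD natrM; ring.
  have k2 : k0 (2%:R ^+ 2) by insf. have kc : k0 c4%:R by insf. have kl : k0 2%:R by insf.
  apply: (vgeMr V) => //; last exact: (vge_nat SK0 V).
  by right; rewrite (val_X SK0 V) // pnatr_eq0.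
have [x [Qx x0 vx]] := quad_unr numfield_rat NK0 rat_k0 Ksp Q2 k0_span V s0 cond.
have [k e] := val_ratE SK0 V pr_l vl Qx x0.
by apply: (@int_mul_eq1 _ k vl); rewrite mulrC -e.
Qed.

(** Rational numbers have even multiples of [v sp] as values, so the two terms of [u + t * sp] never
    have the same value and the sign of [t] does not affect the value of the sum. *)
Lemma val_p1 v : val k0 v -> 0 < v p%:R ->
  v sp = 1 /\ forall x, k0 x -> x != 0 -> v (tau x) = v x.
Proof.
move=> V vp; have s0 := sp_neq0; have := val_X SK0 V 2 Ksp s0; rewrite sp2 => vp2.
have vs : 0 < v sp by move: vp; rewrite vp2; lia.
have key u t : QQ u -> QQ t -> u + t * sp != 0 ->
    v (u - t * sp) = v (u + t * sp) /\ exists k, v (u + t * sp) = k * v sp.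
  move=> Qu Qt nz; have ku := rat_k0 Qu; have kt := rat_k0 Qt.
  have [t0|t0] := eqVneq t 0.
    rewrite t0 mul0r addr0 subr0 in nz *; split => //.
    by have [k ->] := val_ratE SK0 V pr_p vp Qu nz; exists (k * 2); rewrite vp2; ring.
  have ts0 : t * sp != 0 by rewrite mulf_neq0.
  have kts : k0 (t * sp) by insf.
  have [j ej] := val_ratE SK0 V pr_p vp Qt t0.
  have et : v (t * sp) = (2 * j + 1) * v sp by rewrite (valM V) // ej vp2; ring.
  have ktsn : k0 (- (t * sp)) by insf.
  have etn : v (- (t * sp)) = (2 * j + 1) * v sp by rewrite (val_N SK0 V).
  have [u0|u0] := eqVneq u 0.
    by rewrite u0 !add0r et etn; split=> //; exists (2 * j + 1).
  have [k ek] := val_ratE SK0 V pr_p vp Qu u0.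
  have eu : v u = (2 * k) * v sp by rewrite ek vp2; ring.
  have [lt|lt|e] := ltgtP (2 * k : int) (2 * j + 1).
  - have ltv : (2 * k) * v sp < (2 * j + 1) * v sp by rewrite ltr_pM2r.
    have [||_ e1] := @val_dom _ _ SK0 V u (t * sp) ((2 * j + 1) * v sp) ku kts u0.
    + by rewrite eu.
    + by right; rewrite et.
    have [||_ e2] := @val_dom _ _ SK0 V u (- (t * sp)) ((2 * j + 1) * v sp) ku ktsn u0.
    + by rewrite eu.
    + by right; rewrite etn.
    by rewrite e1 e2 eu; split => //; exists (2 * k).
  - have ltv : (2 * j + 1) * v sp < (2 * k) * v sp by rewrite ltr_pM2r.
    have nts0 : - (t * sp) != 0 by rewrite oppr_eq0.
    have [||_ e1] := @val_dom _ _ SK0 V (t * sp) u ((2 * k) * v sp) kts ku ts0.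
    + by rewrite et.
    + by right; rewrite eu.
    have [||_ e2] := @val_dom _ _ SK0 V (- (t * sp)) u ((2 * k) * v sp) ktsn ku nts0.
    + by rewrite etn.
    + by right; rewrite eu.
    by rewrite ![u + _]addrC e1 e2 et etn; split => //; exists (2 * j + 1).
  - by exfalso; lia.
split.
  have [x [kx x0 vx]] := val1 V; have [u [t [Qu Qt Dx]]] := k0_span kx.
  have [|_ [k e]] := key u t Qu Qt; first by rewrite -Dx.
  by apply: (@int_mul_eq1 _ k vs); rewrite mulrC -e -Dx.
move=> x kx x0; have [u [t [Qu Qt Dx]]] := k0_span kx.
by rewrite Dx tau_form //; case: (key u t Qu Qt); rewrite -?Dx.
Qed.

Lemma ri_val0 v x : val k0 v -> O x -> ~ vge v 1 x -> x != 0 /\ v x = 0.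
Proof.
move=> V Ox nv; apply: (ri_notin_val NK0 V Ox); by case.
Qed.

(** Primes above [l] are conjugate. Otherwise some integer has positive value at [v2] and is a unit
    at [v1] and its conjugate; its norm is a rational integer that [l] divides according to [v2] and
    does not according to [v1]. *)
Lemma val_k0_eq v1 v2 l : val k0 v1 -> val k0 v2 -> prime l -> 0 < v1 l%:R -> 0 < v2 l%:R ->
  (forall x, k0 x -> x != 0 -> v2 x = v1 x) \/ (forall x, k0 x -> x != 0 -> v2 x = v1 (tau x)).
Proof.
move=> V1 V2 pr_l vl1 vl2; have V1t := val_tau V1.
case: (pselect (forall x, O x -> vge v2 1 x -> vge v1 1 x)) => [H|].
  by left=> x kx x0; rewrite (val_eq NK0 V2 V1 H).
case: (pselect (forall x, O x -> vge v2 1 x -> vge (v1 \o tau) 1 x)) => [H _|].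
  by right=> x kx x0; rewrite -(val_eq NK0 V2 V1t H).
move=> /existsNP[b] /not_implyP[Ob] /not_implyP[v2b nb].
move=> /existsNP[a] /not_implyP[Oa] /not_implyP[v2a na].
exfalso.
have [a0 v1a] := ri_val0 V1 Oa na; have [b0 v1tb] := ri_val0 V1t Ob nb.
have [ka _] := Oa; have [kb _] := Ob.
have [x [Ox v2x v1x v1tx x0]] : exists x, [/\ O x, vge v2 1 x, v1 x = 0, v1 (tau x) = 0 & x != 0].
  case: (pselect (vge (v1 \o tau) 1 a)) => [v1ta|nta]; last first.
    by exists a; split => //; have [] := ri_val0 V1t Oa nta.
  case: (pselect (vge v1 1 b)) => [v1b|n1b]; last first.
    by exists b; split => //; have [] := ri_val0 V1 Ob n1b.
  exists (a + b); split; first by inri.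
  - by apply: (valD V2).
  - by have [] := @val_dom _ _ SK0 V1 a b 1 ka kb a0; rewrite ?v1a.
  - rewrite rmorphD addrC.
    have := @val_dom _ _ SK0 V1t b a 1 kb ka b0; rewrite v1tb => /(_ isT v1ta)[_].
    by rewrite /= rmorphD.
  - by have [] := @val_dom _ _ SK0 V1 a b 1 ka kb a0; rewrite ?v1a.
have [n Dn] := norm_Z Ox.
have [kx _] := Ox; have ktx := tau_k0 kx.
have tx0 : tau x != 0 by rewrite fmorph_eq0.
have nz : n%:~R != 0 :> algC by rewrite -Dn mulf_neq0.
have v1n : v1 n%:~R = 0 by rewrite -Dn (valM V1) // v1x v1tx.
have v2n : vge v2 1 n%:~R.
  by rewrite -Dn; apply: (vgeMr V2) => //; apply: (vge_ri SK0 V2); exact: tau_ri.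
have ndv : ~~ (l %| n)%Z.
  apply/negP => /dvdzP[k Dk]; have k0' : k%:~R != 0 :> algC.
    by rewrite intr_eq0; apply: contraNneq nz => k0; rewrite Dk k0 mul0r.
  have l0 : l%:R != 0 :> algC by rewrite pnatr_eq0 -lt0n prime_gt0.
  have kk : k0 k%:~R by insf. have kl : k0 l%:R by insf.
  move: v1n; rewrite Dk intrM -[(l%:Z)%:~R]/(l%:R) (valM V1) //.
  have := vgeE k0' (vge_int SK0 V1 k); move: vl1.
  by move: (v1 _) (v1 _) => a1 a2; clear; lia.
by have := vgeE nz v2n; rewrite (val_int0 SK0 V2 pr_l vl2 ndv).
Qed.

(** A prime other than [p] in the squarefree part would contribute an odd value, by [val_l1]. *)
Lemma rational_even g : QQ g -> g != 0 -> (forall v, val k0 v -> evz (v g)) ->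
  exists s (i j : bool), [/\ QQ s, s != 0 & g = (-1) ^+ i * p%:R ^+ j * s ^+ 2].
Proof.
move=> Qg g0 ev; have [s [c [Qs s0 Dg c0 sf]]] := rat_squarefree Qg g0.
have ks := rat_k0 Qs.
have [Dc|Dc] : c = 1%N \/ c = p.
  case: (eqVneq c 1%N) => [|c1]; first by left.
  have only_p l : prime l -> (l %| c)%N -> l = p.
    move=> pr_l /dvdnP[m Dm]; apply/eqP; apply: contraT => lp; exfalso.
    have [v V vl] := val_exists_over NK0 pr_l.
    have v1 := val_l1 V pr_l lp vl.
    have m0 : (0 < m)%N by move: c0; rewrite Dm; case: (m).
    have mC : m%:R != 0 :> algC by rewrite pnatr_eq0 -lt0n.
    have lC : l%:R != 0 :> algC by rewrite pnatr_eq0 -lt0n prime_gt0.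
    have cC : c%:R != 0 :> algC by rewrite pnatr_eq0 -lt0n.
    have km : k0 m%:R by insf. have kl : k0 l%:R by insf. have kc : k0 c%:R by insf.
    have vm : v m%:R = 0.
      apply: (val_nat0 SK0 V pr_l vl); apply: contraNN (sf l pr_l) => /dvdnP[m' e].
      by rewrite Dm e -mulnA mulnn dvdn_mull.
    have vc : v c%:R = 1 by rewrite Dm natrM (valM V) // vm v1.
    have ks2 : k0 (s ^+ 2) by insf. have s20 : s ^+ 2 != 0 by rewrite expf_neq0.
    have vcs : v (c%:R * s ^+ 2) = 1 + 2%:Z * v s by rewrite (valM V) // vc (val_X SK0 V).
    have kcs : k0 (c%:R * s ^+ 2) by insf.
    have vg : v g = 1 + 2%:Z * v s by case: Dg => ->; rewrite ?(val_N SK0 V) // mulf_neq0.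
    have := ev v V; rewrite vg addrC => ev1; apply: evz_not (evz2 (v s)) ev1.
  right; have gt1 : (1 < c)%N by case: (c) c0 c1 => [//|[]].
  have pd := pdiv_prime gt1; have e := only_p _ pd (pdiv_dvd c).
  have := pdiv_dvd c; rewrite e => /dvdnP[m Dm].
  case: (eqVneq m 1%N) => [m1|m1]; first by rewrite Dm m1 mul1n.
  have m0 : (0 < m)%N by move: c0; rewrite Dm; case: (m).
  have gt1m : (1 < m)%N by case: (m) m0 m1 => [//|[]].
  have em : pdiv m = p.
    by apply: only_p (pdiv_prime gt1m) _; rewrite Dm dvdn_mulr // pdiv_dvd.
  have := sf p pr_p; rewrite Dm -mulnn dvdn_pmul2r ?prime_gt0 //.
  by rewrite -em pdiv_dvd.
- case: Dg => Dg; [exists s, false, false | exists s, true, false]; split=> //;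
  by rewrite Dg Dc; ring.
- case: Dg => Dg; [exists s, false, true | exists s, true, true]; split=> //;
  by rewrite Dg Dc; ring.
Qed.

Lemma rational_even_k0 g : QQ g -> g != 0 -> (forall v, val k0 v -> evz (v g)) ->
  exists s (i : bool), [/\ k0 s, s != 0 & g = (-1) ^+ i * s ^+ 2].
Proof.
move=> Qg g0 ev; have [s [i [j [Qs s0 Dg]]]] := rational_even Qg g0 ev.
have ks := rat_k0 Qs.
exists (sp ^+ j * s), i; split; first by insf.
  by rewrite mulf_neq0 ?expf_neq0 // sp_neq0.
have -> : (sp ^+ j * s) ^+ 2 = (sp ^+ 2) ^+ j * s ^+ 2 by rewrite exprMn -!exprM mulnC.
by rewrite sp2 Dg -mulrA.
Qed.

Let Osp := sp_ri.
Let Oom := omega_ri.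

(** * Units of the real quadratic field *)

Variable eps : algC.
Hypothesis fu : fundamental_unit k0 eps.

Lemma k0_real x : k0 x -> x \is Num.real.
Proof.
move=> /k0P[u [t [Qu Qt ->]]]; have rs : sp \is Num.real.
  by apply: gtr0_real; apply: sp_gt0.
by rewrite realD ?realM // Creal_rat.
Qed.

Lemma val_unit u v : unit_of_integers k0 u -> val k0 v -> v u = 0.
Proof.
move=> [u0 Ou Oi] V; have [ku _] := Ou.
have := vgeE u0 (vge_ri SK0 V Ou); have := vgeE (invr_neq0 u0) (vge_ri SK0 V Oi).
by rewrite (val_V SK0 V) //; lia.
Qed.

Lemma eps_gt0 : 0 < eps.
Proof. by case: fu => _ e1 _; apply: lt_trans e1; exact: ltr01. Qed.
Lemma eps_neq0 : eps != 0. Proof. exact: lt0r_neq0 eps_gt0. Qed.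
Lemma eps_unit : unit_of_integers k0 eps. Proof. by case: fu. Qed.
Lemma eps_ri : O eps. Proof. by case: eps_unit. Qed.
Lemma eps_k0 : k0 eps. Proof. by case: eps_ri. Qed.

Lemma norm_unit u : unit_of_integers k0 u -> u * tau u = 1 \/ u * tau u = -1.
Proof.
move=> [u0 Ou Oi]; have [n Dn] := norm_Z Ou; have [m Dm] := norm_Z Oi.
have : (n * m)%:~R = 1 :> algC.
  by rewrite intrM -Dn -Dm fmorphV mulrACA !divff ?mulr1 // fmorph_eq0.
move=> /eqP; rewrite (eqr_int _ _ 1) => /eqP e.
have := congr1 absz e; rewrite abszM => /eqP; rewrite muln_eq1 => /andP[/eqP n1 _].
by rewrite Dn; case: (n) n1 => k; [move=> /= ->; left | case: k => //; right].
Qed.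

(** If the norm were 1, [z = 1 + eps] would satisfy [z ^+ 2 = eps * N(z)]. The rational number N(z)
    would have even values everywhere and be a square of k0 up to sign, so that [eps] or [- eps]
    would be the square of a unit. *)
Lemma norm_eps : eps * tau eps = -1.
Proof.
have [ue e1 fund] := fu; have e0 := eps_neq0.
have [N1|//] := norm_unit ue; exfalso.
have te : tau eps = eps^-1 by apply: (mulfI e0); rewrite N1 divff.
pose z := 1 + eps; have ke := eps_k0; have kz : k0 z by rewrite /z; insf.
have z0 : z != 0 by apply: lt0r_neq0; rewrite addr_gt0 ?ltr01 ?eps_gt0.
have tz : tau z = z / eps by rewrite /z rmorphD rmorph1 te mulrDl divff // mul1r addrC.
have Qg := norm_Q kz; set g := z * tau z in Qg.
have Dg : z ^+ 2 = eps * g by rewrite /g tz; field.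
have g0 : g != 0 by rewrite /g mulf_neq0 // fmorph_eq0.
have kg := rat_k0 Qg.
have [|s [i [ks s0 Dg2]]] := rational_even_k0 Qg g0.
  move=> v V; have := val_X SK0 V 2 kz z0; rewrite Dg (valM V) // (val_unit ue V) add0r => ->.
  exact: evz2.
pose w := z / s; have kw : k0 w by rewrite /w; insf.
have Dw : w ^+ 2 = (-1) ^+ i * eps.
  by rewrite /w exprMn Dg Dg2 exprVn; field.
have w0 : w != 0 by rewrite mulf_neq0 ?invr_eq0.
have [_ [_ /= Ae] [_ /= Aei]] := ue.
have uw : unit_of_integers k0 w.
  split => //; split => //=; try (by insf).
    by apply: sqrt_Aint; rewrite Dw rpredM // rpredX // rpredN.
  by apply: sqrt_Aint; rewrite exprVn Dw invfM rpredM // -exprVn invrN1 rpredX // rpredN.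
have [k Dk] := fund w uw.
have {}Dw : eps ^ (k + k) = (-1) ^+ i * eps.
  by rewrite -Dw expfzDr //; case: Dk => ->; ring.
have pk : 0 < eps ^ (k + k) by rewrite exprz_gt0 // eps_gt0.
case: i {Dg2} Dw => Dw.
  by move: pk; rewrite Dw expr1 mulN1r oppr_gt0 => /lt_trans /(_ eps_gt0); rewrite ltxx.
have : eps ^ (k + k - 1) = 1 by rewrite expfzDr // Dw expr0 mul1r -invr_expz expr1z divff.
by move=> /(exprz_eq1_gt1 e1); clear; lia.
Qed.

Lemma tau_eps : tau eps = - eps^-1.
Proof. by apply: (mulfI eps_neq0); rewrite norm_eps mulrN divff // eps_neq0. Qed.

(* The norm of c has even valuation everywhere, hence is a square up to sign
   and up to p; p is absorbed by sp and the sign by eps, and then Hilbert's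
   theorem 90 applies. *)
Lemma even_unit_square c : k0 c -> c != 0 -> (forall v, val k0 v -> evz (v c)) ->
  exists g (i j : bool), [/\ k0 g, g != 0 & c = (-1) ^+ i * eps ^+ j * g ^+ 2].
Proof.
move=> kc c0 ev; have ke := eps_k0; have e0 := eps_neq0.
have tc0 : tau c != 0 by rewrite fmorph_eq0. have ktc := tau_k0 kc.
have evt v : val k0 v -> evz (v (tau c)).
  by move=> V; exact: ev _ (val_tau V).
have Qg := norm_Q kc.
have [|s [i [j [Qs s0 Dg]]]] := rational_even Qg (mulf_neq0 c0 tc0).
  by move=> v V; rewrite (valM V) //; apply: evzD; [exact: ev | exact: evt].
have ks := rat_k0 Qs.
pose b := i (+) j; pose c' := c * sp ^+ j * eps ^+ b.
have kc' : k0 c' by rewrite /c'; insf.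
have c'0 : c' != 0 by rewrite /c' !mulf_neq0 ?expf_neq0.
have Qs' : QQ (p%:R ^+ j * s) by insf.
have s'0 : p%:R ^+ j * s != 0 by rewrite mulf_neq0 ?expf_neq0 // p_neq0.
have [|r [z [Qr r0 kz z0 Dc']]] := norm_square kc' Qs' s'0.
  rewrite /c' !rmorphM !rmorphXn /= tau_sp.
  transitivity ((c * tau c) * (sp ^+ 2 * -1) ^+ j * (eps * tau eps) ^+ b).
    by rewrite -[- sp]mulrN1 expr2 !exprMn; ring.
  rewrite Dg norm_eps sp2 /b; case: (i) (j) => [] []; rewrite /=; ring.
have kr := rat_k0 Qr.
have vc' v : val k0 v -> v c' = v c + j%:Z * v sp.
  move=> V; have kspj : k0 (sp ^+ j) by insf. have keb : k0 (eps ^+ b) by insf.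
  have kcs : k0 (c * sp ^+ j) by insf.
  rewrite /c' (valM V) ?mulf_neq0 ?expf_neq0 // (valM V) ?expf_neq0 //.
  by rewrite !(val_X SK0 V) // (val_unit eps_unit V) mulr0 addr0.
have vr v : val k0 v -> v c' = v r + 2%:Z * v z.
  move=> V; have kz2 : k0 (z ^+ 2) by insf.
  by rewrite Dc' (valM V) ?expf_neq0 // (val_X SK0 V).
have j0 : j = false.
  apply/negP => j1; have [v V vp] := val_exists_over NK0 pr_p.
  have [vsp _] := val_p1 V vp.
  have [k er] := val_ratE SK0 V pr_p vp Qr r0.
  have := vc' v V; rewrite vr // vsp j1 mulr1 er.
  have := val_X SK0 V 2 Ksp sp0; rewrite sp2 vsp => ->.
  have [a ->] := ev v V; move: (v z) => d; clear; lia.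
have [|t [i' [kt t0 Dt]]] := rational_even_k0 Qr r0.
  move=> v V; apply: (@evz_addr _ (2%:Z * v z) (evz2 _)).
  by rewrite -vr // vc' // j0 mul0r addr0; exact: ev.
exists (t * z / eps ^+ b), i', b; split; try (by insf).
  by rewrite !mulf_neq0 ?invr_eq0 ?expf_neq0.
have eb0 : eps ^+ b != 0 by rewrite expf_neq0.
have -> : c = c' / eps ^+ b by rewrite /c' j0 expr0 mulr1 mulfK.
by rewrite Dc' Dt; field.
Qed.

(** Since [eps] has norm -1, the signs of [c] and [tau c] separate the four classes of
    [even_unit_square]. *)
Lemma totally_positive_square c : k0 c -> 0 < c -> 0 < tau c ->
  (forall v, val k0 v -> evz (v c)) -> exists2 g, k0 g & c = g ^+ 2.
Proof.
move=> kc c_gt0 tc_gt0 ev; have [g [i [j [kg g0 Dc]]]] := even_unit_square kc (lt0r_neq0 c_gt0) ev.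
have sq h : k0 h -> h != 0 -> 0 < h ^+ 2.
  by move=> kh h0; rewrite real_exprn_even_gt0 ?k0_real // h0 orbT.
have ktg := tau_k0 kg; have tg0 : tau g != 0 by rewrite fmorph_eq0.
have s1 := sq g kg g0; have s2 := sq _ ktg tg0; have e0 := eps_gt0.
have ei : 0 < eps^-1 by rewrite invr_gt0.
move: c_gt0 tc_gt0; rewrite Dc !rmorphM !rmorphXn rmorphN1 /= tau_eps.
case: i j {Dc} => [] [] /=; rewrite ?expr0 ?expr1 ?mul1r ?mulr1 ?mulN1r ?mulNr.
- by rewrite oppr_gt0 => /lt_trans/(_ (mulr_gt0 e0 s1)); rewrite ltxx.
- by rewrite oppr_gt0 => /lt_trans/(_ s1); rewrite ltxx.
- by move=> _; rewrite oppr_gt0 => /lt_trans/(_ (mulr_gt0 ei s2)); rewrite ltxx.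
- by exists g.
Qed.

Lemma ri_form x : O x -> exists t u : int, 2%:R * x = t%:~R + u%:~R * sp.
Proof.
move=> Ox; have [t Dt] := trace_Z Ox; have [n Dn] := norm_Z Ox.
have [kx _] := Ox; have [a [b [Qa Qb Dx]]] := (k0P x).1 kx.
have tx : tau x = a - b * sp by rewrite Dx tau_form.
have Otx := tau_ri Ox.
(* [w] is [(x - tau x) * sp]. Its square is [p * (t ^+ 2 - 4 * n)], so [p] divides [w] and [2 * b]
   is an integer. *)
have [w Dw] : exists w : int, 2%:R * p%:R * b = w%:~R.
  apply: QAint; first by insf.
  have -> : 2%:R * p%:R * b = (x - tau x) * sp.
    by rewrite tx Dx; move: (sp) sp2 => S <-; ring.
  by suff [] : O ((x - tau x) * sp) by []; inri.
have ew : w ^+ 2 = p%:Z * (t ^+ 2 - 4 * n).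
  apply: (@intr_inj algC); rewrite rmorphXn rmorphM rmorphB rmorphXn rmorphM /=.
  rewrite -Dw -Dt -Dn tx Dx -[(p%:Z)%:~R]/(p%:R) -[4%:~R]/(4%:R).
  by move: (sp) sp2 => S <-; ring.
have : (p %| w)%Z.
  have : (p %| w ^+ 2)%Z by rewrite ew dvdz_mulr.
  by rewrite !dvdzE /= abszX Euclid_dvdX // => /andP[].
move=> /dvdzP[u Du]; exists t, u.
have p0 := p_neq0; have : 2%:R * b = u%:~R.
  apply: (mulfI p0); rewrite mulrA [p%:R * _]mulrC Dw Du intrM mulrC; congr (_ * _).
move=> <-; rewrite -Dt tx Dx; ring.
Qed.

(** The cube of [eps] lies in Z[sp]: it is [T + U * sp] with [T ^+ 2 + 1 = p * U ^+ 2] and [U > 0].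
    Positive odd divisors of [T ^+ 2 + 1] are 1 modulo 4, so [U] is, and then [p = 5] modulo 8
    forces [T] to be 2 modulo 4. *)
Lemma eps3_sp : exists2 y, O y & eps ^+ 3 * sp + 1 = 4%:R * y.
Proof.
have Oe := eps_ri; have e0 := eps_gt0.
have [t [u De]] := ri_form Oe; have te := tau_eps.
have tDe : 2%:R * tau eps = t%:~R - u%:~R * sp.
  have Qt : QQ t%:~R by insf. have Qu : QQ u%:~R by insf.
  by rewrite -(tau_form Qt Qu) -De rmorphM rmorph_nat.
have Ne := norm_eps.
have e1 : t ^+ 2 + 4 = p%:Z * u ^+ 2.
  apply: (@intr_inj algC); rewrite intrM intrD !rmorphXn /= -[(p%:Z)%:~R]/(p%:R) -[4%:~R]/(4%:R).
  have : (t%:~R + u%:~R * sp) * (t%:~R - u%:~R * sp) = - 4%:R.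
    rewrite -De -tDe; transitivity (4%:R * (eps * tau eps)); first by ring.
    by rewrite Ne; ring.
  by move: (sp) sp2 => S <- e; apply/eqP; rewrite -subr_eq0 -(subrr (- 4%:R)) -{1}e; apply/eqP; ring.
have u_gt0 : 0 < u.
  have : 0 < u%:~R * sp.
    have -> : u%:~R * sp = eps - tau eps.
      apply: (@mulfI _ 2%:R); first by rewrite pnatr_eq0.
      by rewrite mulrBr De tDe; ring.
    by rewrite te opprK addr_gt0 ?invr_gt0.
  by rewrite pmulr_lgt0 ?ltr0z // sp_gt0.
(* [T] and [U] are found by expanding the cube of [t + u * sp] and replacing [p * u ^+ 2] by
   [t ^+ 2 + 4]. *)
have [T DT] : exists T : int, 2 * T = t * (t ^+ 2 + 3).
  have : (2 %| t * (t ^+ 2 + 3))%Z.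
    have [e|e] : (t %% 2 = 0)%Z \/ (t %% 2 = 1)%Z by lia.
      by apply: dvdz_mulr; apply/dvdz_mod0P.
    apply: dvdz_mull; have Dt : t = (t %/ 2)%Z * 2 + 1 by move: e; clear; lia.
    rewrite Dt; apply/dvdzP; eexists (2 * (t %/ 2)%Z ^+ 2 + 2 * (t %/ 2)%Z + 2); ring.
  by move=> /dvdzP[T DT]; exists T; rewrite DT mulrC.
have [U DU] : exists U : int, 2 * U = u * (t ^+ 2 + 1).
  have [c Dp] : exists c : int, p%:Z = 8 * c + 5 by exists (p %/ 8)%N%:Z; lia.
  have [e|e] : (t %% 2 = 0)%Z \/ (t %% 2 = 1)%Z by lia.
    have Dt : t = (t %/ 2)%Z * 2 by move: e; clear; lia.
    have [e'|e'] : (u %% 2 = 0)%Z \/ (u %% 2 = 1)%Z by lia.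
      have Du : u = (u %/ 2)%Z * 2 by move: e'; clear; lia.
      by exists ((u %/ 2)%Z * (t ^+ 2 + 1)); rewrite [in RHS]Du; ring.
    have Du : u = (u %/ 2)%Z * 2 + 1 by move: e'; clear; lia.
    exfalso; move: e1; rewrite Dp Dt Du; move: (t %/ 2)%Z (u %/ 2)%Z => a b; clear; nia.
  have Dt : t = (t %/ 2)%Z * 2 + 1 by move: e; clear; lia.
  exists (u * (2 * (t %/ 2)%Z ^+ 2 + 2 * (t %/ 2)%Z + 1)); rewrite [in RHS]Dt; ring.
have e3 : eps ^+ 3 = T%:~R + U%:~R * sp.
  apply: (@mulfI _ 8%:R); first by rewrite pnatr_eq0.
  transitivity ((2%:R * eps) ^+ 3); first by ring.
  rewrite De.
  have DT' : 2%:R * T%:~R = t%:~R * (t%:~R ^+ 2 + 3%:R) :> algC.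
    by have /= := congr1 (fun z : int => z%:~R : algC) DT; rewrite !intrM [(t ^+ 2 + 3)%:~R]intrD rmorphXn.
  have DU' : 2%:R * U%:~R = u%:~R * (t%:~R ^+ 2 + 1) :> algC.
    by have /= := congr1 (fun z : int => z%:~R : algC) DU; rewrite !intrM [(t ^+ 2 + 1)%:~R]intrD rmorphXn.
  have e1' : t%:~R ^+ 2 + 4%:R = p%:R * u%:~R ^+ 2 :> algC.
    by have /= := congr1 (fun z : int => z%:~R : algC) e1; rewrite !intrM [(t ^+ 2 + 4)%:~R]intrD !rmorphXn.
  have -> : 8%:R * (T%:~R + U%:~R * sp) = 4%:R * (2%:R * T%:~R) + 4%:R * (2%:R * U%:~R) * sp by ring.
  rewrite DT' DU'; move: e1'; move: (sp) sp2 => S <- e1'.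
  set a := t%:~R in e1' *; set b := u%:~R in e1' *.
  have -> : (a + b * S) ^+ 3 = a ^+ 3 + 3%:R * a * (S ^+ 2 * b ^+ 2) + (3%:R * a ^+ 2 + S ^+ 2 * b ^+ 2) * b * S by ring.
  by rewrite -e1'; ring.
have N3 : T ^+ 2 + 1 = p%:Z * U ^+ 2.
  apply: (@mulfI _ (4 : int)) => //.
  have -> : 4 * (T ^+ 2 + 1) = (2 * T) ^+ 2 + 4 by ring.
  have -> : 4 * (p%:Z * U ^+ 2) = p%:Z * (2 * U) ^+ 2 by ring.
  have -> : p%:Z * (2 * U) ^+ 2 = (p%:Z * u ^+ 2) * (t ^+ 2 + 1) ^+ 2 by rewrite DU; ring.
  by rewrite DT -e1; ring.
have U_gt0 : 0 < U by move: DU u_gt0; clear; nia.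
have [c Dp] : exists c : int, p%:Z = 8 * c + 5 by exists (p %/ 8)%N%:Z; lia.
have oU : (U %% 2 = 1)%Z.
  have [e|//] : (U %% 2 = 0)%Z \/ (U %% 2 = 1)%Z by lia.
  exfalso; have DU2 : U = (U %/ 2)%Z * 2 by move: e; clear; lia.
  have [e'|e'] : (T %% 2 = 0)%Z \/ (T %% 2 = 1)%Z by lia.
    have DT2 : T = (T %/ 2)%Z * 2 by move: e'; clear; lia.
    by move: N3; rewrite Dp DU2 DT2; move: (T %/ 2)%Z (U %/ 2)%Z => a b; clear; nia.
  have DT2 : T = (T %/ 2)%Z * 2 + 1 by move: e'; clear; lia.
  by move: N3; rewrite Dp DU2 DT2; move: (T %/ 2)%Z (U %/ 2)%Z => a b; clear; nia.
have U4 : (U %% 4 = 1)%Z.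
  have : (`|U|%N %% 4 = 1)%N.
    apply: (@dvd_sqr_add1 _ `|T|%N); first by move: oU U_gt0; clear; lia.
    have : (U %| T ^+ 2 + 1)%Z by rewrite N3 expr2 mulrA dvdz_mull.
    rewrite dvdzE; congr (_ %| _)%N.
    have -> : T ^+ 2 + 1 = (`|T|%N ^ 2 + 1)%N%:Z by rewrite PoszD -abszX gez0_abs // sqr_ge0.
    by [].
  by move: U_gt0; clear; lia.
have T4 : exists T', T = 4 * T' + 2.
  have DU2 : U = (U %/ 4)%Z * 4 + 1 by move: U4; clear; lia.
  have [e|[e|[e|e]]] : (T %% 4 = 0)%Z \/ (T %% 4 = 1)%Z \/ (T %% 4 = 2)%Z \/ (T %% 4 = 3)%Z by lia.
  - exfalso; have DT2 : T = (T %/ 4)%Z * 4 by move: e; clear; lia.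
    by move: N3; rewrite Dp DU2 DT2; move: (T %/ 4)%Z (U %/ 4)%Z => a b; clear; nia.
  - exfalso; have DT2 : T = (T %/ 4)%Z * 4 + 1 by move: e; clear; lia.
    by move: N3; rewrite Dp DU2 DT2; move: (T %/ 4)%Z (U %/ 4)%Z => a b; clear; nia.
  - by exists (T %/ 4)%Z; move: e; clear; lia.
  - exfalso; have DT2 : T = (T %/ 4)%Z * 4 + 3 by move: e; clear; lia.
    by move: N3; rewrite Dp DU2 DT2; move: (T %/ 4)%Z (U %/ 4)%Z => a b; clear; nia.
have [T' DT4] := T4; have DU4 : U = (U %/ 4)%Z * 4 + 1 by move: U4; clear; lia.
set U' := (U %/ 4)%Z in DU4.
have pE : p%:R = 8%:R * c%:~R + 5%:R :> algC.
  by rewrite -[p%:R]/((p%:Z)%:~R) Dp intrD intrM.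
exists ((2%:R * T'%:~R + 1) * omega - T'%:~R + (8%:R * c%:~R + 5%:R) * U'%:~R + 2%:R * c%:~R + 1).
  by inri.
rewrite e3 DT4 DU4 !intrD !intrM /=.
have -> : omega = (1 + sp) / 2%:R by [].
move: (sp) sp2 => S; rewrite pE => S2.
have -> : (4%:~R * T'%:~R + 2%:~R + (U'%:~R * 4%:~R + 1%:~R) * S) * S + 1 =
   (4%:~R * T'%:~R + 2%:~R) * S + (U'%:~R * 4%:~R + 1%:~R) * S ^+ 2 + 1 by ring.
by rewrite S2; field.
Qed.

(** * Ambiguous ideals and the parity of the class number *)

Let tauO := tau_ri.

Lemma ideal_min_int J : nonzero_ideal O J -> exists2 n : nat, (0 < n)%N &
  J n%:R /\ forall m : int, J m%:~R -> exists k : int, m = k * n%:Z.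
Proof.
move=> [[JO J0 JD JM] [x Jx x0]].
have [z z0 [y Oy Dz]] := Aint_dvd_int SK0 (JO _ Jx) x0.
have JN t : J t -> J (- t) by move=> Jt; rewrite -mulN1r; apply: JM => //; inri.
have Jabs (m : int) : J m%:~R -> J (`|m|%N)%:R.
  by case: m => m // /JN; rewrite NegzE mulrNz opprK.
have ex : exists n, (0 < n)%N && `[< J n%:R >].
  exists `|z|%N; rewrite absz_gt0 z0; apply/asboolP/Jabs.
  by rewrite Dz mulrC; apply: JM.
case: (ex_minnP ex) => n /andP[n0 /asboolP Jn] minn; exists n => //; split=> // m Jm.
exists (m %/ n)%Z; apply/eqP; rewrite {1}(divz_eq m n) -subr_eq0 addrC addKr.
apply: contraT => r0; have nz : (n : int) != 0 by case: (n) n0.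
have Jr : J (m %% n)%Z%:~R.
  rewrite /modz intrB; apply: JD => //; apply: JN; rewrite intrM.
  by apply: JM => //; inri.
have /minn : (0 < `|(m %% n)%Z|)%N && `[< J (`|(m %% n)%Z|%N)%:R >].
  by rewrite absz_gt0 r0; apply/asboolP/Jabs.
have := ltz_pmod m (isT : 0 < n.+1%:Z); have := modz_ge0 m nz.
have : (m %% n)%Z < n by apply: ltz_pmod; rewrite ltz_nat.
by clear; lia.
Qed.

(* For x in J, both Tr(x) and Tr(x omega) lie in J and in Z, hence in nZ. *)
Lemma stable_ideal_sp J n : nonzero_ideal O J -> (forall x, J x -> J (tau x)) ->
  (forall m : int, J m%:~R -> exists k : int, m = k * n%:Z) ->
  forall x, J x -> exists2 y, O y & sp * x = n%:R * y.
Proof.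
move=> [[JO J0 JD JM] _] st Hn x Jx.
have tr y : J y -> exists k : int, y + tau y = n%:R * k%:~R.
  move=> Jy; have [m Dm] := trace_Z (JO _ Jy).
  have [|k Dk] := Hn m; first by rewrite -Dm; apply: JD => //; exact: st.
  by exists k; rewrite Dm Dk intrM mulrC.
have [a Da] := tr x Jx; have [b Db] := tr _ (JM _ _ Oom Jx).
exists (b%:~R + a%:~R * (omega - 1)); first by inri.
rewrite mulrDr -Db mulrA -Da rmorphM /= tau_omega.
by rewrite [sp]sp_omega; ring.
Qed.

(** By [stable_ideal_sp], [J1] (which is [sp / n] times [J]) is again an integral stable ideal, and
    it contains [p]. Its least positive integer is 1 or [p]: either [J1] is the unit ideal, or the
    same inclusion for [J1] shows that it is generated by [sp], so that [J] is generated by [n]. *)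
Lemma stable_ideal_principal J : nonzero_ideal O J -> (forall x, J x -> J (tau x)) ->
  ideal_equiv O O J.
Proof.
move=> NJ st; have [[JO J0 JD JM] _] := NJ.
have [n n0 [Jn minn]] := ideal_min_int NJ.
have nC : n%:R != 0 :> algC by rewrite pnatr_eq0 -lt0n.
have Hsp := stable_ideal_sp NJ st minn.
pose J1 : set algC := [set y | exists2 x, J x & sp * x = n%:R * y].
have J1sp : J1 sp by exists n%:R => //; rewrite mulrC.
have NJ1 : nonzero_ideal O J1.
  split; last by exists sp.
  split=> [y [x Jx e]||y z [x Jx e] [x' Jx' e']|r y Or [x Jx e]].
  - have [y' Oy' e'] := Hsp x Jx; suff -> : y = y' by [].
    by apply: (mulfI nC); rewrite -e e'.
  - by exists 0; rewrite ?mulr0.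
  - by exists (x + x'); [exact: JD | rewrite !mulrDr e e'].
  - by exists (r * x); [exact: JM | rewrite mulrCA e mulrCA].
have [[J1O J10 J1D J1M] _] := NJ1.
have st1 y : J1 y -> J1 (tau y).
  move=> [x Jx e]; exists (- tau x).
    by rewrite -mulN1r; apply: JM; [inri | exact: st].
  by have := congr1 tau e; rewrite !rmorphM /= tau_sp rmorph_nat mulrN mulNr.
have [n1 n10 [J1n1 minn1]] := ideal_min_int NJ1.
have [k Dk] : exists k : int, p%:Z = k * n1%:Z.
  by apply: minn1; rewrite -[(p%:Z)%:~R]/(p%:R) -sp2 expr2; apply: J1M.
have [e1|e1] : n1 = 1%N \/ n1 = p.
  have : (n1%:Z %| p%:Z)%Z by rewrite Dk dvdz_mull.
  by have /primeP[_ H] := pr_p; rewrite dvdzE /= => /H /orP[] /eqP; [left | right].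
- exists n%:R, sp; split; try (by inri); rewrite ?pnatr_eq0 -?lt0n //.
  apply/seteqP; split=> [_ [r Or <-]|_ [x Jx <-]].
    have J11 : J1 1 by rewrite e1 in J1n1.
    by have [x Jx] := J1M r 1 Or J11; rewrite mulr1 => <-; exists x.
  by have [y Oy ->] := Hsp x Jx; exists y.
- exists n%:R, 1; split; try (by inri); rewrite ?oner_neq0 //.
  apply/seteqP; split=> [_ [r Or <-]|_ [x Jx <-]].
    by exists (n%:R * r); rewrite ?mul1r // mulrC; apply: JM.
  have [y Oy e] := Hsp x Jx; have J1y : J1 y by exists x.
  have [y' Oy' e'] := stable_ideal_sp NJ1 st1 minn1 J1y.
  exists y' => //; rewrite mul1r; apply: (mulfI sp0); rewrite e mulrCA; congr (_ * _).
  by apply: (mulfI sp0); rewrite e' e1 mulrA -expr2 sp2.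
Qed.

Local Notation T I := [set tau x | x in I].

Lemma tau_ideal I : nonzero_ideal O I -> nonzero_ideal O (T I).
Proof.
move=> [[IO I0 ID IM] [x Ix x0]]; split; last first.
  by exists (tau x); [exists x | rewrite fmorph_eq0].
split=> [_ [y Iy <-]||_ _ [y Iy <-] [z Iz <-]|r _ Or [y Iy <-]].
- exact/tauO/IO.
- by exists 0; rewrite ?rmorph0.
- by exists (y + z); [exact: ID | rewrite rmorphD].
- exists (tau r * y); first by apply: IM => //; exact: tauO.
  by rewrite rmorphM /= tauK //; case: Or.
Qed.

Lemma tau_idealK I : nonzero_ideal O I -> T (T I) = I.
Proof.
move=> [[IO _ _ _] _]; have KI x : I x -> tau (tau x) = x.
  by move=> /IO[kx _]; exact: tauK.
apply/seteqP; split=> [_ [_ [x Ix <-] <-]|x Ix]; first by rewrite KI.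
by exists (tau x); [exists x | exact: KI].
Qed.

Lemma tau_scale a I : T (scale a I) = scale (tau a) (T I).
Proof.
apply/seteqP; split=> [_ [_ [x Ix <-] <-]|_ [_ [x Ix <-] <-]].
  by exists (tau x); [exists x | rewrite rmorphM].
by exists (a * x); [exists x | rewrite rmorphM].
Qed.

Lemma tau_equiv I J : ideal_equiv O I J -> ideal_equiv O (T I) (T J).
Proof.
move=> [a [b [Oa Ob a0 b0 e]]]; exists (tau a), (tau b); split; rewrite ?fmorph_eq0 //.
- exact: tauO.
- exact: tauO.
by rewrite -!tau_scale e.
Qed.

Lemma scale1 (I : set algC) : scale 1 I = I.
Proof.
apply/seteqP; split=> [_ [x Ix <-]|x Ix]; first by rewrite mul1r.
by exists x; rewrite ?mul1r.
Qed.

Lemma scale_unit u I : unit_of_integers k0 u -> ideal O I -> scale u I = I.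
Proof.
move=> [u0 Ou Oi] [_ _ _ IM]; apply/seteqP; split=> [_ [x Ix <-]|x Ix]; first exact: IM.
by exists (u^-1 * x); [exact: IM | rewrite mulVKf].
Qed.

(** [N ^+ k * x] and [x / N ^+ k] stay in [I] for all [k], so [N] has value 0 everywhere; a rational
    number with this property is 1 or -1. *)
Lemma rational_scale_unit N I : QQ N -> nonzero_ideal O I -> scale N I = I -> N = 1 \/ N = -1.
Proof.
move=> QN NI eN; have [[IO _ _ _] [x Ix x0]] := NI; have [kx _] := IO _ Ix.
have N0 : N != 0.
  apply: contraTneq x0 => N0; move: Ix; rewrite -eN => -[y _ <-].
  by rewrite N0 mul0r eqxx.
have kN := rat_k0 QN.
have pw k : I (N ^+ k * x).
  elim: k => [|k IHk]; first by rewrite mul1r.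
  by rewrite exprS -mulrA -eN; exists (N ^+ k * x).
have pwV k : exists2 y, I y & x = N ^+ k * y.
  elim: k => [|k [y]]; first by exists x; rewrite ?mul1r.
  by rewrite -{1}eN => -[z Iz <-] ->; exists z => //; rewrite exprSr mulrA.
have vN v : val k0 v -> v N = 0.
  move=> V; pose m := (`|v x|%N).+1.
  have kNm : k0 (N ^+ m) by insf. have Nm0 : N ^+ m != 0 by rewrite expf_neq0.
  have := vgeE (mulf_neq0 Nm0 x0) (vge_ri SK0 V (IO _ (pw m))).
  rewrite (valM V) // (val_X SK0 V) // => ge1.
  have [y Iy Dx] := pwV m; have [ky _] := IO _ Iy.
  have y0 : y != 0 by apply: contraNneq x0 => y0; rewrite Dx y0 mulr0.
  have := vgeE y0 (vge_ri SK0 V (IO _ Iy)).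
  have : v x = m%:Z * v N + v y by rewrite {1}Dx (valM V) // (val_X SK0 V).
  move: ge1; rewrite /m; move: (v x) (v y) (v N) => a b c; clear; nia.
have [q _ Dq] := QN.
have num1 (n : int) : n != 0 -> (forall v, val k0 v -> v n%:~R = 0) -> (`|n| = 1)%N.
  move=> n0 Hv; apply/eqP; apply: contraT => n1.
  have gt1 : (1 < `|n|)%N by move: n0 n1; clear; lia.
  have pr := pdiv_prime gt1; have [v V vl] := val_exists_over NK0 pr.
  have [m Dn] : exists m : int, n = m * (pdiv `|n|)%:Z.
    by apply/dvdzP; rewrite dvdzE /= pdiv_dvd.
  have l0 : (pdiv `|n|)%:R != 0 :> algC by rewrite pnatr_eq0 -lt0n prime_gt0.
  have m0 : m%:~R != 0 :> algC.
    by rewrite intr_eq0; apply: contraNneq n0 => m0; rewrite Dn m0 mul0r.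
  have := Hv v V; rewrite Dn intrM -[(Posz _)%:~R]/((pdiv `|n|)%:R) (valM V) //; try (by insf).
  have := vgeE m0 (vge_int SK0 V m); move: vl; move: (v _) (v _) => a b; clear; lia.
have q0 : q != 0 by apply: contraNneq N0 => q0; rewrite -Dq q0 rmorph0.
have d0 : (denq q)%:~R != 0 :> algC by rewrite intr_eq0 denq_neq0.
have nq0 : (numq q)%:~R != 0 :> algC by rewrite intr_eq0 numq_eq0.
have vq v : val k0 v -> v (numq q)%:~R = v (denq q)%:~R.
  move=> V; have kn : k0 (numq q)%:~R by insf. have kd : k0 (denq q)%:~R by insf.
  by have /eqP := vN v V; rewrite -Dq /ratr (val_div SK0 V) // subr_eq0 => /eqP.
have cop l : prime l -> ~~ (l %| numq q)%Z \/ ~~ (l %| denq q)%Z.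
  move=> pr; have := coprime_num_den q; case: (boolP (l %| numq q)%Z) => dn; last by left.
  case: (boolP (l %| denq q)%Z) => dd; last by right.
  move: dn dd; rewrite !dvdzE /= => dn dd /eqP cp.
  have : (l %| gcdn `|numq q| `|denq q|)%N by rewrite dvdn_gcd dn dd.
  by rewrite cp dvdn1 => /eqP l1; move: pr; rewrite l1.
have vz v : val k0 v -> v (numq q)%:~R = 0 /\ v (denq q)%:~R = 0.
  move=> V; have [l pr vl] := val_prime NK0 V.
  by case: (cop l pr) => nd; have := val_int0 SK0 V pr vl nd; have := vq v V => e e'; rewrite ?e' -?e ?e'; split; rewrite // -e' e.
have n1 : (`|numq q| = 1)%N by apply: num1; rewrite ?numq_eq0 // => v /vz[].
have d1 : denq q = 1.
  have := num1 (denq q) (denq_neq0 q) (fun v V => (vz v V).2).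
  by have := denq_gt0 q; case: (denq q) => // k _ /= ->.
rewrite -Dq /ratr d1 divr1; case: (numq q) n1 => k /=; first by move=> ->; left.
by case: k => // _; right.
Qed.

(** [T I = g I] forces [g] to have norm 1 or -1. A factor [eps], of norm -1, corrects the sign, and
    Hilbert 90 gives [g' = r * z ^+ 2]. Then [z I], made integral by [m], is stable under [tau]. *)
Lemma ambiguous_principal I : nonzero_ideal O I -> ideal_equiv O (T I) I -> ideal_equiv O O I.
Proof.
move=> NI [a [b [Oa Ob a0 b0 e]]]; have [ka _] := Oa; have [kb _] := Ob; have [II _] := NI.
pose g := b / a; have g0 : g != 0 by rewrite mulf_neq0 ?invr_eq0.
have kg : k0 g by rewrite /g; insf.
have eg : T I = scale g I.
  transitivity (scale (a^-1 * a) (T I)); first by rewrite mulVf // scale1.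
  by rewrite (scaleM a^-1 a) e -(scaleM a^-1 b) mulrC.
have eN : scale (g * tau g) I = I.
  by rewrite -{2}(tau_idealK NI) eg tau_scale eg -(scaleM (tau g) g) mulrC.
have QN := norm_Q kg.
have ke := eps_k0; have e0 := eps_neq0; have ue := eps_unit.
have [g' [kg' g'0 eg' N1]] : exists g', [/\ k0 g', g' != 0, T I = scale g' I & g' * tau g' = 1 ^+ 2].
  have [N1|N1] := rational_scale_unit QN NI eN; first by exists g; rewrite expr1n.
  exists (g * eps); split; [by insf | exact: mulf_neq0 | |].
    by rewrite (scaleM g eps) scale_unit.
  by rewrite (rmorphM tau g) mulrACA N1 norm_eps mulrNN !expr1n mulr1.
have [r [z [Qr r0 kz z0 Dg]]] := norm_square kg' (sf1 SQ) (oner_neq0 _) N1.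
have tz0 : tau z != 0 by rewrite fmorph_eq0.
have [m m0 Oz] := numfield_frac NK0 kz; set c := m%:~R * z in Oz.
have mC : m%:~R != 0 :> algC by rewrite intr_eq0.
have c0 : c != 0 by rewrite mulf_neq0.
have [IO I0 ID IM] := II.
have NJ : nonzero_ideal O (scale c I).
  split; last by have [x Ix x0] := NI.2; exists (c * x); [exists x | rewrite mulf_neq0].
  split=> [_ [x Ix <-]||_ _ [x Ix <-] [y Iy <-]|s _ Os [x Ix <-]].
  - by have Ox := IO _ Ix; inri.
  - by exists 0; rewrite ?mulr0.
  - by exists (x + y); [exact: ID | rewrite mulrDr].
  - by exists (s * x); [exact: IM | rewrite mulrCA].
have rN : (r * (z * tau z)) ^+ 2 = 1.
  by move: N1; rewrite Dg rmorphM rmorphXn /= (tauQ Qr) expr1n => <-; ring.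
have st x : scale c I x -> scale c I (tau x).
  move=> [y Iy <-]; have : (T I) (tau y) by exists y.
  rewrite eg' => -[y' Iy' Dy']; rewrite rmorphM /c rmorphM rmorph_int /= -Dy' Dg.
  have -> : m%:~R * tau z * (r * z ^+ 2 * y') = m%:~R * z * (r * (z * tau z) * y') by ring.
  exists (r * (z * tau z) * y') => //; move: rN => /eqP.
  rewrite sqrf_eq1 => /orP[] /eqP ->; first by rewrite mul1r.
  by apply: IM => //; inri.
apply: (equiv_trans SK0 (stable_ideal_principal NJ st)).
exists 1, c; split; rewrite ?oner_neq0 //; first by inri.
exact: scale1.
Qed.

(* Conjugation is an involution on the ideal classes whose only fixed point is
   the principal class. *)
Lemma class_number_odd h : class_number k0 h -> odd h.
Proof.
move=> /card_set_bijP[f [fC finj fsurj]].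
have NO : nonzero_ideal O O.
  by split; [exact: ideal_O | exists 1; rewrite ?oner_neq0 //; inri].
pose s (c : set (set algC)) : set (set algC) := [set T J | J in c].
have sE I : nonzero_ideal O I -> s (ideal_class O I) = ideal_class O (T I).
  move=> NI; apply/seteqP; split=> [_ [J [NJ eJ] <-]|J [NJ eJ]].
    by split; [exact: tau_ideal | exact: tau_equiv].
  exists (T J); last exact: tau_idealK.
  by split; [exact: tau_ideal | rewrite -(tau_idealK NI); exact: tau_equiv].
pose C := ideal_classes O.
have sC c : C c -> C (s c).
  by move=> [I NI <-]; rewrite sE //; exists (T I) => //; exact: tau_ideal.
have sK c : C c -> s (s c) = c.
  move=> [I NI <-]; rewrite sE // sE ?tau_idealK //; exact: tau_ideal.
have CO : C (ideal_class O O) by exists O.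
have TO : T O = O.
  apply/seteqP; split=> [_ [x Ox <-]|x Ox]; first exact: tauO.
  by exists (tau x); [exact: tauO | rewrite tauK //; case: Ox].
have fixC c : C c -> s c = c -> c = ideal_class O O.
  move=> [I NI <-]; rewrite sE // => /(ideal_class_eq SK0 (tau_ideal NI) NI) e.
  by apply/esym/(ideal_class_eq SK0 NO NI); exact: ambiguous_principal.
have ex_g (i : 'I_h) : exists c, C c /\ f c = i.
  by have [c Cc <-] := fsurj i (ltn_ord i); exists c.
have [g Hg] := choice ex_g.
have lt c : C c -> (f c < h)%N by move=> Cc; exact: fC.
pose s' (i : 'I_h) : 'I_h := Ordinal (lt _ (sC _ (Hg i).1)).
have gs i : g (s' i) = s (g i).
  apply: finj; rewrite ?inE; [exact: (Hg _).1 | exact: sC (Hg _).1 |].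
  by rewrite (Hg _).2.
apply: (@odd_card_involution h s' (Ordinal (lt _ CO))).
  by move=> i; apply: val_inj; rewrite /= gs sK ?(Hg _).2 //; exact: (Hg _).1.
move=> i; split=> [e|->].
  apply: val_inj; rewrite /= -(Hg i).2; congr (f _).
  by apply: fixC; [exact: (Hg _).1 | rewrite -gs e].
apply: val_inj => /=; congr (f _).
have -> : g (Ordinal (lt _ CO)) = ideal_class O O.
  by apply: finj; rewrite ?inE; [exact: (Hg _).1 | exact: CO | rewrite (Hg _).2].
by rewrite sE // TO.
Qed.

(** * The quartic field K over k0 *)

Variable a : nat.
Hypothesis a_gt0 : (0 < a)%N.
Let e0 := eps_neq0.
Let ke := eps_k0.

Definition quartic_gen : algC := - (a%:R * eps * sp).
Local Notation beta := quartic_gen.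
Definition quartic_root : algC := sqrtC beta.
Local Notation rb := quartic_root.
Definition quartic : set algC := Qadjoin [set rb].
Local Notation K := quartic.

Lemma aC : 0 < (a%:R : algC). Proof. by rewrite ltr0n. Qed.

Lemma rb2 : rb ^+ 2 = beta. Proof. exact: sqrtCK. Qed.

Lemma beta_k0 : k0 beta. Proof. by rewrite /beta; insf. Qed.

Lemma beta_lt0 : beta < 0.
Proof. by rewrite /beta oppr_lt0 !mulr_gt0 ?aC ?eps_gt0 ?sp_gt0. Qed.

Lemma tau_beta_lt0 : tau beta < 0.
Proof.
rewrite /beta rmorphN !rmorphM rmorph_nat /= tau_eps tau_sp.
have -> : - (a%:R * - eps^-1 * - sp) = - (a%:R * eps^-1 * sp) by rewrite mulrN mulrN mulNr opprK.
by rewrite oppr_lt0 !mulr_gt0 ?aC ?invr_gt0 ?eps_gt0 ?sp_gt0.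
Qed.

Lemma beta_neq0 : beta != 0. Proof. exact: ltr0_neq0 beta_lt0. Qed.
Lemma rb_neq0 : rb != 0. Proof. by rewrite sqrtC_eq0 beta_neq0. Qed.

Lemma sf_K : subfield K. Proof. exact: subfield_adjoin. Qed.
Lemma K_rb : K rb. Proof. exact: adjoin_subr. Qed.

Lemma nf_K : numfield K.
Proof.
have -> : K = Qadjoin [set` [:: rb]]; last exact: numfield_Qadjoin_seq.
by rewrite /K; congr Qadjoin; apply/seteqP; split=> x /=; rewrite inE => /eqP.
Qed.

(** [t != 0] is what allows sqrt p to be recovered from the square of [rb]; it holds because
    [tau eps = - eps] would give [eps ^+ 2 = 1]. *)
Lemma eps_form : exists t u : int, [/\ 2%:R * eps = t%:~R + u%:~R * sp, t != 0 &
  2%:R * tau eps = t%:~R - u%:~R * sp].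
Proof.
have [t [u De]] := ri_form eps_ri; exists t, u; split=> //.
  apply/eqP => t0; have te := tau_eps.
  have Qu : QQ u%:~R by insf. have Q0 : QQ 0 by insf.
  have := tau_form Q0 Qu; rewrite add0r sub0r.
  have <- : 2%:R * eps = u%:~R * sp by rewrite De t0 add0r.
  rewrite rmorphM rmorph_nat te mulrN => /oppr_inj /mulfI; rewrite pnatr_eq0 => /(_ isT) e.
  have [_ e1 _] := fu; have : eps ^+ 2 = 1 by rewrite expr2 -{1}e mulVf.
  move=> e2; have : 1 < eps ^+ 2 by rewrite exprn_egt1.
  by rewrite e2 ltxx.
have Qt : QQ t%:~R by insf. have Qu : QQ u%:~R by insf.
by rewrite -(tau_form Qt Qu) -De rmorphM rmorph_nat.
Qed.

Lemma K_k0 : k0 `<=` K.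
Proof.
have SK := sf_K; have Kr := K_rb.
suff Kp : K sp by apply: adjoin_min => // x /= ->.
have [t [u [De t0 _]]] := eps_form.
have aC0 : a%:R != 0 :> algC by rewrite pnatr_eq0 -lt0n.
have tC : t%:~R != 0 :> algC by rewrite intr_eq0.
have K2 : K (rb ^+ 2) by insf.
have -> : sp = (- (2%:R * rb ^+ 2 / a%:R) - u%:~R * p%:R) / t%:~R.
  have -> : 2%:R * rb ^+ 2 = - a%:R * (2%:R * eps) * sp by rewrite rb2 /beta; ring.
  rewrite De; move: (sp) sp2 => S <-; field; by rewrite aC0 tC.
by insf.
Qed.

Let SK := sf_K.
Let Kr := K_rb.
Let k_beta := beta_k0.

Lemma K_adjoin : K = adjoin k0 [set rb].
Proof.
apply/seteqP; split; apply: adjoin_min => //.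
- exact: subfield_adjoin.
- exact: adjoin_subr.
- exact: K_k0.
- by move=> _ ->; exact: K_rb.
Qed.

Lemma K_span x : K x -> exists X Y, [/\ k0 X, k0 Y & x = X + Y * rb].
Proof.
rewrite K_adjoin; apply: quad_span => //.
by rewrite rb2; exact: beta_k0.
Qed.

Lemma k0_conj X : k0 X -> X^* = X.
Proof. by move=> /k0_real/conj_Creal. Qed.

(** As [beta] is negative, complex conjugation is the nontrivial automorphism of K over k0, and it
    is used as such from here on. *)
Lemma rb_conj : rb^* = - rb.
Proof.
have : rb^* ^+ 2 == rb ^+ 2 by rewrite -rmorphXn /= rb2 k0_conj //; exact: beta_k0.
rewrite eqf_sqr => /orP[/eqP e|/eqP //].
have rr : rb \is Num.real by apply/CrealP.
have := real_exprn_even_ge0 rr (isT : ~~ odd 2); rewrite rb2 => /le_lt_trans/(_ beta_lt0).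
by rewrite ltxx.
Qed.

Lemma K_conj x : K x -> K x^*.
Proof.
move=> /K_span[X [Y [kX kY ->]]]; rewrite rmorphD rmorphM /= (k0_conj kX) (k0_conj kY) rb_conj.
by have KX := K_k0 kX; have KY := K_k0 kY; insf.
Qed.

(** The norm is [X ^+ 2 - beta * Y ^+ 2], and [beta] is negative under both embeddings of k0. *)
Lemma norm_K x : K x -> x != 0 -> [/\ k0 (x * x^*), 0 < x * x^* & 0 < tau (x * x^*)].
Proof.
move=> Kx x0; have [X [Y [kX kY Dx]]] := K_span Kx.
have DN : x * x^* = X ^+ 2 - beta * Y ^+ 2.
  by rewrite -rb2 Dx rmorphD rmorphM /= (k0_conj kX) (k0_conj kY) rb_conj; ring.
have kX' := tau_k0 kX; have kY' := tau_k0 kY.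
have pos b U W : b < 0 -> k0 U -> k0 W -> (U != 0) || (W != 0) -> 0 < U ^+ 2 - b * W ^+ 2.
  move=> b0 kU kW nz; have nb : 0 < - b by rewrite oppr_gt0.
  have U2 : 0 <= U ^+ 2 by rewrite real_exprn_even_ge0 ?k0_real.
  have W2 : 0 <= W ^+ 2 by rewrite real_exprn_even_ge0 ?k0_real.
  rewrite -mulNr; case/orP: nz => nz.
    have U2' : 0 < U ^+ 2 by rewrite lt_def sqrf_eq0 nz.
    by apply: ltr_wpDr => //; apply: mulr_ge0 => //; exact: ltW.
  have W2' : 0 < W ^+ 2 by rewrite lt_def sqrf_eq0 nz.
  by apply: ltr_wpDl => //; exact: mulr_gt0.
have nz : (X != 0) || (Y != 0).
  by apply: contraNT x0; rewrite negb_or !negbK Dx => /andP[/eqP -> /eqP ->]; rewrite mul0r addr0.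
rewrite DN; split; first by insf.
  exact: pos beta_lt0 kX kY nz.
rewrite rmorphB (rmorphM tau beta) !rmorphXn /=; apply: pos => //; first exact: tau_beta_lt0.
by rewrite !fmorph_eq0.
Qed.

(** The condition at the infinite places is vacuous for K: the square of [s rb] is [beta] or
    [tau beta], both negative. *)
Lemma totally_imaginary L (s : algC -> algC) : subfield L -> K `<=` L -> embedding L s ->
  ~ (forall x, K x -> s x \is Num.real).
Proof.
move=> SL sKL Es Hs.
have Lr : L rb by apply: sKL.
have k0L X : k0 X -> L X by move=> /K_k0 /sKL.
have : 0 <= s rb ^+ 2 by rewrite real_exprn_even_ge0 // Hs.
rewrite -(embX SL Es) // rb2.
have Lsp := k0L _ Ksp.
have form u t : QQ u -> QQ t -> s (u + t * sp) = u + t * s sp.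
  move=> [q _ <-] [q' _ <-]; have Lq' : L (ratr q') by insf. have Lq : L (ratr q) by insf.
  have Lqs : L (ratr q' * sp) by insf.
  by rewrite (embD Es) // (embM Es) // !(emb_rat SL Es).
have : s sp = sp \/ s sp = - sp.
  have /eqP : s sp ^+ 2 = sp ^+ 2 by rewrite -(embX SL Es) // sp2 (emb_nat SL Es).
  by rewrite eqf_sqr => /orP[] /eqP ?; [left | right].
have [u [t [Qu Qt Db]]] := (k0P beta).1 beta_k0.
case=> e; rewrite Db form // e.
  by rewrite -Db => /le_lt_trans/(_ beta_lt0); rewrite ltxx.
by rewrite mulrN -tau_form // -Db => /le_lt_trans/(_ tau_beta_lt0); rewrite ltxx.
Qed.

(* w(s z) and w((s z)^2 - 1) express that d z^2 is a unit at w, and a square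
   modulo 4 if w lies above 2. *)
Lemma sqrt_unramified s : K (s ^+ 2) -> s != 0 ->
  (forall w, val (adjoin K [set s]) w -> exists z, [/\ K z, z != 0 &
     (w 2%:R = 0 /\ w (s * z) = 0) \/
     (0 < w 2%:R /\ vge w (2%:Z * w 2%:R) ((s * z) ^+ 2 - 1))]) ->
  unramified_abelian_extension K (adjoin K [set s]).
Proof.
move=> Ks2 s0 Hw; have NK := nf_K; have NL := quad_numfield s NK; have SL := NL.1.
have sKL : K `<=` adjoin K [set s] by apply: adjoin_subl.
have Ls : adjoin K [set s] s by apply: adjoin_subr.
split; first exact: quad_abelian.
- apply: unramified_of_unr => // w W; have [z [Kz z0 cond]] := Hw w W.
  have Lsz : adjoin K [set s] (s * z) by have := sKL _ Kz; move=> ?; insf.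
  apply: (@quad_unr K (adjoin K [set s]) (s * z) w) => //.
  + by rewrite exprMn; insf.
  + move=> x /(quad_span NK Ks2)[u [t [Ku Kt ->]]]; exists u, (t / z); split => //; first by insf.
    by rewrite [s * z]mulrC mulrA divfK.
  + by rewrite mulf_neq0.
- by move=> g Eg Hg; case: (totally_imaginary SL sKL Eg Hg).
Qed.

(** * Square roots that are unramified over K *)

Hypothesis co_ap : coprime a p.
Let NK := nf_K.
Let r0 : rb != 0 := rb_neq0.

Section Local.
Variables (M : set algC) (w : algC -> int) (l : nat).
Hypotheses (NM : numfield M) (sKM : K `<=` M) (W : val M w) (pr_l : prime l) (wl : 0 < w l%:R).
Let SM := NM.1.
Let k0M x : k0 x -> M x. Proof. by move=> /K_k0 /sKM. Qed.

Lemma w_nat0 (n : nat) : ~~ (l %| n)%N -> w n%:R = 0.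
Proof. exact: (val_nat0 SM W pr_l wl). Qed.

Lemma w_k0 X : l != p -> k0 X -> X != 0 -> exists k : int, w X = k * w l%:R.
Proof.
move=> lp kX X0; have [v [e [V e_gt0 He]]] := val_restrict_exists NK0 NM (@k0M) W.
have l0 : l%:R != 0 :> algC by rewrite pnatr_eq0 -lt0n prime_gt0.
have kl : k0 l%:R by insf.
have vl : 0 < v l%:R by move: wl; rewrite He // pmulr_rgt0.
by exists (v X); rewrite !He // (val_l1 V pr_l lp vl) mulr1 mulrC.
Qed.

Lemma w_eps : w eps = 0.
Proof.
have [_ [_ /= Ae] [_ /= Ai]] := eps_unit.
have Me : M eps by apply: k0M.
have Mi : M eps^-1 by insf.
have := vgeE e0 (vge_ri SM W (conj Me Ae)); have := vgeE (invr_neq0 e0) (vge_ri SM W (conj Mi Ai)).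
by rewrite (val_V SM W) //; lia.
Qed.

Lemma w_sp : w p%:R = 2 * w sp.
Proof. by have := val_X SM W 2 (k0M Ksp) sp0; rewrite sp2. Qed.

Lemma w_sp0 : l != p -> w sp = 0.
Proof.
move=> lp; have := w_sp; rewrite w_nat0; first by lia.
by rewrite dvdn_prime2.
Qed.

Lemma w_rb : 2 * w rb = w a%:R + w sp.
Proof.
have Mr : M rb by apply: sKM.
have aC : a%:R != 0 :> algC by rewrite pnatr_eq0 -lt0n.
have Me : M eps by apply: k0M. have Ma : M a%:R by insf. have Ms : M sp by apply: k0M.
have -> : 2 * w rb = w (rb ^+ 2) by rewrite (val_X SM W).
have Mae : M (a%:R * eps) by insf. have Maes : M (a%:R * eps * sp) by insf.
rewrite rb2 /quartic_gen (val_N SM W) ?mulf_neq0 // (valM W) ?mulf_neq0 // (valM W) // w_eps.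
by rewrite addr0.
Qed.

Lemma sq_unit1 d : w d = 0 -> sq_unit K w d.
Proof. by move=> wd; exists 1; split; rewrite ?oner_neq0 ?expr1n ?mulr1 //; insf. Qed.

Lemma sq_unit_rb d (k : int) : K d -> d != 0 -> w d = 2 * k * w rb -> sq_unit K w d.
Proof.
move=> Kd d0 wd; have Mr : M rb by apply: sKM.
exists (rb ^ (- k)); split; [by insf | exact: expfz_neq0 |].
have Md : M d by apply: sKM. have Mrk : M (rb ^ (- k)) by insf.
have rk0 : rb ^ (- k) != 0 by rewrite expfz_neq0.
have Mrk2 : M ((rb ^ (- k)) ^+ 2) by insf.
rewrite (valM W) ?expf_neq0 // (val_X SM W 2 Mrk rk0) (val_Xz SM W (- k) Mr r0) wd.
by move: (w rb) => c; ring.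
Qed.

Lemma sq4_mod4 d z y : K z -> z != 0 -> l = 2%N -> O y -> d * z ^+ 2 = 1 + 4%:R * y -> sq4 K w d.
Proof.
move=> Kz z0 l2 Oy e; exists z; split => //; rewrite e addrAC subrr add0r.
have [ky Ay] := Oy; have My := k0M ky.
have M4 : M 4%:R by insf. have M2 : M 2%:R by insf.
apply: (vgeMr W) => //; last by apply: (vge_ri SM W); split.
right; have -> : 4%:R = 2%:R ^+ 2 :> algC by ring.
by rewrite (val_X SM W) // pnatr_eq0.
Qed.

End Local.

(** [M] ranges over all number fields above K: the lower bound applies this to K(sqrt d), the upper
    bound to an unramified [M] given in advance. *)
Definition locally_good d := forall M w l, numfield M -> K `<=` M -> val M w -> prime l -> 0 < w l%:R ->
  (l = 2%N -> sq4 K w d) /\ (l <> 2%N -> sq_unit K w d).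

Lemma unram_of_locally_good d : K d -> d != 0 -> locally_good d ->
  unramified_abelian_extension K (adjoin K [set sqrtC d]).
Proof.
move=> Kd d0 gd; apply: sqrt_unramified.
- by rewrite sqrtCK.
- by rewrite sqrtC_eq0.
have NM : numfield (adjoin K [set sqrtC d]) := quad_numfield _ NK.
have sKM : K `<=` adjoin K [set sqrtC d] by apply: adjoin_subl.
move=> w W; have [l pr_l wl] := val_prime NM W; have SM := NM.1.
have [g2 g1] := gd _ w l NM sKM W pr_l wl.
have Ms : adjoin K [set sqrtC d] (sqrtC d) by apply: adjoin_subr.
have [l2|/eqP l2] := eqVneq l 2%N.
  have [z [Kz z0 vz]] := g2 l2; exists z; split=> //; right; split; first by rewrite l2 in wl.
  by rewrite exprMn sqrtCK.
have [z [Kz z0 vz]] := g1 l2; exists z; split => //; left.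
split; first by apply: (w_nat0 NM W pr_l wl); rewrite dvdn_prime2 //; apply/eqP.
have Mz := sKM _ Kz; have Msz : adjoin K [set sqrtC d] (sqrtC d * z) by insf.
have := val_X SM W 2 Msz; rewrite mulf_neq0 ?sqrtC_eq0 // => /(_ isT).
by rewrite exprMn sqrtCK vz; move: (w _) => c; lia.
Qed.

Lemma q_starE q : odd q -> exists k : int, q_star q = (4 * k + 1)%:~R.
Proof.
move=> oq; have Dq : q = (2 * (q.-1)./2 + 1)%N by move: oq; clear; lia.
have [k Dk] := sign_mod4 (q.-1)./2; exists k; rewrite -Dk intrM /q_star -Dq.
by rewrite rmorphXn rmorphN1.
Qed.

Section Ramified.
Variable (q : nat).
Hypotheses (pr_q : prime q) (qa : (q %| a)%N) (q2a : ~~ (q ^ 2 %| a)%N) (oq : odd q).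

Lemma q_neq_p : q != p.
Proof.
apply: contraTneq co_ap => e; rewrite /coprime -e; apply: contraTN (prime_gt1 pr_q) => /eqP g1.
have : (q %| gcdn a q)%N by rewrite dvdn_gcd qa dvdnn.
by rewrite g1 dvdn1 => /eqP ->.
Qed.

Section Local.
Variables (M : set algC) (w : algC -> int).
Hypotheses (NM : numfield M) (sKM : K `<=` M) (W : val M w) (wq : 0 < w q%:R).
Let SM := NM.1.

Lemma w_a_q : w a%:R = w q%:R.
Proof.
have /dvdnP[a' Da] := qa; have nd : ~~ (q %| a')%N.
  by apply: contraNN q2a => /dvdnP[a'' Da']; rewrite Da Da' -mulnA mulnn dvdn_mull.
have a'0 : a'%:R != 0 :> algC.
  by rewrite pnatr_eq0; apply: contraTneq a_gt0 => e; rewrite Da e.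
have q0 : q%:R != 0 :> algC by rewrite pnatr_eq0 -lt0n prime_gt0.
rewrite Da natrM (valM W) ?(w_nat0 NM W pr_q wq nd) ?add0r //; have := SM => ?; insf.
Qed.

Lemma w_rb_q : 2 * w rb = w q%:R.
Proof.
by rewrite (w_rb NM sKM W pr_q wq) w_a_q (w_sp0 NM sKM W pr_q wq) ?addr0 //; exact: q_neq_p.
Qed.

(** Since [q] ramifies in K over k0 ([w_rb_q]), the values of k0 are even multiples of [w rb], and a
    power of [rb ^+ 2] turns [d] into a unit. *)
Lemma sq_unit_k0_q d : k0 d -> d != 0 -> sq_unit K w d.
Proof.
move=> kd d0; have [k e] := w_k0 NM sKM W pr_q wq q_neq_p kd d0.
apply: (sq_unit_rb NM sKM W (k := k)) => //; first exact: K_k0.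
by rewrite e -w_rb_q; move: (w rb) => c; ring.
Qed.

End Local.

Lemma locally_good_q_star : locally_good (q_star q).
Proof.
move=> M w l NM sKM W pr_l wl; have [k Dk] := q_starE oq.
split=> [l2|/eqP l2].
  apply: (@sq4_mod4 M w l NM sKM W _ 1 k%:~R) => //; try (by insf).
  - by rewrite oner_neq0.
  - by inri.
  - by rewrite Dk intrD intrM; ring.
have q0 : q%:R != 0 :> algC by rewrite pnatr_eq0 -lt0n prime_gt0.
have [lq|lq] := eqVneq l q.
  subst l; apply: (sq_unit_k0_q NM sKM W wl); first by rewrite Dk; insf.
  by rewrite /q_star mulf_neq0 // expf_neq0 // oppr_eq0 oner_neq0.
apply: sq_unit1; rewrite Dk; apply: (val_int0 NM.1 W pr_l wl).
have : ~~ (l %| q)%N by rewrite dvdn_prime2.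
apply: contraNN; have : (4 * k + 1) = q \/ (4 * k + 1) = - q%:Z.
  have := Dk; rewrite /q_star -signr_odd; case: (odd _); rewrite ?expr0 ?expr1 ?mul1r ?mulN1r => /esym e.
    by right; apply: (@intr_inj algC); rewrite e mulrNz.
  by left; apply: (@intr_inj algC); rewrite e.
by case=> ->; rewrite !dvdzE //= abszN.
Qed.

Section Alpha.
Variables (h x y : nat).
Hypothesis norm_xy : x%:Z ^+ 2 - p%:Z * y%:Z ^+ 2 = q%:Z ^+ (3 * h).
Hypothesis par1 : (q %% 4 = 1)%N -> odd x /\ ~~ odd y.
Hypothesis par3 : (q %% 4 = 3)%N -> ~~ odd x /\ odd y.

Lemma alpha_k0 : k0 (alpha p x y). Proof. by rewrite /alpha; insf. Qed.
Lemma alpha_ri : O (alpha p x y).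
Proof. by rewrite /alpha; have ? := sp_ri; inri. Qed.

Lemma alpha_norm : alpha p x y * tau (alpha p x y) = q%:R ^+ (3 * h).
Proof.
rewrite /alpha rmorphD rmorphM !rmorph_nat /= tau_sp.
have := congr1 (fun z : int => z%:~R : algC) norm_xy; rewrite /= intrB intrM !rmorphXn /=.
rewrite -![(_%:Z)%:~R]/(_%:R) => <-.
by move: (sp) sp2 => S <-; ring.
Qed.

Lemma alpha_neq0 : alpha p x y != 0.
Proof.
have : q%:R ^+ (3 * h) != 0 :> algC by rewrite expf_neq0 // pnatr_eq0 -lt0n prime_gt0.
by rewrite -alpha_norm; apply: contraNneq => ->; rewrite mul0r.
Qed.

Lemma alpha_starE : exists b c : bool, alpha_star p q x y = (-1) ^+ b * alpha p x y * sp ^+ c.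
Proof.
rewrite /alpha_star; exists (odd (x + y).-1./2), (q %% 4 != 1)%N; rewrite signr_odd.
by case: eqP => _; rewrite ?expr0 ?expr1 ?mulr1.
Qed.

(** Substituting [sp = 2 * omega - 1], [alpha] becomes [x + y] plus a multiple of [2 * y], and
    [alpha * sp], as [p] is 1 modulo 4, becomes [x + y] plus a multiple of [2 * x] modulo 4. In each
    case the coefficient concerned is even, and the sign makes [x + y] congruent to 1 modulo 4. *)
Lemma alpha_star_mod4 : exists2 Y, O Y & alpha_star p q x y = 1 + 4%:R * Y.
Proof.
have [pE _] := c4E.
have eps4 : (q %% 4 = 1 \/ q %% 4 = 3)%N by move: oq; clear; lia.
have oxy : odd (x + y) by case: eps4 => [/par1|/par3] [ox oy]; rewrite oddD ?ox ?oy ?(negPf ox) ?(negPf oy).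
have [k Dk] := sign_mod4 (x + y).-1./2.
have Dxy : ((2 * (x + y).-1./2 + 1) = x + y)%N by move: oxy; clear; lia.
rewrite Dxy in Dk; set sg := (x + y).-1./2 in Dk.
have Dk' : (-1) ^+ sg * (x%:R + y%:R) = 4%:R * k%:~R + 1 :> algC.
  have := congr1 (fun z : int => z%:~R : algC) Dk; rewrite /= intrM intrD intrM rmorphXn rmorphN1.
  by rewrite -[(Posz _)%:~R]/((x + y)%:R) natrD.
rewrite /alpha_star -/sg; case: eps4 => q4; rewrite q4 /=.
  have [_ ey] := par1 q4; have Dy : y = (2 * y./2)%N by move: ey; clear; lia.
  exists (k%:~R + (-1) ^+ sg * y./2%:R * (omega - 1)); first by inri.
  transitivity ((-1) ^+ sg * (x%:R + y%:R * (2%:R * omega - 1))).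
    by congr (_ * (_ + _ * _)); exact: sp_omega.
  have -> : (-1) ^+ sg * (x%:R + y%:R * (2%:R * omega - 1)) =
    (-1) ^+ sg * (x%:R + y%:R) + (-1) ^+ sg * y%:R * 2%:R * (omega - 1) by ring.
  by rewrite Dk' {1}Dy natrM; ring.
have [ex _] := par3 q4; have Dx : x = (2 * x./2)%N by move: ex; clear; lia.
exists (k%:~R + (-1) ^+ sg * (x./2%:R * (omega - 1) + y%:R * c4%:R)); first by inri.
have -> : (-1) ^+ sg * alpha p x y * sp = (-1) ^+ sg * (x%:R * sp + y%:R * p%:R).
  by rewrite /alpha; move: (sp) sp2 => S <-; ring.
have pC : p%:R = 4%:R * c4%:R + 1 :> algC by rewrite {1}pE natrD natrM.
transitivity ((-1) ^+ sg * (x%:R * (2%:R * omega - 1) + y%:R * (4%:R * c4%:R + 1))).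
    by congr (_ * (_ * _ + _ * _)); [exact: sp_omega | exact: pC].
have -> : (-1) ^+ sg * (x%:R * (2%:R * omega - 1) + y%:R * (4%:R * c4%:R + 1)) =
  (-1) ^+ sg * (x%:R + y%:R) + (-1) ^+ sg * (x%:R * 2%:R * (omega - 1) + 4%:R * y%:R * c4%:R) by ring.
by rewrite Dk' {1}Dx natrM; ring.
Qed.

(** Away from [q], [alpha] is a unit because its norm is; above [p], the remaining factor [sp] has
    the value of [rb ^+ 2]; above [q], [sq_unit_k0_q] covers all of k0. *)
Lemma locally_good_alpha_star : locally_good (alpha_star p q x y).
Proof.
move=> M w l NM sKM W pr_l wl; have SM := NM.1.
have k0M z : k0 z -> M z by move=> /K_k0 /sKM.
have [b [c Da]] := alpha_starE.
have ka : k0 (alpha_star p q x y) by rewrite Da; have ? := alpha_k0; insf.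
have a0 : alpha_star p q x y != 0.
  by rewrite Da !mulf_neq0 ?alpha_neq0 ?expf_neq0 // oppr_eq0 oner_neq0.
split=> [l2|/eqP l2].
  have [Y OY e] := alpha_star_mod4.
  apply: (@sq4_mod4 M w l NM sKM W _ 1 Y) => //; try (by insf).
  - by rewrite oner_neq0.
  - by rewrite expr1n mulr1.
have [lq|lq] := eqVneq l q; first by subst l; apply: (sq_unit_k0_q NM sKM W wl).
have wq : w q%:R = 0 by apply: (w_nat0 NM W pr_l wl); rewrite dvdn_prime2.
have al0 := alpha_neq0; have tal0 : tau (alpha p x y) != 0 by rewrite fmorph_eq0.
have [kal Aal] := alpha_ri; have [ktal Atal] := tau_ri alpha_ri.
have Mal := k0M _ kal; have Mtal := k0M _ ktal.
have wal : w (alpha p x y) = 0.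
  have := vgeE al0 (vge_ri SM W (conj Mal Aal)); have := vgeE tal0 (vge_ri SM W (conj Mtal Atal)).
  have : w (alpha p x y) + w (tau (alpha p x y)) = 0.
    by rewrite -(valM W) // alpha_norm (val_X SM W) ?wq ?mulr0 // ?pnatr_eq0 -?lt0n ?prime_gt0 //; insf.
  by move: (w (alpha _ _ _)) (w (tau _)) => i j; clear; lia.
have Msp := k0M _ Ksp; have Mspc : M (sp ^+ c) by insf.
have wa : w (alpha_star p q x y) = c%:Z * w sp.
  have Mb : M ((-1) ^+ b) by insf. have Mba : M ((-1) ^+ b * alpha p x y) by insf.
  have b0 : (-1) ^+ b != 0 :> algC by rewrite expf_neq0 // oppr_eq0 oner_neq0.
  have wb : w ((-1) ^+ b) = 0.
    by case: (b); rewrite ?expr1 ?(val_N SM W) ?oner_neq0 ?(val_1 SM W) //; insf.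
  have ba0 : (-1) ^+ b * alpha p x y != 0 by rewrite mulf_neq0.
  have spc0 : sp ^+ c != 0 by rewrite expf_neq0.
  rewrite Da (valM W) // (valM W) // wb wal !add0r.
  by rewrite (val_X SM W).
have [lp|lp] := eqVneq l p; last first.
  by apply: sq_unit1; rewrite wa (w_sp0 NM sKM W pr_l wl lp) mulr0.
have wra : 2 * w rb = w sp.
  rewrite (w_rb NM sKM W pr_l wl) (w_nat0 NM W pr_l wl) ?add0r // lp.
  by rewrite -prime_coprime // coprime_sym.
apply: (sq_unit_rb NM sKM W (k := c%:Z)) => //; first exact: K_k0.
by rewrite wa -wra; move: (w rb) => i; ring.
Qed.

End Alpha.
End Ramified.

Lemma locally_good_case d z : d = 1 \/ d = -1 \/ d = 2%:R \/ d = -2%:R ->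
  K z -> z != 0 -> (exists2 Y, O Y & d * z ^+ 2 = 1 + 4%:R * Y) -> locally_good d.
Proof.
move=> Hd Kz z0 [Y OY e] M w l NM sKM W pr_l wl; have SM := NM.1.
split=> [l2|/eqP l2]; first exact: (@sq4_mod4 M w l NM sKM W d z Y).
have w2 : w 2%:R = 0 by apply: (w_nat0 NM W pr_l wl); rewrite dvdn_prime2.
have M1 : M 1 by insf. have M2 : M 2%:R by insf.
apply: sq_unit1; case: Hd => [->|[->|[->|->]]];
  by rewrite ?(val_N SM W) ?oner_neq0 ?pnatr_eq0 ?(val_1 SM W) ?w2.
Qed.

(** This is [eps3_sp] multiplied by [- a]. The error term keeps its factor [a], so that the
    congruence survives division by 2 when [a] is even. *)
Lemma beta_eps2 : exists2 Y, O Y & beta * eps ^+ 2 = a%:R - 4%:R * a%:R * Y.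
Proof.
have [Y OY e] := eps3_sp; exists Y => //.
have -> : beta * eps ^+ 2 = a%:R - a%:R * (eps ^+ 3 * sp + 1) by rewrite /quartic_gen; ring.
by rewrite e; ring.
Qed.

Lemma locally_good_m1 : (a %% 4 = 3)%N -> locally_good (-1).
Proof.
move=> a3; have [Y OY e] := beta_eps2.
apply: (@locally_good_case _ (rb * eps)); first by right; left.
- by have := K_k0 ke; move=> ?; insf.
- by rewrite mulf_neq0.
have Da : a = (4 * (a %/ 4) + 3)%N by move: a3; clear; lia.
exists (a%:R * Y - (a %/ 4)%:R - 1); first by inri.
by rewrite exprMn rb2 e {1}Da natrD natrM; ring.
Qed.

Lemma locally_good_two (b : nat) (sg : bool) : a = (2 * b)%N -> (b %% 4 = if sg then 3 else 1)%N ->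
  locally_good ((-1) ^+ sg * 2%:R).
Proof.
move=> ab b4; have [Y OY e] := beta_eps2.
have e2 : 2%:R != 0 :> algC by rewrite pnatr_eq0.
apply: (@locally_good_case _ (rb * eps / 2%:R)).
- by case: (sg); rewrite ?expr0 ?expr1 ?mul1r ?mulN1r; do ![by left | right].
- by have := K_k0 ke; move=> ?; insf.
- by rewrite !mulf_neq0 ?invr_eq0.
have -> : (-1) ^+ sg * 2%:R * (rb * eps / 2%:R) ^+ 2 = (-1) ^+ sg * (b%:R - 4%:R * b%:R * Y).
  have -> : (rb * eps / 2%:R) ^+ 2 = (beta * eps ^+ 2) / 2%:R ^+ 2 by rewrite -rb2; field.
  by rewrite e ab natrM; field.
case: sg b4 => b4.
  have Db : b = (4 * (b %/ 4) + 3)%N by move: b4; clear; lia.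
  exists (b%:R * Y - (b %/ 4)%:R - 1); first by inri.
  by rewrite expr1 {1}Db natrD natrM; ring.
have Db : b = (4 * (b %/ 4) + 1)%N by move: b4; clear; lia.
exists (- b%:R * Y + (b %/ 4)%:R); first by inri.
by rewrite expr0 {1}Db natrD natrM; ring.
Qed.

(** * Descent of square classes from K to k0 *)

Section Descent.

Lemma conj_invaut x : algC_invaut Num.conj x = x^*.
Proof. by apply: (fmorph_inj Num.conj); rewrite algC_invautK /= conjCK. Qed.

Lemma val_conj w : val K w -> val K (w \o Num.conj).
Proof.
move=> W; apply: (val_aut (g := Num.conj)) => // x Kx; first exact: (K_conj Kx).
by rewrite conj_invaut; exact: (K_conj Kx).
Qed.

(* If v ramifies in K then w is invariant under conjugation, so w of the norm
   is twice w d. *)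
Lemma val_norm_even v d : val k0 v -> K d -> d != 0 -> (forall w, val K w -> evz (w d)) ->
  evz (v (d * d^*)).
Proof.
move=> V Kd d0 ev; have [w [e [W e_gt0 He]]] := lying_over NK0 NK K_k0 V.
have W' := val_conj W.
have Kc x : K x -> K x^* by move=> Kx; exact: (K_conj Kx).
have normE x : K x -> x != 0 -> w x + w x^* = e * v (x * x^*).
  move=> Kx x0; have x0' : x^* != 0 by rewrite conjC_eq0.
  have [kn _ _] := norm_K Kx x0.
  by rewrite -He ?mulf_neq0 // (valM W) //; exact: Kc.
have [same|diff] := pselect (forall x, ring_of_integers K x -> vge w 1 x -> vge (w \o Num.conj) 1 x).
  have eqw := val_eq NK W W' same.
  have [x [Kx x0 wx]] := val1 W.
  have := normE x Kx x0; have /= -> := eqw x Kx x0; rewrite wx => e2.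
  have [j wd] := ev w W; have := normE d Kd d0; have /= -> := eqw d Kd d0; rewrite wd.
  by move=> ed; exact: (two_div e_gt0 e2 ed).
have [x [[Kx Ax] wx wx']] : exists x, [/\ ring_of_integers K x, vge w 1 x & ~ vge (w \o Num.conj) 1 x].
  apply: contrapT => nx; apply: diff => x Ox wx; apply: contrapT => wx'; by apply: nx; exists x.
have x0 : x != 0 by apply: contra_notN wx' => /eqP ->; left.
have vx := vgeE x0 wx.
have wx0 : w x^* = 0.
  have := vgeE x0 (vge_ri SK W' (conj Kx Ax)) => /=.
  have : ~ (1 <= w x^*) by move=> le; apply: wx'; right.
  by move: (w _) => c; clear; lia.
have [t [[Kt At] t0 wt]] := val_unif NK W.
have wt' := vgeE t0 (vge_ri SK W' (conj Kt At)); rewrite /= in wt'.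
(* When [w] and its conjugate differ, an element with values 1 and 0 at them has a norm of [w]-value
   1, so [e = 1]. *)
have [z [Kz z0 wz wz']] : exists z, [/\ K z, z != 0, w z = 1 & w z^* = 0].
  have [wt0|wt0] := eqVneq (w t^*) 0; first by exists t.
  have Kx2 : K (x ^+ 2) by insf.
  have [||nz wz] := @val_dom _ _ SK W t (x ^+ 2) 2 Kt Kx2 t0; first by rewrite wt.
    by right; rewrite (val_X SK W) //; move: (w x) vx => c; clear; lia.
  exists (t + x ^+ 2); split=> //; [by insf | by rewrite wz |].
  have x20 : (x ^+ 2)^* != 0 by rewrite conjC_eq0 expf_neq0.
  have w20 : w (x ^+ 2)^* = 0 by rewrite rmorphXn (val_X SK W) ?wx0 ?mulr0 ?conjC_eq0 //; exact: Kc.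
  have [|| _] := @val_dom _ _ SK W (x ^+ 2)^* t^* 1 (Kc _ Kx2) (Kc _ Kt) x20; first by rewrite w20.
    by right; move: (w t^*) wt' wt0 => c; clear; lia.
  by rewrite w20 addrC -rmorphD.
have e1 : e = 1 by apply: (@int_mul_eq1 e (v (z * z^*))) => //; rewrite -normE // wz wz'.
rewrite -[v _]mul1r -e1 -normE //; apply: evzD; first exact: ev.
exact: (ev _ W').
Qed.

Variables (M : set algC) (y : algC).
Hypotheses (UM : unr_normal K M) (My : M y) (y0 : y != 0) (Ky : K (y ^+ 2)).

(* The norm of y^2 is a square g^2 in k0; Hilbert's theorem 90 for K/k0 applies
   to g / y^2. *)
Lemma descent : exists delta z, [/\ k0 delta, delta != 0, K z, z != 0 & y ^+ 2 = delta * z ^+ 2].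
Proof.
have [NM sKM _ unrM] := UM; have Kd : K (y ^+ 2) := Ky; set d := y ^+ 2 in Kd *.
have d0 : d != 0 by rewrite expf_neq0.
have evd w : val K w -> evz (w d) by move=> W; exact: (unr_val_sqr_even NK NM).
have [kc c_gt0 tc_gt0] := norm_K Kd d0.
have [g kg Dc] := totally_positive_square kc c_gt0 tc_gt0
  (fun v V => val_norm_even V Kd d0 evd).
have d0' : d^* != 0 by rewrite conjC_eq0.
have g0 : g != 0.
  by apply: contraTneq c_gt0 => g0; rewrite Dc g0 expr0n ltxx.
have Kg := K_k0 kg.
have [e|ne] := eqVneq (d + g) 0.
  exists (- g), 1; split; rewrite ?oppr_eq0 ?oner_neq0 //; try (by insf).
  by rewrite expr1n mulr1; apply: (addIr g); rewrite e addNr.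
have [kn n_gt0 _] := @norm_K (1 + g / d) ltac:(insf)
  ltac:(by rewrite -(divff d0) -mulrDl mulf_neq0 ?invr_eq0).
have z0 : 1 + g / d != 0 by rewrite -(divff d0) -mulrDl mulf_neq0 ?invr_eq0.
have Dz : (1 + g / d)^* = (1 + g / d) * d / g.
  rewrite rmorphD rmorph1 fmorph_div /= (k0_conj kg).
  have -> : d^* = g ^+ 2 / d by rewrite -Dc mulrAC mulfV ?mul1r.
  by field; rewrite d0 g0.
exists (g * ((1 + g / d) * (1 + g / d)^*)), ((1 + g / d)^-1); split => //.
- by insf.
- by rewrite !mulf_neq0 // conjC_eq0.
- by insf.
- by rewrite invr_eq0.
by rewrite Dz; move: (1 + g / d) z0 => z z0; field; rewrite g0 z0.
Qed.

End Descent.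

(** * Generators of the relevant square classes of k0 *)

Section Kappa.

Variables (delta : algC).
Hypotheses (kd : k0 delta) (d0 : delta != 0).

(** Away from [2 * a * p], K is unramified over k0, by [quad_unr] applied to [rb]; so the parity
    found in K is the parity in k0. *)
Lemma delta_even M s v l : unr_normal K M -> M s -> s ^+ 2 = delta -> val k0 v -> prime l -> 0 < v l%:R ->
  ~~ (l %| 2 * a * p)%N -> evz (v delta).
Proof.
move=> [NM sKM _ unrM] Ms Ds V pr_l vl ndv.
have s0 : s != 0 by apply: contraNneq d0 => s0; rewrite -Ds s0 expr0n.
have [w [e [W e_gt0 He]]] := lying_over NK0 NK K_k0 V.
have l0 : l%:R != 0 :> algC by rewrite pnatr_eq0 -lt0n prime_gt0.
have wl : 0 < w l%:R by rewrite He ?mulr_gt0 //; insf.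
have w0 n : (n %| 2 * a * p)%N -> w n%:R = 0.
  by move=> dn; apply: (w_nat0 NK W pr_l wl); apply: contraNN ndv => /dvdn_trans; apply.
have kb : k0 (rb ^+ 2) by rewrite rb2; exact: beta_k0.
have wr : w rb = 0.
  have := w_rb NK (fun x Kx => Kx) W pr_l wl.
  have := w_sp NK (fun x Kx => Kx) W.
  have -> : w a%:R = 0 by apply: w0; rewrite dvdn_mulr // dvdn_mull.
  have -> : w p%:R = 0 by apply: w0; rewrite dvdn_mull.
  by move: (w rb) (w sp) => i j; clear; lia.
have [|x [kx x0 wx]] := quad_unr NK0 NK K_k0 Kr kb K_span W r0.
  by left; split=> //; apply: w0; rewrite -mulnA dvdn_mulr.
have e1 : e = 1 by apply: (@int_mul_eq1 e (v x)) => //; rewrite -He.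
have -> : v delta = w (s ^+ 2) by rewrite Ds He // e1 mul1r.
by apply: (unr_val_sqr_even NK NM); rewrite ?Ds //; exact: K_k0.
Qed.

(** The valuations above [l] are [v0] and its conjugate, where the values of [c] have equal parity
    by hypothesis; a factor [l], of value 1 at both, corrects them together. *)
Lemma even_at l c : prime l -> l != p -> k0 c -> c != 0 ->
  (forall v, val k0 v -> 0 < v l%:R -> evz (v c + v (tau c))) ->
  exists i : bool, forall v, val k0 v -> 0 < v l%:R -> evz (v (c * l%:R ^+ i)).
Proof.
move=> pr_l lp kc c0 ev; have [v0 V0 v0l] := val_exists_over NK0 pr_l.
have l0 : l%:R != 0 :> algC by rewrite pnatr_eq0 -lt0n prime_gt0.
have kl : k0 l%:R by insf.
have [i evi] : exists i : bool, evz (v0 c + i%:Z).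
  by have [e|e] := evz_or (v0 c); [exists false; rewrite addr0 | exists true].
exists i => v V vl; have kli : k0 (l%:R ^+ i) by insf.
rewrite (valM V) ?expf_neq0 // (val_X SK0 V) // (val_l1 V pr_l lp vl) mulr1.
have [e|e] := val_k0_eq V0 V pr_l v0l vl; rewrite e //.
have := ev v0 V0 v0l; have [j ej] := evi => -[k ek]; exists (k + i%:Z - j).
by move: (v0 c) (v0 _) i%:Z j k ej ek; clear; lia.
Qed.

Lemma even_at_p : exists i : bool, forall v, val k0 v -> 0 < v p%:R -> evz (v (delta * sp ^+ i)).
Proof.
have [v0 V0 v0p] := val_exists_over NK0 pr_p.
have [i evi] : exists i : bool, evz (v0 delta + i%:Z).
  by have [e|e] := evz_or (v0 delta); [exists false; rewrite addr0 | exists true].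
exists i => v V vl; have kli : k0 (sp ^+ i) by insf.
rewrite (valM V) ?expf_neq0 // (val_X SK0 V) //; have [-> _] := val_p1 V vl.
rewrite mulr1; have [e|e] := val_k0_eq V0 V pr_p v0p vl; rewrite e //.
by have [_ ->] := val_p1 V0 v0p.
Qed.

(* The second hypothesis expresses that l is inert. *)
Lemma inert_val l : prime l ->
  (forall (x : algC) (v : algC -> int) (n : int), O x -> val k0 v -> 0 < v l%:R -> x * tau x = n%:~R -> (l %| n)%Z ->
     vge v 1 (tau x)) ->
  forall v x, val k0 v -> 0 < v l%:R -> k0 x -> x != 0 -> v (tau x) = v x.
Proof.
move=> pr_l H v x V vl kx x0.
apply: (val_eq NK0 V (val_tau V)) => // z Oz vz.
have [n Dn] := norm_Z Oz.
suff: vge v 1 (tau z) by case=> [/eqP|le]; [rewrite fmorph_eq0 => /eqP; left | right].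
apply: (H z v n) => //; apply: contrapT => /negP ndv.
have vn := val_int0 SK0 V pr_l vl ndv.
have Otz := tau_ri Oz.
have [z0|z0] := eqVneq z 0.
  by case/negP: ndv; move/esym: Dn; rewrite z0 mul0r => /eqP; rewrite intr_eq0 => /eqP ->; rewrite dvdz0.
have tz0 : tau z != 0 by rewrite fmorph_eq0.
have := vgeE z0 vz; have := vgeE tz0 (vge_ri SK0 V Otz).
have := valM V Oz.1 Otz.1 z0 tz0; rewrite Dn vn; move: (v z) (v _) => i j; clear; lia.
Qed.

(** For [x = r + u * omega] the norm is [r ^+ 2 + r * u - c4 * u ^+ 2]. As [c4] is odd, it is even
    only if [r] and [u] are, and then 2 divides [x]. *)
Lemma inert_two v x : val k0 v -> 0 < v 2%:R -> k0 x -> x != 0 -> v (tau x) = v x.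
Proof.
apply: inert_val => // {}x {}v n Ox V v2 Dn dn.
have [t [u e2]] := ri_form Ox.
have [kx _] := Ox.
have et : 2%:R * tau x = t%:~R - u%:~R * sp.
  by rewrite -[2%:R](rmorph_nat tau) -rmorphM e2 rmorphD rmorphM !rmorph_int tau_sp mulrN.
have nE : t ^+ 2 - p%:Z * u ^+ 2 = 4 * n.
  apply: (@intr_inj algC); rewrite intrB !intrM -Dn.
  have -> : (4 : int)%:~R * (x * tau x) = (2%:R * x) * (2%:R * tau x) :> algC by ring.
  rewrite e2 et -[(p%:Z)%:~R]/(p%:R : algC).
  by move: (sp) sp2 => S <-; ring.
have [pE oc] := c4E.
have [r Dt] : exists r, t = u + 2 * r.
  exists ((t - u) %/ 2)%Z; have : exists k, (t - u) * (t + u) = 2 * k.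
    exists (2 * n + 2 * c4%:Z * u ^+ 2).
    have : p%:Z = 4 * c4%:Z + 1 by rewrite {1}pE; clear; lia.
    by move: nE => /[swap] -> nE; clear -nE; nia.
  by move=> [k ek]; clear -ek; nia.
have [m Dm] : exists m, n = 2 * m by exists (n %/ 2)%Z; clear -dn; lia.
have nE2 : r ^+ 2 + r * u - c4%:Z * u ^+ 2 = n.
  have : p%:Z = 4 * c4%:Z + 1 by rewrite {1}pE; clear; lia.
  by move: nE; rewrite Dt => /[swap] -> nE; clear -nE; nia.
have [k Dk] : exists k, c4%:Z = 2 * k + 1 by exists (c4./2)%:Z; clear -oc; lia.
have [[r' Dr] [u' Du]] : (exists r', r = 2 * r') /\ (exists u', u = 2 * u').
  rewrite Dk Dm in nE2.
  have [R [er|er]] : exists R, r = 2 * R \/ r = 2 * R + 1 by exists (r %/ 2)%Z; clear; lia.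
    have [U [eu|eu]] : exists U, u = 2 * U \/ u = 2 * U + 1 by exists (u %/ 2)%Z; clear; lia.
      by split; [exists R | exists U].
    by exfalso; rewrite er eu in nE2; clear -nE2; lia.
  have [U [eu|eu]] : exists U, u = 2 * U \/ u = 2 * U + 1 by exists (u %/ 2)%Z; clear; lia.
    by exfalso; rewrite er eu in nE2; clear -nE2; lia.
  by exfalso; rewrite er eu in nE2; clear -nE2; lia.
have -> : tau x = 2%:R * (r'%:~R + u'%:~R * (1 - omega)).
  apply: (mulfI (_ : 2%:R != 0)); first by rewrite pnatr_eq0.
  rewrite et Dt Dr Du; have := sp_omega; move: omega => om ->.
  by rewrite intrD !intrM; ring.
have kom : k0 omega := omega_k0.
apply: (vgeMr V); [by insf | by insf | by right; move: (v 2%:R) v2 => c; clear; lia |].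
by apply: (vge_ri SK0 V); have := tau_ri Oom; rewrite tau_omega => O1; inri.
Qed.

Lemma legendre_nonres q : (0 < q)%N -> legendre p q = -1 -> forall z : int, ~ (q%:Z %| z ^+ 2 - p%:Z)%Z.
Proof.
move=> q0; rewrite /legendre; case: ifP => // /negbT ndp; case: existsP => // nx _ z dz; apply: nx.
have qz : q%:Z != 0 by case: (q) q0.
have r_ge0 := modz_ge0 z qz; have r_lt := ltz_pmod z (q0 : 0 < q%:Z).
have Dr : (absz (z %% q%:Z)%Z)%:Z = (z %% q%:Z)%Z by rewrite gez0_abs.
have r_lt' : (absz (z %% q%:Z)%Z < q)%N by rewrite -ltz_nat Dr.
exists (Ordinal r_lt') => /=.
have : (((absz (z %% q%:Z)%Z) ^ 2)%N%:Z == p%:Z %[mod q%:Z])%Z.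
  have -> : ((absz (z %% q%:Z)%Z) ^ 2)%N%:Z = (z %% q%:Z)%Z ^+ 2 by rewrite -mulnn PoszM Dr expr2.
  by rewrite modzXm eqz_mod_dvd.
by rewrite !modz_nat.
Qed.

(** If [q] divides the norm but not [u], inverting [u] modulo [q] exhibits [p] as a square. So [q]
    divides [t] and [u], hence [2 * x] and its conjugate. *)
Lemma inert_odd q v x : prime q -> odd q -> legendre p q = -1 ->
  val k0 v -> 0 < v q%:R -> k0 x -> x != 0 -> v (tau x) = v x.
Proof.
move=> pr_q oq leg; apply: inert_val => // {}x {}v n Ox V vq Dn dn.
have [t [u e2]] := ri_form Ox.
have et : 2%:R * tau x = t%:~R - u%:~R * sp.
  by rewrite -[2%:R](rmorph_nat tau) -rmorphM e2 rmorphD rmorphM !rmorph_int tau_sp mulrN.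
have nE : t ^+ 2 - p%:Z * u ^+ 2 = 4 * n.
  apply: (@intr_inj algC); rewrite intrB !intrM -Dn.
  have -> : (4 : int)%:~R * (x * tau x) = (2%:R * x) * (2%:R * tau x) :> algC by ring.
  rewrite e2 et -[(p%:Z)%:~R]/(p%:R : algC).
  by move: (sp) sp2 => S <-; ring.
have v2 : v 2%:R = 0.
  by apply: (val_nat0 SK0 V pr_q vq); rewrite dvdn_prime2 //; apply: contraTneq oq => ->.
have [[t' Dt] [u' Du]] : (exists t', t = q%:Z * t') /\ (exists u', u = q%:Z * u').
  have main : (q%:Z %| u)%Z.
    apply: contrapT => /negP ndu.
    have co : coprimez q%:Z u by rewrite coprimezE prime_coprime // -dvdzE.
    have [[b c] /= bez] := coprimezP _ _ co; apply: (@legendre_nonres q (prime_gt0 pr_q) leg (t * c)).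
    have -> : (t * c) ^+ 2 - p%:Z = q%:Z * (c ^+ 2 * (4 * (n %/ q%:Z)%Z) - p%:Z * b * (1 + c * u)).
      have en := divzK dn; have e1 : b * q%:Z = 1 - c * u by rewrite -bez addrK.
      have -> : (t * c) ^+ 2 = c ^+ 2 * (p%:Z * u ^+ 2 + 4 * n) by rewrite -nE; ring.
      rewrite -{1}en; have -> : q%:Z * (c ^+ 2 * (4 * (n %/ q%:Z)%Z) - p%:Z * b * (1 + c * u)) =
        c ^+ 2 * (4 * ((n %/ q%:Z)%Z * q%:Z)) - p%:Z * (b * q%:Z) * (1 + c * u) by ring.
      by rewrite e1; ring.
    exact: dvdz_mulr.
  have dt : (q%:Z %| t)%Z.
    have : (q%:Z %| t ^+ 2)%Z.
      have -> : t ^+ 2 = 4 * n + p%:Z * u ^+ 2 by rewrite -nE; ring.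
      by rewrite rpredD // dvdz_mull // expr2 dvdz_mull.
    by rewrite !dvdzE abszX Euclid_dvdX // => /andP[].
  by split; [exists (t %/ q%:Z)%Z | exists (u %/ q%:Z)%Z]; rewrite mulrC divzK.
have D2 : 2%:R * tau x = q%:R * (t'%:~R - u'%:~R * sp).
  by rewrite et Dt Du !intrM -[(q%:Z)%:~R]/(q%:R : algC); ring.
have [kx _] := Ox; have ktx := tau_k0 kx.
have [x0|x0] := eqVneq (tau x) 0; first by left.
have k2 : k0 2%:R by insf.
have : vge v 1 (2%:R * tau x).
  rewrite D2; apply: (vgeMr V); [by insf | by insf | by right; move: (v q%:R) vq => c; clear; lia |].
  by apply: (vge_ri SK0 V); inri.
move=> /vgeE; rewrite mulf_neq0 // ?pnatr_eq0 // => /(_ isT).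
by rewrite (valM V) ?pnatr_eq0 // v2 add0r => le; right.
Qed.

End Kappa.

Section Generation.

Variables (h m n : nat) (q x y : 'I_n -> nat).
Hypothesis (cl_h : class_number k0 h).
Hypothesis (a_fact : (a = \prod_(i < n) q i \/ a = 2 * \prod_(i < n) q i)%N).
Hypothesis (pr_q : forall i, prime (q i) /\ odd (q i)).
Hypothesis (split_q : forall j : 'I_n, (j < m)%N ->
  (x j)%:Z ^+ 2 - p%:Z * (y j)%:Z ^+ 2 = (q j)%:Z ^+ (3 * h)).
Hypothesis (inert_q : forall j : 'I_n, (m <= j)%N -> legendre p (q j) = -1).

Lemma q_dvd_a i : (q i %| a)%N.
Proof.
have d : (q i %| \prod_(i < n) q i)%N by rewrite (bigD1 i) //= dvdn_mulr.
by case: a_fact => ->; rewrite ?dvdn_mull.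
Qed.

Lemma prime_dvd_2ap l : prime l -> (l %| 2 * a * p)%N -> l \in [:: 2, p & codom q].
Proof.
move=> pr_l; rewrite !inE.
have P0 : (l %| \prod_(i < n) q i)%N -> l \in codom q.
  rewrite (big_morph (fun s => l %| s)%N (id1 := false) (op1 := orb)); last 2 first.
  - by move=> s t; rewrite Euclid_dvdM.
  - by rewrite dvdn1; case: eqP pr_l => // ->.
  rewrite big_has => /hasP[i _ dl]; apply/codomP; exists i; apply/eqP.
  by rewrite -dvdn_prime2 //; case: (pr_q i).
have l2 := dvdn_prime2 pr_l (isT : prime 2).
rewrite !Euclid_dvdM // l2 (dvdn_prime2 pr_l pr_p) => /orP[/orP[-> //|la]|->]; last by rewrite orbT.
have {la} : (l == 2)%N || (l %| \prod_(i < n) q i)%N.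
  by case: a_fact la => ->; rewrite ?Euclid_dvdM // ?l2 => ->; rewrite ?orbT.
by case/orP => [-> //|/P0 ->]; rewrite !orbT.
Qed.

Variables (M : set algC) (s delta : algC).
Hypotheses (UM : unr_normal K M) (Ms : M s) (Ds : s ^+ 2 = delta) (kd : k0 delta) (d0 : delta != 0).
Variable (H : set algC).
Hypothesis HM : forall u v, H u -> H v -> H (u * v).
Hypothesis Hsq : forall z, k0 z -> z != 0 -> H (z ^+ 2).
Hypotheses (Hm1 : H (-1)) (Heps : H eps) (H2 : H 2%:R) (Hsp : H sp).
Hypothesis Hq : forall i, H (q i)%:R.
Hypothesis Ha : forall j : 'I_n, (j < m)%N -> H (alpha p (x j) (y j)).

Lemma gen_one : H 1.
Proof. by rewrite -(expr1n _ 2); apply: Hsq; rewrite ?oner_neq0 //; insf. Qed.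

Lemma gen_exp u (b : bool) : H u -> H (u ^+ b).
Proof. by case: b => Hu; rewrite ?expr1 ?expr0 //; exact: gen_one. Qed.

(** A correction at [l] alone: being a unit away from [l], it does not disturb the corrections
    chosen for other primes. *)
Definition corrects l kappa := [/\ H kappa, k0 kappa, kappa != 0,
  forall v, val k0 v -> 0 < v l%:R -> evz (v (delta * kappa)) &
  forall v, val k0 v -> v l%:R = 0 -> v kappa = 0].

Lemma corrects_even_at l c : prime l -> l != p -> H l%:R -> k0 c -> c != 0 -> H c ->
  (forall v, val k0 v -> v l%:R = 0 -> v c = 0) ->
  (forall v, val k0 v -> 0 < v l%:R -> evz (v (delta * c) + v (tau (delta * c)))) ->
  exists kappa, corrects l kappa.
Proof.
move=> pr_l lp Hl kc c0 Hc vc ev; have kdc : k0 (delta * c) by insf.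
have l0 : l%:R != 0 :> algC by rewrite pnatr_eq0 -lt0n prime_gt0.
have kl : k0 l%:R by insf.
have [i Hi] := even_at pr_l lp kdc (mulf_neq0 d0 c0) ev.
have kli : k0 (l%:R ^+ i) by insf. have li0 : l%:R ^+ i != 0 :> algC by rewrite expf_neq0.
exists (c * l%:R ^+ i); split.
- by apply: HM => //; exact: gen_exp.
- by insf.
- by rewrite mulf_neq0.
- by move=> v V vl; rewrite mulrA; exact: Hi.
- by move=> v V vl; rewrite (valM V) // (val_X SK0 V) // vc // vl mulr0.
Qed.

Lemma corrects_inert l : prime l -> l != p -> H l%:R ->
  (forall v z, val k0 v -> 0 < v l%:R -> k0 z -> z != 0 -> v (tau z) = v z) ->
  exists kappa, corrects l kappa.
Proof.
move=> pr_l lp Hl inert; apply: (corrects_even_at (c := 1)) => //; first by insf.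
- exact: oner_neq0.
- exact: gen_one.
- by move=> v V _; exact: (val_1 SK0 V).
- by move=> v V vl; rewrite mulr1 (inert v delta V vl kd d0); exists (v delta).
Qed.

(** The norm of [al] is a power of [q j] with the odd exponent [3 * h], so a factor [al] flips the
    parity of the sum of the values of [delta] and [tau delta]. Once this sum is even, [even_at]
    applies. *)
Lemma corrects_split (j : 'I_n) : (j < m)%N -> exists kappa, corrects (q j) kappa.
Proof.
move=> jm; have [pr oq] := pr_q j; have qp := q_neq_p pr (q_dvd_a j).
have N := alpha_norm (split_q jm); have al0 := alpha_neq0 pr (split_q jm).
set al := alpha p (x j) (y j) in N al0 *.
have kal : k0 al by exact: alpha_k0.
have Oal : O al by exact: alpha_ri.
have tal0 : tau al != 0 by rewrite fmorph_eq0.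
have Otal := tau_ri Oal; have ktal := Otal.1.
have kq : k0 (q j)%:R by insf.
have q0 : (q j)%:R != 0 :> algC by rewrite pnatr_eq0 -lt0n prime_gt0.
have vN v : val k0 v -> v al + v (tau al) = (3 * h)%N%:Z * v (q j)%:R.
  by move=> V; rewrite -(valM V) // N (val_X SK0 V).
have [v0 V0 v0q] := val_exists_over NK0 pr.
have oh := class_number_odd cl_h.
have ktd := tau_k0 kd. have td0 : tau delta != 0 by rewrite fmorph_eq0.
have [b eb] : exists b : bool, evz (v0 delta + v0 (tau delta) + b%:Z).
  have [e|e] := evz_or (v0 delta + v0 (tau delta)); first by exists false; rewrite addr0.
  by exists true.
have [g Dg] : exists g, (3 * h)%N = (g + g + 1)%N by exists (3 * h)./2; clear -oh; lia.
have kalb : k0 (al ^+ b) by insf. have ktalb : k0 (tau al ^+ b) by insf.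
have alb0 : al ^+ b != 0 by rewrite expf_neq0. have talb0 : tau al ^+ b != 0 by rewrite expf_neq0.
apply: (corrects_even_at (c := al ^+ b)) => //.
- exact: gen_exp (Ha jm).
- move=> v V vq; have := vN v V; rewrite vq mulr0 (val_X SK0 V) //.
  have := vgeE al0 (vge_ri SK0 V Oal); have := vgeE tal0 (vge_ri SK0 V Otal).
  move: (v al) (v _) => i k i0 k1 e; have -> : i = 0 by clear -i0 k1 e; lia.
  by rewrite mulr0.
move=> v V vq.
have sym : v (delta * al ^+ b) + v (tau (delta * al ^+ b)) = v0 (delta * al ^+ b) + v0 (tau (delta * al ^+ b)).
  have kc : k0 (delta * al ^+ b) by insf.
  have c0 : delta * al ^+ b != 0 by rewrite mulf_neq0.
  have ktc := tau_k0 kc. have tc0 : tau (delta * al ^+ b) != 0 by rewrite fmorph_eq0.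
  have [e|e] := val_k0_eq V0 V pr v0q vq; first by rewrite (e _ kc c0) (e _ ktc tc0).
  by rewrite (e _ kc c0) (e _ ktc tc0) (tauK kc) addrC.
rewrite sym (rmorphM tau delta) rmorphXn (valM V0) // (valM V0) // (val_X SK0 V0) // (val_X SK0 V0) //.
have := vN v0 V0; rewrite (val_l1 V0 pr qp v0q) Dg mulr1.
case: eb => k; move: (v0 delta) (v0 (tau delta)) (v0 al) (v0 (tau al)) => A B C D ek e.
exists (k + b%:Z * g%:Z); move: ek e; move: (b) => []; clear; lia.
Qed.

Lemma corrects_seq (S : seq nat) : uniq S -> (forall l, l \in S -> prime l) ->
  (forall l, l \in S -> exists kappa, corrects l kappa) ->
  exists kappa, [/\ H kappa, k0 kappa, kappa != 0,
    forall v l, l \in S -> val k0 v -> 0 < v l%:R -> evz (v (delta * kappa)) &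
    forall v, val k0 v -> (forall l, l \in S -> v l%:R = 0) -> v kappa = 0].
Proof.
elim: S => [|l S IHS] /= => [_ _ _|/andP[nlS uS] prS corS].
  exists 1; split; rewrite ?oner_neq0 //; [exact: gen_one | by insf | by move=> v V _; exact: (val_1 SK0 V)].
have [|l' l'S|k' [Hk' kk' k'0 ev' off']] := IHS uS.
- by move=> l' l'S; apply: prS; rewrite inE l'S orbT.
- by apply: corS; rewrite inE l'S orbT.
have [k [Hk kk k0' ev off]] := corS l (mem_head _ _).
have pr_l := prS l (mem_head _ _).
have other v l1 l2 : val k0 v -> prime l1 -> prime l2 -> l1 != l2 -> 0 < v l1%:R -> v l2%:R = 0.
  by move=> V p1 p2 n12 v1; apply: (val_nat0 SK0 V p1 v1); rewrite dvdn_prime2.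
exists (k * k'); split; rewrite ?mulf_neq0 //; [exact: HM | by insf | |].
- move=> v l'; rewrite inE => /orP[/eqP ->|l'S] V vl.
    rewrite mulrA (valM V) ?mulf_neq0 //; last by insf.
    rewrite [v k']off' ?addr0; [exact: ev | by [] |] => l2 l2S.
    apply: (other v l l2 V) => //; first by apply: prS; rewrite inE l2S orbT.
    by apply: contraNneq nlS => ->.
  rewrite [k * k']mulrC mulrA (valM V) ?mulf_neq0 //; last by insf.
  rewrite [v k]off ?addr0; [exact: (ev' v l') | by [] |].
  apply: (other v l' l V) => //; first by apply: prS; rewrite inE l'S orbT.
  by apply: contraNneq nlS => <-.
- move=> v V vS; rewrite (valM V) // off ?vS ?mem_head // off' // => l' l'S.
  by apply: vS; rewrite inE l'S orbT.
Qed.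

(** [H] stands for any multiplicative set with the listed members; it will be [near_sqr]. After
    correction at 2, [p] and the [q i], [even_unit_square] leaves only a sign, a power of [eps] and
    a square. *)
Lemma delta_gen : H delta.
Proof.
have two_p : 2%N != p by apply/eqP => e2; move: p8; rewrite -e2.
have [|l|kappa [Hk kk k0' ev off]] := @corrects_seq (undup [:: 2, p & codom q]) (undup_uniq _).
- by move=> l; rewrite mem_undup !inE => /or3P[/eqP ->|/eqP ->|/codomP[i ->]] //; case: (pr_q i).
- rewrite mem_undup !inE => /or3P[/eqP ->|/eqP ->|/codomP[i ->]].
  + by apply: corrects_inert => // v z; exact: inert_two.
  + have [i Hi] := even_at_p kd d0.
    exists (sp ^+ i); split=> //; [exact: gen_exp | by insf | by rewrite expf_neq0 |].
    move=> v V vp; have := val_X SK0 V 2 Ksp sp0; rewrite sp2 vp (val_X SK0 V) //.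
    move: (v sp) => c e; have c0 : c = 0 by clear -e; lia.
    by rewrite c0 mulr0.
  + have [im|mi] := ltnP i m; first exact: corrects_split.
    have [pr oq] := pr_q i; apply: corrects_inert => //; first exact: (q_neq_p pr (q_dvd_a i)).
    by move=> v z V vq kz z0; exact: (inert_odd pr oq (inert_q mi) V vq kz z0).
have kdk : k0 (delta * kappa) by insf.
have [|g [i [j [kg g0 e]]]] := even_unit_square kdk (mulf_neq0 d0 k0').
  move=> v V; have [l pr_l vl] := val_prime NK0 V.
  have [lS|nlS] := boolP (l \in [:: 2, p & codom q]); first by apply: (ev v l); rewrite ?mem_undup.
  have ndl : ~~ (l %| 2 * a * p)%N by apply: contraNN nlS; exact: prime_dvd_2ap.
  have vd := delta_even kd d0 UM Ms Ds V pr_l vl ndl.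
  rewrite (valM V) // off ?addr0 // => l' l'S; apply: (val_nat0 SK0 V pr_l vl).
  rewrite mem_undup in l'S; rewrite dvdn_prime2 //; first by apply: contraNneq nlS => ->.
  by move: l'S; rewrite !inE => /or3P[/eqP ->|/eqP ->|/codomP[i ->]] //; case: (pr_q i).
have -> : delta = (-1) ^+ i * eps ^+ j * (g / kappa) ^+ 2 * kappa.
  by apply: (mulIf k0'); rewrite e; field.
have kgk : k0 (g / kappa) by insf.
have gk0 : g / kappa != 0 by rewrite mulf_neq0 ?invr_eq0.
apply: HM => //; apply: HM; last exact: Hsq.
by apply: HM; exact: gen_exp.
Qed.

End Generation.

(** * Dyadic obstructions *)

Section Local.
Variables (M : set algC) (w : algC -> int).
Hypotheses (NM : numfield M) (sKM : K `<=` M) (unrM : unr K M) (W : val M w) (w2 : 0 < w 2%:R).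
Let SM := NM.1.
Let k0M x : k0 x -> M x. Proof. by move=> /K_k0 /sKM. Qed.
Let two0 : 2%:R != 0 :> algC. Proof. by rewrite pnatr_eq0. Qed.
Let M2 : M 2%:R. Proof. by insf. Qed.
Let pr2 : prime 2 := isT.

(* If w (s - 1) < w 2 then s - 1 and s + 1 have the same valuation. *)
Lemma sqr_sub1_even s : M s -> s ^+ 2 - 1 != 0 -> w (s ^+ 2 - 1) < 2 * w 2%:R -> evz (w (s ^+ 2 - 1)).
Proof.
move=> Ms nz lt; have e : s ^+ 2 - 1 = (s - 1) * (s + 1) by ring.
have [s1 s2] : s - 1 != 0 /\ s + 1 != 0 by move: nz; rewrite e mulf_eq0 negb_or => /andP.
have M1 : M (s - 1) by insf. have M1' : M (s + 1) by insf.
have s1E : s + 1 = (s - 1) + 2%:R by ring.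
have [lt1|ge1] := ltP (w (s - 1)) (w 2%:R).
  have [|_ e2] := val_dom SM W M1 M2 s1 lt1; first by right.
  by rewrite e (valM W) // s1E e2; exists (w (s - 1)).
have : vge w (w 2%:R) (s + 1) by rewrite s1E; apply: (valD W) => //; right.
move=> /(vgeE s2) ge2; move: lt; rewrite e (valM W) //.
by move: (w _) (w (s + 1)) (w _) ge1 ge2 => i j k; clear; lia.
Qed.

Lemma sq4_even d : M d -> d != 0 -> sq4 K w d -> evz (w d).
Proof.
move=> Md d0 [z [Kz z0 cl]]; have Mz := sKM Kz.
have Mz2 : M (z ^+ 2) by insf. have z20 : z ^+ 2 != 0 by rewrite expf_neq0.
have Mm : M (d * z ^+ 2 - 1) by insf. have Mi : M 1 by insf.
have [|_] := val_dom SM W Mi Mm (oner_neq0 _) _ cl; first by rewrite (val_1 SM W); move: (w 2%:R) w2 => c; clear; lia.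
rewrite addrC subrK (val_1 SM W) (valM W) // (val_X SM W) // => e.
by exists (- w z); move: (w d) (w z) e => i j; clear; lia.
Qed.

(** Write [rho = t ^+ 2 * (1 + u)] with [w u = c]. Then [S = s * z * rho / t] satisfies
    [S ^+ 2 = eta * (1 + u)] with [eta] congruent to 1 modulo 4, so [S ^+ 2 - 1] has the odd value
    [c], against [sqr_sub1_even]. *)
Lemma dyadic_false s rho t (c : int) : M s -> s != 0 -> K rho -> rho != 0 -> K t -> t != 0 ->
  sq4 K w (s ^+ 2 * rho) -> rho - t ^+ 2 != 0 -> w (rho - t ^+ 2) = 2 * w t + c ->
  0 < c -> c < 2 * w 2%:R -> ~ evz c -> False.
Proof.
move=> Ms s0 Kr' rho0 Kt t0 [z [Kz z0 cl]] X0 wX c0 c2; apply.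
have Mrho := sKM Kr'; have Mt := sKM Kt; have Mz := sKM Kz.
set u := (rho - t ^+ 2) / t ^+ 2; have Mu : M u by rewrite /u; insf.
have t20 : t ^+ 2 != 0 by rewrite expf_neq0.
have u0 : u != 0 by rewrite /u mulf_neq0 ?invr_eq0.
have wu : w u = c.
  have MX : M (rho - t ^+ 2) by insf. have Mt2 : M (t ^+ 2) by insf.
  by rewrite /u (val_div SM W) // wX (val_X SM W) // addrC addKr.
set S := s * z * rho / t; have MS : M S by rewrite /S; insf.
set eta := s ^+ 2 * rho * z ^+ 2 in cl; have Meta : M (eta - 1) by rewrite /eta; insf.
have e : S ^+ 2 - 1 = u + (eta - 1) * (1 + u) by rewrite /S /eta /u; field.
have M1u : M (1 + u) by insf. have Mp : M ((eta - 1) * (1 + u)) by insf.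
have Mi : M 1 by insf.
have v1u : vge w 0 (1 + u).
  by apply: (valD W) => //; [exact: (vge_1 SM W) | right; rewrite wu ltW].
have [|nz e'] := val_dom SM W Mu Mp u0 _ (vgeMr W Meta M1u cl v1u); first by rewrite wu.
rewrite -e in nz e'.
by have := sqr_sub1_even MS nz; rewrite e' wu => /(_ c2).
Qed.

Lemma w_ri x : O x -> vge w 0 x.
Proof. by move=> [kx Ax]; apply: (vge_ri SM W); split=> //; exact: k0M. Qed.

Lemma w_odd (k : nat) : odd k -> w k%:R = 0.
Proof. by move=> ok; apply: (w_nat0 NM W pr2 w2); rewrite dvdn2 ok. Qed.

(** The product of [omega] and [omega - 1] is the odd integer [c4]. *)
Lemma w_omega : [/\ omega != 0, omega - 1 != 0, w omega = 0 & w (omega - 1) = 0].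
Proof.
have [_ oc] := c4E; have c0 : c4%:R != 0 :> algC by rewrite pnatr_eq0; case: c4 oc.
have e : omega * (omega - 1) = c4%:R by rewrite mulrBr mulr1 -expr2 omega2; ring.
have [o0 o1] : omega != 0 /\ omega - 1 != 0 by move: c0; rewrite -e mulf_eq0 negb_or => /andP.
have Oom1 : O (omega - 1) by inri.
have Mom := k0M Oom.1; have Mom1 := k0M Oom1.1.
have := valM W Mom Mom1 o0 o1; rewrite e (w_odd oc).
have := vgeE o0 (w_ri Oom); have := vgeE o1 (w_ri Oom1).
move: (w omega) (w (omega - 1)) => i j i0 j0 ij; split=> //; clear -i0 j0 ij; lia.
Qed.

(** The values of [X] and [Y * pi] are an even and an odd multiple of [w pi], so every value on K is
    a multiple of [w pi]; as [M] is unramified over K, 1 is such a value. *)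
Lemma w_half pi : K pi -> pi != 0 -> 2 * w pi = w 2%:R ->
  (forall x, K x -> exists X Y, [/\ k0 X, k0 Y & x = X + Y * pi]) -> w pi = 1.
Proof.
move=> Kpi pi0 wpi span; have [x [Kx x0 wx]] := unrM W; have [X [Y [kX kY Dx]]] := span x Kx.
have Mpi := sKM Kpi; have MX := k0M kX; have MY := k0M kY.
have two_p : 2%N != p by apply/eqP => e2; move: p8; rewrite -e2.
have wk z : k0 z -> z != 0 -> exists k : int, w z = 2 * k * w pi.
  move=> kz z0; have [k ->] := w_k0 NM sKM W pr2 w2 two_p kz z0.
  by exists k; rewrite -wpi; move: (w pi) => c; ring.
have wpi0 : 0 < w pi by move: w2; rewrite -wpi; move: (w pi) => c; clear; lia.
suff [k ek] : exists k : int, w x = w pi * k.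
  by apply: (@int_mul_eq1 _ k) => //; rewrite -ek.
have [X0|X0] := eqVneq X 0.
  have Y0 : Y != 0 by apply: contraNneq x0 => Y0; rewrite Dx X0 Y0 mul0r addr0.
  have [k ek] := wk Y kY Y0; exists (2 * k + 1).
  by rewrite Dx X0 add0r (valM W) // ek; move: (w pi) => c; ring.
have [i ei] := wk X kX X0.
have [Y0|Y0] := eqVneq Y 0.
  by exists (2 * i); rewrite Dx Y0 mul0r addr0 ei; move: (w pi) => c; ring.
have [j ej] := wk Y kY Y0; have MYp : M (Y * pi) by insf.
have Yp0 : Y * pi != 0 by rewrite mulf_neq0.
have wY : w (Y * pi) = (2 * j + 1) * w pi by rewrite (valM W) // ej; move: (w pi) => c; ring.
have [lt|ge] := ltP (w X) (w (Y * pi)).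
  have [|_ ex] := val_dom SM W MX MYp X0 lt; first by right.
  by exists (2 * i); rewrite Dx ex ei; move: (w pi) => c; ring.
have lt : w (Y * pi) < w X.
  move: ge; rewrite le_eqVlt => /orP[/eqP eXY|//]; exfalso.
  have : (2 * j + 1) * w pi = 2 * i * w pi by rewrite -wY -ei.
  move=> /(mulIf (_ : w pi != 0)); rewrite gt_eqF // => /(_ isT); clear; lia.
have [|_ ex] := val_dom SM W MYp MX Yp0 lt; first by right.
by exists (2 * j + 1); rewrite Dx addrC ex wY mulrC.
Qed.

Local Notation r := (rb * eps).
Let re0 : r != 0. Proof. by rewrite mulf_neq0. Qed.
Let Kre : K r. Proof. by have := K_k0 ke => ?; insf. Qed.

Lemma span_shift (c : algC) x : k0 c -> K x -> exists X Y, [/\ k0 X, k0 Y & x = X + Y * (r - c)].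
Proof.
move=> kc Kx; have [X [Y [kX kY ->]]] := K_span Kx.
exists (X + Y / eps * c), (Y / eps); split; [by insf | by insf | by field].
Qed.

Lemma r_sqr : exists2 Y, O Y & r ^+ 2 = a%:R - 4%:R * a%:R * Y.
Proof.
have [Y OY e] := beta_eps2; exists Y => //.
by rewrite exprMn rb2.
Qed.

Lemma w4 B : O B -> vge w (2 * w 2%:R) (4%:R * B).
Proof.
move=> OB; have M4 : M 4%:R by insf.
apply: (vgeMr W) => //; [exact: (k0M OB.1) | | exact: w_ri].
right; have -> : 4%:R = 2%:R ^+ 2 :> algC by ring.
by rewrite (val_X SM W).
Qed.

Lemma w_unit_shift th u : O th -> M u -> 0 < w u -> u != 0 -> 1 + th * u != 0 /\ w (1 + th * u) = 0.
Proof.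
move=> Oth Mu u0 nz; have Mth := k0M Oth.1; have Mtu : M (th * u) by insf.
have Mi : M 1 by insf.
have vtu : vge w 1 (th * u).
  by apply: (vgeMl W) => //; [exact: w_ri | right; move: (w u) u0 => c; clear; lia].
by have [|nz' ->] := val_dom SM W Mi Mtu (oner_neq0 _) _ vtu; rewrite (val_1 SM W).
Qed.

Section Mod4.
Hypothesis a1 : (a %% 4 = 1)%N.

(** [r ^+ 2] is 1 modulo 4, so K over k0 is unramified above 2, and 2 is unramified in k0. *)
Lemma w_two1 : w 2%:R = 1.
Proof.
have WK : val K w.
  split=> [u v Ku Kv|k u v Ku Kv|]; [by apply: (valM W); exact: sKM | by apply: (valD W); exact: sKM | exact: unrM].
have [Y OY e] := r_sqr.
have kr2 : k0 (r ^+ 2) by rewrite exprMn rb2; have ? := beta_k0; insf.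
have Da : a = (4 * (a %/ 4) + 1)%N by move: a1; clear; lia.
have [||x [kx x0 wx]] := quad_unr NK0 NK K_k0 Kre kr2 _ WK re0.
- by move=> x Kx; have [X [Y' [kX kY ->]]] := span_shift (sf_nat SK0 0) Kx; exists X, Y'; rewrite subr0.
- right; split=> //; rewrite e {1}Da natrD natrM.
  have -> : 4%:R * (a %/ 4)%:R + 1 - 4%:R * a%:R * Y - 1 = 4%:R * ((a %/ 4)%:R - a%:R * Y) by ring.
  by apply: w4; inri.
have two_p : 2%N != p by apply/eqP => e2; move: p8; rewrite -e2.
have [k ek] := w_k0 NM sKM W pr2 w2 two_p kx x0.
by apply: (@int_mul_eq1 _ k) => //; rewrite mulrC -ek.
Qed.

End Mod4.

(* Representatives modulo squares of the subgroup that the local condition at 2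
   has to cut down. *)
Definition coset_rep (i j k : bool) : algC := (-1) ^+ i * sp ^+ j * 2%:R ^+ k.
Local Notation rho := coset_rep.

Lemma rho_k0 i j k : k0 (rho i j k). Proof. by rewrite /coset_rep; insf. Qed.
Lemma rho_neq0 i j k : rho i j k != 0.
Proof. by rewrite /coset_rep !mulf_neq0 ?expf_neq0 // oppr_eq0 oner_neq0. Qed.

Variable s : algC.
Hypotheses (Ms : M s) (s0 : s != 0).

(** As 2 has value 1, a factor 2 is excluded by parity. For the other representatives [t = 1] works:
    [rho - 1] is twice a unit ([- omega], -1 or [omega - 1]), of odd value below 2. *)
Lemma exclude1 i j k : (a %% 4 = 1)%N -> sq4 K w (s ^+ 2 * rho i j k) -> rho i j k = 1.
Proof.
move=> a1 cl; have two1 := w_two1 a1; have kr := rho_k0 i j k; have nz := rho_neq0 i j k.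
have Mr := k0M kr; have Ms2 : M (s ^+ 2) by insf. have s20 : s ^+ 2 != 0 by rewrite expf_neq0.
have [o0 o1 wo wo1] := w_omega.
have ks : k = false.
  have Mm : M (s ^+ 2 * rho i j k) by insf.
  have := sq4_even Mm (mulf_neq0 s20 nz) cl; rewrite (valM W) // (val_X SM W) //.
  case: (k) => //; rewrite /coset_rep expr1 => -[c e]; exfalso; move: c e.
  have Msp := k0M Ksp; have Mspj : M (sp ^+ j) by insf. have Mi : M ((-1) ^+ i) by insf.
  have i0 : (-1) ^+ i != 0 :> algC by rewrite expf_neq0 // oppr_eq0 oner_neq0.
  have j0 : sp ^+ j != 0 by rewrite expf_neq0.
  have Mij : M ((-1) ^+ i * sp ^+ j) by insf. have ij0 : (-1) ^+ i * sp ^+ j != 0 by rewrite mulf_neq0.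
  have M1 : M (-1) by insf. have Mo : M 1 by insf.
  rewrite (valM W) // (valM W) // (val_X SM W) // ?oppr_eq0 ?oner_neq0 // (val_X SM W) // two1.
  rewrite (w_sp0 NM sKM W pr2 w2) ?(val_N SM W) ?oner_neq0 //; last by apply/eqP => e2; move: p8; rewrite -e2.
  by rewrite (val_1 SM W) !mulr0; move: (w s) => c; clear; lia.
subst k; have K1 : K 1 by insf.
have [->//|ne] := eqVneq (rho i j false) 1; exfalso.
have key X : rho i j false - 1 = 2%:R * X -> k0 X -> X != 0 -> w X = 0 -> False.
  move=> e kX X0 wX; apply: (@dyadic_false s (rho i j false) 1 1) => //; rewrite ?oner_neq0 ?expr1n ?e ?mulf_neq0 ?(val_1 SM W) ?two1 //.
  - exact: K_k0.
  - by rewrite (valM W) ?two1 ?wX //; exact: k0M.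
  - by move=> [c]; clear; lia.
have M1 : M 1 by insf. have oner0 := oner_neq0 algC.
have Mom := k0M omega_k0; have spE := sp_omega.
move: ne key; rewrite /coset_rep expr0 mulr1; case: (i) (j) => [] []; rewrite ?expr0 ?expr1 ?mulr1 ?mul1r ?mulN1r => ne key.
- apply: (key (- omega)); rewrite ?oppr_eq0 ?(val_N SM W) //; last by have ? := omega_k0; insf.
  by rewrite spE; ring.
- apply: (key (- 1)); rewrite ?oppr_eq0 ?(val_N SM W) ?(val_1 SM W) //; last by insf.
  by ring.
- apply: (key (omega - 1)) => //; last by have ? := omega_k0; insf.
  by rewrite {1}spE; ring.
- by rewrite eqxx in ne.
Qed.

Section Ramified.
Variable pi : algC.
Hypotheses (Kpi : K pi) (pi0 : pi != 0) (wpi : w pi = 1) (two2 : w 2%:R = 2).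

(** Here 2 has value 2, so [2 * th * pi] has value 3, and [rh / t ^+ 2 - 1] has value 3 or 1: odd
    and less than 4. *)
Lemma ramified_false rh t th B : k0 rh -> rh != 0 -> sq4 K w (s ^+ 2 * rh) ->
  K t -> t != 0 -> w t = 0 \/ w t = 1 ->
  k0 th -> th != 0 -> w th = 0 -> M B -> vge w 4 B -> rh - t ^+ 2 = 2%:R * (th * pi) + B -> False.
Proof.
move=> kr rh0 cl Kt t0 wt kth th0 wth MB vB e.
have Mth := k0M kth; have Mpi := sKM Kpi; have Mtp : M (th * pi) by insf.
have tp0 : th * pi != 0 by rewrite mulf_neq0.
have Mx : M (2%:R * (th * pi)) by insf. have x0 : 2%:R * (th * pi) != 0 by rewrite mulf_neq0.
have wx : w (2%:R * (th * pi)) = 3 by rewrite (valM W) // (valM W) // two2 wth wpi.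
have [|nz ew] := val_dom SM W Mx MB x0 _ vB; first by rewrite wx.
apply: (@dyadic_false s rh t (3 - 2 * w t)) => //; rewrite ?e ?ew ?wx ?two2 //.
- exact: K_k0.
- by move: (w t) => c; ring.
- by case: wt => ->.
- by case: wt => ->.
- by case: wt => -> [c]; clear; lia.
Qed.

End Ramified.

(** [r ^+ 2] is -1 modulo 4, so [pi = r - 1] is a uniformizer with [pi ^+ 2 = -2 - 2 * pi] modulo 4.
    The sign is fixed to [false] because sqrt(-1) is among the generators in this case. *)
Lemma exclude2 j k : (a %% 4 = 3)%N -> sq4 K w (s ^+ 2 * rho false j k) -> rho false j k = 1.
Proof.
move=> a3 cl; have [Y OY e] := r_sqr; have kr := rho_k0 false j k; have nz := rho_neq0 false j k.
have Da : a = (4 * (a %/ 4) + 3)%N by move: a3; clear; lia.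
have Mre := sKM Kre; have M1 : M 1 by insf.
set Z := (a %/ 4)%:R + 1 - a%:R * Y; have OZ : O Z by rewrite /Z; inri.
have r2 : r ^+ 2 = -1 + 4%:R * Z by rewrite e {1}Da natrD natrM /Z; ring.
have kZ := OZ.1.
have MZ := k0M kZ.
set pi := r - 1; have Kpi : K pi by rewrite /pi; insf.
have Mpi := sKM Kpi.
have M2r : M (- 2%:R * r) by insf. have M4Z : M (4%:R * Z) by insf.
have n20 : - 2%:R != 0 :> algC by rewrite oppr_eq0.
have M2n : M (- 2%:R) by insf.
have pi2 : pi ^+ 2 = - 2%:R * r + 4%:R * Z.
  rewrite /pi; have -> : (r - 1) ^+ 2 = r ^+ 2 + 1 - 2%:R * r by ring.
  by rewrite r2; ring.
have wr : w r = 0.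
  have M4 : M (-1) by insf. have m10 : -1 != 0 :> algC by rewrite oppr_eq0 oner_neq0.
  have [|_] := val_dom SM W M4 M4Z m10 _ (w4 OZ); first by rewrite (val_N SM W) ?(val_1 SM W) ?oner_neq0 //; move: (w 2%:R) w2 => c; clear; lia.
  rewrite -r2 (val_N SM W) ?(val_1 SM W) ?oner_neq0 // (val_X SM W) //.
  by move: (w r) => c; clear; lia.
have w2r : w (- 2%:R * r) = w 2%:R by rewrite (valM W) // (val_N SM W) // wr addr0.
have [|pi20 wpi2] := val_dom SM W M2r M4Z (mulf_neq0 n20 re0) _ (w4 OZ).
  by rewrite w2r; move: (w 2%:R) w2 => c; clear; lia.
rewrite -pi2 w2r in pi20 wpi2.
have pi0 : pi != 0 by apply: contraNneq pi20 => ->; rewrite expr0n.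
have wpi : w pi = 1.
  apply: w_half => //; first by rewrite -wpi2 (val_X SM W).
  by move=> x Kx; exact: (span_shift (sf1 SK0) Kx).
have two2 : w 2%:R = 2 by rewrite -wpi2 (val_X SM W) // wpi.
have pi2' : pi ^+ 2 = 2%:R * (2%:R * Z - 1 - pi) by rewrite pi2 /pi; ring.
have [o0 o1 wo wo1] := w_omega.
have spE := sp_omega; have kom := omega_k0; have Kom := K_k0 kom.
have [_ oc] := c4E; have om2 := omega2.
have Dc : c4 = (2 * c4./2 + 1)%N by clear -oc; lia.
have c0 : c4%:R != 0 :> algC by rewrite pnatr_eq0; case: c4 oc.
have wc := w_odd oc; have kc : k0 c4%:R by insf.
have v4 B : O B -> M (4%:R * B) /\ vge w 4 (4%:R * B).
  move=> OB; have kB := OB.1; have MB := k0M kB; split; first by insf.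
  by have := w4 OB; rewrite two2.
have rf := ramified_false Kpi pi0 wpi two2 kr nz cl.
have Mo : M omega by apply: k0M.
have [t0 wt] : 1 + omega * pi != 0 /\ w (1 + omega * pi) = 0 by apply: w_unit_shift => //; rewrite wpi.
have kone : k0 1 by insf. have w1 := val_1 SM W.
move: rf; rewrite /coset_rep expr0 mul1r; case: (j) (k) => [] []; rewrite ?expr0 ?expr1 ?mulr1 ?mul1r => rf //.
(* The cases are [2 * sp], [sp] and 2. For the first and last, [pi] is the approximate square root.
   For [sp] it is [1 + omega * pi]: the term [2 * (omega - 1 + omega ^+ 2) = 2 * (2 * omega + c4 -
   1)] is divisible by 4, and [2 * pi] is left with the coefficient [omega ^+ 2 - omega = c4]. *)
- have OB : O (omega - Z) by inri.
  have [MB vB] := v4 _ OB; case: (rf pi 1 (4%:R * (omega - Z))) => //; rewrite ?oner_neq0 //; first by right.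
  by rewrite pi2' spE; ring.
- have Ot : O (omega + c4./2%:R - omega ^+ 2 * Z) by inri.
  have [MB vB] := v4 _ Ot.
  case: (rf (1 + omega * pi) c4%:R (4%:R * (omega + c4./2%:R - omega ^+ 2 * Z))) => //; first (by insf); first by left.
  have -> : (1 + omega * pi) ^+ 2 = 1 + 2%:R * omega * pi + omega ^+ 2 * pi ^+ 2 by ring.
  rewrite {1}spE pi2'.
  have Dc' : c4%:R = 2%:R * c4./2%:R + 1 :> algC by rewrite {1}Dc natrD natrM.
  move: c4%:R Dc' om2 {spE pi2 pi2' r2 rf wt t0} => c' Dc'; have -> : c4./2%:R = (c' - 1) / 2%:R :> algC by rewrite Dc'; field.
  by move=> om2; rewrite om2; field.
- have OB : O (1 - Z) by inri.
  have [MB vB] := v4 _ OB; case: (rf pi 1 (4%:R * (1 - Z))) => //; rewrite ?oner_neq0 //; first by right.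
  by rewrite pi2'; ring.
Qed.

(** [r ^+ 2 = 2 * u] with [u] congruent to 1 modulo 2, so [r] is a uniformizer. The approximate
    square root is [1 + c * r] with [c ^+ 2] congruent to [(rho - 1) / 2] modulo 2: [c] is 1,
    [omega] or [omega + 1] for [rho] equal to -1, [sp] or [- sp]. Factors 2 are absorbed by the
    generator sqrt(2) or sqrt(-2). *)
Lemma exclude34 b i j : a = (2 * b)%N -> odd b -> sq4 K w (s ^+ 2 * rho i j false) -> rho i j false = 1.
Proof.
move=> Dab ob cl; have [Y OY e] := r_sqr; have kr := rho_k0 i j false; have nz := rho_neq0 i j false.
have Mre := sKM Kre; have M1 : M 1 by insf.
set u := b%:R - 4%:R * (b%:R * Y).
have r2 : r ^+ 2 = 2%:R * u by rewrite e Dab natrM /u; ring.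
have ObY : O (b%:R * Y) by inri.
have Ou : O u by rewrite /u; inri.
have Mu := k0M Ou.1; have Mb : M b%:R by insf.
have b0 : b%:R != 0 :> algC by rewrite pnatr_eq0; case: (b) ob.
have [wu u0] : w u = 0 /\ u != 0.
  have MbY : M (- (4%:R * (b%:R * Y))) by have MY := k0M OY.1; insf.
  have M4 : M (4%:R * (b%:R * Y)) by have MY := k0M OY.1; insf.
  have [|nu ->] := val_dom SM W Mb MbY b0 _ (vgeN SM W M4 (w4 ObY)); last by rewrite w_odd.
  by rewrite w_odd //; move: (w 2%:R) w2 => c; clear; lia.
have w2r : 2 * w r = w 2%:R by rewrite -(val_X SM W 2 Mre re0) r2 (valM W) // wu addr0.
have wpi : w r = 1.
  apply: w_half => // x Kx.
  by have [X [Y' [kX kY ->]]] := span_shift (sf_nat SK0 0) Kx; exists X, Y'; rewrite subr0.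
have two2 : w 2%:R = 2 by rewrite -w2r wpi.
have [o0 o1 wo wo1] := w_omega.
have spE := sp_omega; have kom := omega_k0; have Kom := K_k0 kom; have Mom := k0M kom.
have [_ oc] := c4E; have om2 := omega2.
have Dc : c4 = (2 * c4./2 + 1)%N by clear -oc; lia.
have Db : b = (2 * b./2 + 1)%N by clear -ob; lia.
have [oo0 wo2] : omega + 1 != 0 /\ w (omega + 1) = 0.
  have Mom1 : M (omega - 1) by insf.
  have v2 : vge w (w 2%:R) 2%:R by right.
  have [|] := val_dom SM W Mom1 M2 o1 _ v2; first by rewrite wo1.
  by have -> : omega - 1 + 2%:R = omega + 1; [ring | rewrite wo1].
have rf := ramified_false Kre re0 wpi two2 kr nz cl.
have w1 := val_1 SM W.
have v4 B : O B -> M (4%:R * B) /\ vge w 4 (4%:R * B).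
  move=> OB; have kB := OB.1; have MB := k0M kB; split; first by insf.
  by have := w4 OB; rewrite two2.
have Oo1 : O (omega + 1) by inri.
have sh th : O th -> 1 + th * r != 0 /\ w (1 + th * r) = 0 by move=> Oth; apply: w_unit_shift => //; rewrite wpi.
have Dc' : c4%:R = 2%:R * c4./2%:R + 1 :> algC by rewrite {1}Dc natrD natrM.
have Du : u = 2%:R * (b./2%:R - 2%:R * (b%:R * Y)) + 1 by rewrite /u {1}Db natrD natrM; ring.
have Ou' : O (b./2%:R - 2%:R * (b%:R * Y)) by inri.
move: (b./2%:R - 2%:R * (b%:R * Y)) Du Ou' => u' Du Ou'.
have K1 : K 1 by insf.
move: rf; rewrite /coset_rep expr0 mulr1; case: (i) (j) => [] []; rewrite ?expr0 ?expr1 ?mulr1 ?mul1r ?mulN1r => rf //.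
- have [t0 wt] := sh _ Oo1; have OB : O (- (2%:R * omega + 3%:R * omega * u' + c4./2%:R * u + u)) by inri.
  have [MB vB] := v4 _ OB.
  case: (rf (1 + (omega + 1) * r) (- (omega + 1)) (4%:R * (- (2%:R * omega + 3%:R * omega * u' + c4./2%:R * u + u)))) => //.
  + by insf.
  + by left.
  + by insf.
  + by rewrite oppr_eq0.
  + by rewrite (val_N SM W) //; insf.
  have -> : (1 + (omega + 1) * r) ^+ 2 = 1 + 2%:R * (omega + 1) * r + (omega ^+ 2 + 2%:R * omega + 1) * r ^+ 2 by ring.
  rewrite {1}spE r2 om2 Dc' Du; ring.
- have O1 : O 1 by inri.
  have [t0 wt] := sh _ O1; rewrite mul1r in t0 wt; have OB : O (- (1 + u')) by inri.
  have [MB vB] := v4 _ OB.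
  have m10 : -1 != 0 :> algC by rewrite oppr_eq0 oner_neq0.
  case: (rf (1 + r) (- 1) (4%:R * (- (1 + u')))) => //.
  + by insf.
  + by left.
  + by insf.
  + by rewrite (val_N SM W) ?oner_neq0.
  have -> : (1 + r) ^+ 2 = 1 + 2%:R * r + r ^+ 2 by ring.
  by rewrite r2 Du; ring.
- have [t0 wt] := sh _ Oom; have OB : O (- (omega * u') - 1 - c4./2%:R * u - u') by inri.
  have [MB vB] := v4 _ OB.
  case: (rf (1 + omega * r) (- omega) (4%:R * (- (omega * u') - 1 - c4./2%:R * u - u'))) => //.
  + by insf.
  + by left.
  + by insf.
  + by rewrite oppr_eq0.
  + by rewrite (val_N SM W).
  have -> : (1 + omega * r) ^+ 2 = 1 + 2%:R * omega * r + omega ^+ 2 * r ^+ 2 by ring.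
  by rewrite {1}spE r2 om2 Dc' Du; ring.
Qed.

End Local.

(** * The Hilbert genus field *)

Section Genus.

Local Notation rho := coset_rep.

Lemma subfield_genus : subfield (hilbert_genus_field K).
Proof.
set H := hilbert_class_field K; have SH : subfield H by exact: subfield_adjoin.
have im s x : galois_group K H s -> H x -> H (s x) by move=> [_ e _] Hx; have : (s @` H) (s x) by [exists x]; rewrite e.
split=> [|x y [Hx fx] [Hy fy]|x y [Hx fx] [Hy fy]]; split; try by insf.
- by move=> _ [s [Es _ _] <-] /=; rewrite !(emb1 Es).
- move=> _ [s Gs <-]; have [Es _ _] := Gs; have ex := fx _ (ex_intro2 _ _ s Gs erefl).
  have ey := fy _ (ex_intro2 _ _ s Gs erefl); rewrite /= in ex ey *.
  by rewrite !(embB SH Es) ?ex ?ey //; exact: im.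
- move=> _ [s Gs <-]; have [Es _ _] := Gs; have ex := fx _ (ex_intro2 _ _ s Gs erefl).
  have ey := fy _ (ex_intro2 _ _ s Gs erefl); rewrite /= in ex ey *.
  by rewrite !(emb_div SH Es) ?ex ?ey //; exact: im.
Qed.

Lemma sub_genus : K `<=` hilbert_genus_field K.
Proof.
move=> x Kx; split; first exact: adjoin_subl.
by move=> _ [s [_ _ fs] <-] /=; rewrite !(fs x Kx).
Qed.

Lemma genus_sqrt d : K d -> d != 0 -> locally_good d -> hilbert_genus_field K (sqrtC d).
Proof.
move=> Kd d0 gd; set H := hilbert_class_field K.
have SH : subfield H by exact: subfield_adjoin.
have Hd : H (sqrtC d).
  apply: adjoin_subr; exists (adjoin K [set sqrtC d]); last exact: adjoin_subr.
  exact: unram_of_locally_good.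
split=> // _ [s Gs <-] /=; have [Es _ fs] := Gs.
have : s (sqrtC d) ^+ 2 == sqrtC d ^+ 2 by rewrite -(embX SH Es) // sqrtCK fs.
by rewrite eqf_sqr => /orP[]/eqP e; rewrite !e // (embN SH Es) // e opprK.
Qed.

Variables (h m n : nat) (q x y : 'I_n -> nat).
Hypothesis (cl_h : class_number k0 h).
Hypothesis (a_fact : (a = \prod_(i < n) q i \/ a = 2 * \prod_(i < n) q i)%N).
Hypothesis (pr_q : forall i, prime (q i) /\ odd (q i)).
Hypothesis (split_q : forall j : 'I_n, (j < m)%N ->
  (x j)%:Z ^+ 2 - p%:Z * (y j)%:Z ^+ 2 = (q j)%:Z ^+ (3 * h)).
Hypothesis (inert_q : forall j : 'I_n, (m <= j)%N -> legendre p (q j) = -1).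

Variable G : set algC.
Hypothesis G_good : forall g, G g -> exists d, [/\ K d, d != 0, locally_good d & g = sqrtC d].
Hypothesis Gq : forall i, G (sqrtC (q_star (q i))).
Hypothesis Ga : forall j : 'I_n, (j < m)%N -> G (sqrtC (alpha_star p (q j) (x j) (y j))).
Hypothesis cases : [\/ (a %% 4 = 1)%N, (a %% 4 = 3)%N /\ G (sqrtC (-1))
  | exists b (sg : bool), [/\ a = (2 * b)%N, odd b & G (sqrtC ((-1) ^+ sg * 2%:R))]].

Local Notation E := (adjoin K G).
Let SE : subfield E := subfield_adjoin K G.
Let sKE : K `<=` E. Proof. exact: adjoin_subl. Qed.

Section Upper.
Variables (M : set algC) (w : algC -> int).
Hypotheses (UM : unr_normal K M) (W : val M w) (w2 : 0 < w 2%:R).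
Let NM : numfield M. Proof. by case: UM. Qed.
Let sKM : K `<=` M. Proof. by case: UM. Qed.
Let unrM : unr K M. Proof. by case: UM. Qed.
Let SM := NM.1.

(** Square classes settled by [E]: their roots lie in [E], and being squares modulo 4 at [w] they
    can be multiplied into a class without changing its dyadic condition. *)
Definition good_sqr d := [/\ K d, d != 0, exists2 s, E s & s ^+ 2 = d & sq4 K w d].
Local Notation P := good_sqr.

Lemma good_sqrM u v : P u -> P v -> P (u * v).
Proof.
move=> [Ku u0 [s Es Ds] [z [Kz z0 cz]]] [Kv v0 [t Et Dt] [z' [Kz' z0' cz']]].
split; [by insf | by rewrite mulf_neq0 | by exists (s * t); [insf | rewrite exprMn Ds Dt] |].
exists (z * z'); split; [by insf | by rewrite mulf_neq0 |].
have e : u * v * (z * z') ^+ 2 - 1 = (u * z ^+ 2 - 1) * (v * z' ^+ 2) + (v * z' ^+ 2 - 1) by ring.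
have M1 : M 1 by insf.
have Mu : M (u * z ^+ 2 - 1) by apply: sKM; insf.
have Mv : M (v * z' ^+ 2 - 1) by apply: sKM; insf.
have Mv' : M (v * z' ^+ 2) by apply: sKM; insf.
have vv : vge w 0 (v * z' ^+ 2).
  rewrite -[v * _](subrK 1); apply: (valD W) => //; last exact: (vge_1 SM W).
  by apply: vge_le cz'; rewrite mulr_ge0 // ltW.
by rewrite e; apply: (valD W) => //; [insf | exact: (vgeMr W)].
Qed.

Lemma good_sqr_sqr z : K z -> z != 0 -> P (z ^+ 2).
Proof.
move=> Kz z0; split; [by insf | by rewrite expf_neq0 | by exists z => //; exact: sKE |].
exists z^-1; split; [by insf | by rewrite invr_eq0 |].
by rewrite -exprMn divff // expr1n subrr; left.
Qed.

Lemma good_sqr_gen d : G (sqrtC d) -> P d.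
Proof.
move=> Gd; have [d' [Kd d0 gd e]] := G_good Gd.
have {}e : d = d' by rewrite -[d]sqrtCK e sqrtCK.
subst d'; split=> //; first by exists (sqrtC d); [exact: adjoin_subr | rewrite sqrtCK].
exact: (gd M w 2%N NM sKM W isT w2).1.
Qed.

(** Good up to one of the eight [coset_rep]. This is the multiplicative set to which [delta_gen] is
    applied; [near_good] then removes the representative. *)
Definition near_sqr d := K d /\ exists i j k, P (d * rho i j k).
Local Notation N := near_sqr.

Lemma rhoM i j k i' j' k' : exists z, [/\ K z, z != 0 &
  rho i j k * rho i' j' k' = rho (i (+) i') (j (+) j') (k (+) k') * z ^+ 2].
Proof.
have two0 : 2%:R != 0 :> algC by rewrite pnatr_eq0.
have bM (u : algC) (b c : bool) : u ^+ b * u ^+ c = u ^+ (b (+) c) * (u ^+ (b && c)) ^+ 2.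
  by case: b c => [] []; rewrite /= ?expr0 ?expr1 ?expr1n; ring.
exists ((-1) ^+ (i && i') * sp ^+ (j && j') * 2%:R ^+ (k && k')); split.
- by have Ks := K_k0 Ksp; insf.
- by rewrite !mulf_neq0 ?expf_neq0 // oppr_eq0 oner_neq0.
rewrite /coset_rep.
have -> : (-1) ^+ i * sp ^+ j * 2%:R ^+ k * ((-1) ^+ i' * sp ^+ j' * 2%:R ^+ k') =
  ((-1) ^+ i * (-1) ^+ i') * (sp ^+ j * sp ^+ j') * (2%:R ^+ k * 2%:R ^+ k') :> algC by ring.
by rewrite !bM !exprMn; ring.
Qed.

Lemma near_sqrM u v : N u -> N v -> N (u * v).
Proof.
move=> [Ku [i [j [k Pu]]]] [Kv [i' [j' [k' Pv]]]]; split; first by insf.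
exists (i (+) i'), (j (+) j'), (k (+) k'); have [z [Kz z0 e]] := rhoM i j k i' j' k'.
have := good_sqrM (good_sqrM Pu Pv) (good_sqr_sqr (sfV SK Kz) (invr_neq0 z0)).
have -> // : u * rho i j k * (v * rho i' j' k') * z^-1 ^+ 2 = u * v * rho (i (+) i') (j (+) j') (k (+) k').
have -> : u * rho i j k * (v * rho i' j' k') = u * v * (rho i j k * rho i' j' k') by ring.
by rewrite e; field.
Qed.

Lemma good_near d : P d -> N d.
Proof.
move=> Pd; split; first by case: Pd.
by exists false, false, false; rewrite /coset_rep !expr0 !mulr1.
Qed.

Lemma near_sqr_sqr z : K z -> z != 0 -> N (z ^+ 2).
Proof. by move=> Kz z0; apply/good_near/good_sqr_sqr. Qed.

Lemma near_rho i j k : N (rho i j k).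
Proof.
have kr := rho_k0 i j k; split; first exact: K_k0.
by exists i, j, k; rewrite -expr2; apply: good_sqr_sqr; [exact: K_k0 | exact: rho_neq0].
Qed.

Lemma near_m1 : N (-1).
Proof. by have := near_rho true false false; rewrite /coset_rep !expr0 expr1 !mulr1. Qed.

Lemma near_sp : N sp.
Proof. by have := near_rho false true false; rewrite /coset_rep !expr0 expr1 mulr1 mul1r. Qed.

Lemma near_two : N 2%:R.
Proof. by have := near_rho false false true; rewrite /coset_rep !expr0 expr1 !mul1r. Qed.

Lemma near_sqr1 : N 1.
Proof. by rewrite -(expr1n _ 2); apply: near_sqr_sqr; rewrite ?oner_neq0 //; insf. Qed.

Lemma near_signM (k : nat) u : N u -> N ((-1) ^+ k * u).
Proof.
move=> Nu; apply: near_sqrM => //; rewrite -signr_odd; case: (odd k); rewrite ?expr0 ?expr1.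
  exact: near_m1.
exact: near_sqr1.
Qed.

Lemma near_q i : N (q i)%:R.
Proof.
have -> : (q i)%:R = (-1) ^+ (q i).-1./2 * q_star (q i) by rewrite /q_star signrMK.
by apply/near_signM/good_near/good_sqr_gen/Gq.
Qed.

Lemma near_alpha (j : 'I_n) : (j < m)%N -> N (alpha p (x j) (y j)).
Proof.
move=> jm; have [b [c e]] := alpha_starE (q j) (x j) (y j).
have Ng := good_near (good_sqr_gen (Ga jm)).
have spc0 : sp ^+ c != 0 by rewrite expf_neq0.
have -> : alpha p (x j) (y j) = (-1) ^+ b * (alpha_star p (q j) (x j) (y j) * sp ^+ c * (sp ^+ c)^-1 ^+ 2).
  by rewrite e -!mulrA signrMK; field.
apply/near_signM; apply: near_sqrM.
  by apply: near_sqrM => //; case: (c); rewrite ?expr1 ?expr0; [exact: near_sp | exact: near_sqr1].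
by apply: near_sqr_sqr; [have Ks := K_k0 Ksp; insf | rewrite invr_eq0].
Qed.

Lemma near_a : N a%:R.
Proof.
have Np : N (\prod_(i < n) q i)%:R.
  by rewrite natr_prod; elim/big_ind: _ => //; [exact: near_sqr1 | exact: near_sqrM | move=> i _; exact: near_q].
by case: a_fact => ->; rewrite ?natrM //; apply: near_sqrM => //; exact: near_two.
Qed.

(** [beta] is a square in K, which identifies the class of [eps] with that of [- (a * sp)]. *)
Lemma near_eps : N eps.
Proof.
have aC : a%:R != 0 :> algC by rewrite pnatr_eq0 -lt0n.
have as0 : a%:R * sp != 0 by rewrite mulf_neq0.
have -> : eps = (-1) ^+ 1 * (rb ^+ 2 * (a%:R * sp) * (a%:R * sp)^-1 ^+ 2).
  by rewrite rb2 /quartic_gen; field; rewrite sp0.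
have Ks := K_k0 Ksp.
apply: near_signM; apply: near_sqrM; last by apply: near_sqr_sqr; [insf | rewrite invr_eq0].
by apply: near_sqrM; [exact: near_sqr_sqr | apply: near_sqrM; [exact: near_a | exact: near_sp]].
Qed.

(** For a square of [M] the dyadic exclusions force the representative to be 1. In the cases with an
    extra generator, [change] first uses it to remove the sign or the factor 2 from the
    representative. *)
Lemma near_good s : M s -> s != 0 -> N (s ^+ 2) -> P (s ^+ 2).
Proof.
move=> Ms s0 [Kd [i [j [k Pd]]]].
have rhoN i' j' k' : P (s ^+ 2 * rho i' j' k') -> rho i' j' k' = 1 -> P (s ^+ 2).
  by move=> + e; rewrite e mulr1.
have cl i' j' k' : P (s ^+ 2 * rho i' j' k') -> sq4 K w (s ^+ 2 * rho i' j' k') by case.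
have change i1 j1 k1 u : P u -> u = rho i1 j1 k1 -> P (s ^+ 2 * rho (i (+) i1) (j (+) j1) (k (+) k1)).
  move=> Pu e; have [z [Kz z0 e']] := rhoM i j k i1 j1 k1; rewrite e in Pu.
  have := good_sqrM (good_sqrM Pd Pu) (good_sqr_sqr (sfV SK Kz) (invr_neq0 z0)).
  by rewrite -(mulrA (s ^+ 2)) e' mulrA -(mulrA _ (z ^+ 2)) -exprMn divff // expr1n mulr1.
case: cases => [a1|[a3 Gm1]|[b [sg [ab ob G2]]]].
- apply: (rhoN i j k Pd); apply: (exclude1 NM sKM unrM W w2 Ms s0 a1).
  exact: cl.
- have Pm1 := good_sqr_gen Gm1.
  have Pi : P (s ^+ 2 * rho false j k).
    case: (i) Pd change => // Pd' /(_ true false false _ Pm1).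
    by rewrite !addbF; apply; rewrite /coset_rep expr1 !expr0 !mulr1.
  apply: (rhoN false j k Pi).
  by apply: (exclude2 NM sKM unrM W w2 Ms s0 a3); exact: cl.
have P2 := good_sqr_gen G2.
have [i1 Pi] : exists i1, P (s ^+ 2 * rho i1 j false).
  case ek : k; last by exists i; rewrite ek in Pd.
  have := change sg false true _ P2; rewrite /coset_rep expr0 expr1 mulr1 => /(_ erefl) Pi.
  by exists (i (+) sg); move: Pi; rewrite ek addbF.
apply: (rhoN i1 j false Pi).
by apply: (exclude34 NM sKM unrM W w2 Ms s0 ab ob); exact: cl.
Qed.

Lemma sqrt_in_E u : M u -> K (u ^+ 2) -> E u.
Proof.
move=> Mu Ku; have [->|u0] := eqVneq u 0; first exact: sf0.
have [d [z [kd d0 Kz z0 e]]] := descent UM Mu u0 Ku.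
have Mz := sKM Kz; pose s := u / z; have Ms : M s by rewrite /s; insf.
have Ds : s ^+ 2 = d by rewrite /s expr_div_n e; field.
have s0 : s != 0 by rewrite mulf_neq0 ?invr_eq0.
have Nd : N d.
  apply: (delta_gen cl_h a_fact pr_q split_q inert_q UM Ms Ds kd d0).
  - exact: near_sqrM.
  - by move=> v kv v0; apply: near_sqr_sqr => //; exact: K_k0.
  - exact: near_m1.
  - exact: near_eps.
  - exact: near_two.
  - exact: near_sp.
  - exact: near_q.
  - exact: near_alpha.
rewrite -Ds in Nd; have [_ _ [t Et Dt] _] := near_good Ms s0 Nd.
have Ez := sKE Kz; have -> : u = s * z by rewrite /s divfK.
have := Dt => /eqP; rewrite eqf_sqr => /orP[/eqP <-|/eqP tE]; first by insf.
have -> : s = - t by rewrite tE opprK.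
by insf.
Qed.

End Upper.

Lemma genus_eq : hilbert_genus_field K = E.
Proof.
apply/seteqP; split=> u; last first.
  apply: adjoin_min; [exact: subfield_genus | exact: sub_genus | move=> g /G_good[d [Kd d0 gd ->]]].
  exact: genus_sqrt.
move=> gu; apply: (genus_eigen NK SE gu) => v Hv eig.
have [M UM Mv] := hilbert_unr_normal NK Hv; have [NM _ _ _] := UM.
have [w W w2] := val_exists_over NM (isT : prime 2).
apply: (sqrt_in_E UM W w2 Mv); apply: (galois_fixed NK) => nu fnu.
by rewrite rmorphXn; case: (eig nu fnu) => ->; rewrite ?sqrrN.
Qed.

End Genus.

End QuadraticField.

Theorem theorem4p5 (p : nat) (eps : algC) (h a m n : nat)
    (q x y : 'I_n -> nat) :
  let k0 := Qadjoin [set sqrtC p%:R] in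
  let K := Qadjoin [set sqrtC (- (a%:R * eps * sqrtC p%:R))] in
  let Q := [set sqrtC (q_star (q i)) | i in [set: 'I_n]] in
  let A := [set sqrtC (alpha_star p (q j) (x j) (y j))
           | j in [set j : 'I_n | (j < m)%N]] in
  prime p -> (p %% 8 = 5)%N ->
  fundamental_unit k0 eps ->
  class_number k0 h ->
  (0 < a)%N -> square_free a -> coprime a p ->
  (a = \prod_(i < n) q i \/ a = 2 * \prod_(i < n) q i)%N ->
  injective q ->
  (forall i, prime (q i) /\ odd (q i)) ->
  (m <= n)%N ->
  (forall j : 'I_n, (j < m)%N -> legendre p (q j) = 1) ->
  (forall j : 'I_n, (m <= j)%N -> legendre p (q j) = -1) ->
  (forall j : 'I_n, (j < m)%N ->
     [/\ (x j)%:Z ^+ 2 - p%:Z * (y j)%:Z ^+ 2 = (q j)%:Z ^+ (3 * h),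
         (q j %% 4 = 1)%N -> odd (x j) /\ ~~ odd (y j)
       & (q j %% 4 = 3)%N -> ~~ odd (x j) /\ odd (y j)]) ->
  [/\ (a %% 4 = 1)%N ->
        hilbert_genus_field K = adjoin K (Q `|` A),
      (a %% 4 = 3)%N ->
        hilbert_genus_field K = adjoin K ([set sqrtC (-1)] `|` Q `|` A),
      (a = 2 * \prod_(i < n) q i)%N -> (\prod_(i < n) q i %% 4 = 1)%N ->
        hilbert_genus_field K = adjoin K ([set sqrtC 2] `|` Q `|` A)
    & (a = 2 * \prod_(i < n) q i)%N -> (\prod_(i < n) q i %% 4 = 3)%N ->
        hilbert_genus_field K = adjoin K ([set sqrtC (-2)] `|` Q `|` A)].
Proof.
move=> k0 K Q A pr_p p8 fu cl_h a_gt0 sqf co_ap a_fact _ pr_q _ _ inert_q xyq.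
have [tau tau_sp] := tau_exists pr_p.
have split_q (j : 'I_n) : (j < m)%N -> (x j)%:Z ^+ 2 - p%:Z * (y j)%:Z ^+ 2 = (q j)%:Z ^+ (3 * h).
  by move=> /xyq[].
have SK : subfield K := subfield_adjoin _ _.
have kK := K_k0 pr_p p8 tau_sp fu a_gt0.
have q2a i : ~~ (q i ^ 2 %| a)%N.
  by apply/negP => /sqf q1; have [] := pr_q i; rewrite q1.
have goodQA g : (Q `|` A) g -> exists d, [/\ K d, d != 0, locally_good p eps a d & g = sqrtC d].
  move=> [[i _ <-]|[j jm <-]].
    have [pr oq] := pr_q i; exists (q_star (q i)); split=> //.
    - by rewrite /q_star; insf.
    - by rewrite /q_star mulf_neq0 ?expf_neq0 ?oppr_eq0 ?oner_neq0 // pnatr_eq0 -lt0n prime_gt0.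
    - exact: (locally_good_q_star pr_p p8 tau_sp fu a_gt0 co_ap pr (q_dvd_a a_fact i) (q2a i) oq).
  have [pr oq] := pr_q j; have [N par1 par3] := xyq j jm.
  have [b [c e]] := alpha_starE p (q j) (x j) (y j).
  exists (alpha_star p (q j) (x j) (y j)); split=> //.
  - by apply: kK; have ka := @alpha_k0 p (x j) (y j); have ks := @k0_sp p; have S0 := sf_k0 p; rewrite e; insf.
  - rewrite e !mulf_neq0 ?expf_neq0 ?oppr_eq0 ?oner_neq0 ?(sp_neq0 pr_p) //.
    exact: (alpha_neq0 tau_sp pr N).
  - exact: (locally_good_alpha_star pr_p p8 tau_sp fu a_gt0 co_ap pr (q_dvd_a a_fact j) (q2a j) oq N par1 par3).
have main G : (forall g, G g -> exists d, [/\ K d, d != 0, locally_good p eps a d & g = sqrtC d]) ->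
    (Q `|` A) `<=` G ->
    [\/ (a %% 4 = 1)%N, (a %% 4 = 3)%N /\ G (sqrtC (-1))
     | exists b (sg : bool), [/\ a = (2 * b)%N, odd b & G (sqrtC ((-1) ^+ sg * 2%:R))]] ->
    hilbert_genus_field K = adjoin K G.
  move=> goodG QAG; apply: (genus_eq pr_p p8 tau_sp fu a_gt0 co_ap cl_h a_fact pr_q split_q inert_q) => //.
  - by move=> i; apply: QAG; left; exists i.
  - by move=> j jm; apply: QAG; right; exists j.
have extend d : K d -> d != 0 -> locally_good p eps a d ->
    (forall g, ([set sqrtC d] `|` Q `|` A) g -> exists d, [/\ K d, d != 0, locally_good p eps a d & g = sqrtC d]) /\
    (Q `|` A) `<=` [set sqrtC d] `|` Q `|` A.
  move=> Kd d0 gd; rewrite -setUA; split=> [g [->|/goodQA //]|g QAg]; first by exists d.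
  by right.
have two0 : 2%:R != 0 :> algC by rewrite pnatr_eq0.
split=> [a1|a3|ab b4|ab b4].
- by apply: main => //; constructor 1.
- have [| | |good sub] := extend (-1); [by insf | by rewrite oppr_eq0 oner_neq0 | |].
    exact: (locally_good_m1 pr_p p8 tau_sp fu a_gt0 a3).
  by apply: main => //; constructor 2; split=> //; do 2!left.
- have := locally_good_two pr_p p8 tau_sp fu a_gt0 (sg := false) ab b4; rewrite expr0 mul1r => g2.
  have [| | |good sub] := extend 2%:R => //; first by insf.
  apply: main => //; constructor 3; exists (\prod_(i < n) q i)%N, false; split=> //.
    by move: b4; clear; lia.
  by rewrite expr0 mul1r; do 2!left.
- have := locally_good_two pr_p p8 tau_sp fu a_gt0 (sg := true) ab b4; rewrite expr1 mulN1r => g2.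
  have [| | |good sub] := extend (- 2%:R) => //; [by insf | by rewrite oppr_eq0 |].
  apply: main => //; constructor 3; exists (\prod_(i < n) q i)%N, true; split=> //.
    by move: b4; clear; lia.
  by rewrite expr1 mulN1r; do 2!left.
Qed.
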